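(* Let $(\theta_0,f_0)\in\Theta\times H$ be such that $\tilde i_{\theta_0,f_0}>0$. Suppose there are constants $D_1,D_2,D_3,D_4$ such that for all $\theta,\theta_0\in\Theta$ and all $f\in H$: (i) $\|K_\theta f\|_{H_2}\le D_1\|f\|_{H_1}$ and $\|\dot K_\theta f\|_{H_2}\le D_1\|f\|_{H_1}$; (ii) $\|(K_\theta-K_{\theta_0})f\|_S\le D_2|\theta-\theta_0|\,\|f\|_H$; (iii) $\|(K_\theta-K_{\theta_0}-(\theta-\theta_0)\dot K_{\theta_0})f\|_S\le D_3|\theta-\theta_0|^2\|f\|_H$; (iv) $\|\dot K_{\theta_0}(f-f_0)\|_S\le D_4\|f-f_0\|_H$. Assume that for $M$ large enough the posterior mass of $\{f:\|f\|_H<M\}$ tends to $1$. Assume that the posterior is consistent at $(\theta_0,f_0)$ with respect to the semi-metric $|\theta-\theta_0|+\|K_{\theta_0}(f-f_0)\|_{H_2}$ and with respect to $\|\dot K_{\theta_0}(f-f_0)\|_{H_2}$. Assume that there is a sequence $\gamma_n\in H$ with $\|\gamma_n-\gamma_{\theta_0,f_0}\|_{H_1}\le\rho_n$ for some $\rho_n\downarrow 0$. Finally, assume that there exist subsets $\Theta_n\subset\Theta$ and $H_n\subset H$ such that $\sqrt n(\Theta_n-\theta_0)\uparrow\mathbb R$ and, in $P^n_{\theta_0,f_0}$-probability for the random quantities, $$\Pi(\Theta_n\times H_n\mid X^{(n)})\to 1,\qquad \inf_{\theta\in\Theta_n}\Pi^{\theta=\theta_0}\bigl(H_n+(\theta-\theta_0)\gamma_n\mid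 X^{(n)}\bigr)\to 1,$$ $$\sqrt n\sup_{f\in H_n}\bigl|\langle K_{\theta_0}(f-f_0),K_{\theta_0}(\gamma_{\theta_0,f}-\gamma_n)\rangle_{H_2}\bigr|\to 0,$$ $$\sup_{\theta\in\Theta_n,\,f\in H_n}\left|\frac{\log\bigl(d\pi_{f+(\theta-\theta_0)\gamma_n}/d\pi_f\bigr)(f)}{1+n(\theta-\theta_0)^2}\right|\to 0.$$ Then the Bernstein-von Mises theorem holds at $(\theta_0,f_0)$.
   Context: Setting. $\Theta\subset\mathbb R$ is compact, $H_1,H_2$ are separable Hilbert spaces, $\{K_\theta:H_1\to H_2,\ \theta\in\Theta\}$ are continuous linear operators, and $H\subseteq H_1$ is a linear subspace with a norm $\|\cdot\|_H$. The derivative $\dot K_\theta f:=\lim_{t\to0}(K_{\theta+t}f-K_\theta f)/t$ ($H_2$-norm limit) is assumed to exist. Model. One observes $X^{(n)}=K_\theta f+n^{-1/2}\dot W$ with $\dot W$ the iso-Gaussian process of $H_2$: for $h\in H_2$, $\langle h,X^{(n)}\rangle=\langle K_\theta f,h\rangle_{H_2}+n^{-1/2}\langle h,\dot W\rangle$, where $(\langle h,\dot W\rangle)_{h\in H_2}$ is centered Gaussian with covariance $\langle h,h'\rangle_{H_2}$. $P^n_{\theta,f}$ is the law of $X^{(n)}$ and, with $P_0^n$ the law of $n^{-1/2}\dot W$, $\log\frac{dP^n_{\theta,f}}{dP^n_0}(X^{(n)})=n\langle K_\theta f,X^{(n)}\rangle-\frac n2\|K_\theta f\|_{H_2}^2$.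 Prior and posterior. $\Pi=\pi_\theta\times\pi_f$, where $\pi_\theta$ has a positive Lebesgue density on $\Theta$ and $\pi_f$ is a probability distribution supported on $H$. $\Pi(\cdot\mid X^{(n)})$ is the posterior of $(\theta,f)$; $\Pi^{\theta=\theta_0}(\cdot\mid X^{(n)})$ is the posterior of $f$ under prior $\pi_f$ in the model where $\theta=\theta_0$ is known. For $g\in H$, $\pi_{f+g}$ is the law of $f+g$ when $f\sim\pi_f$. The data are generated from $P^n_{\theta_0,f_0}$; ''posterior mass tends to 1'' means in $P^n_{\theta_0,f_0}$-probability as $n\to\infty$. The posterior is consistent at $(\theta_0,f_0)$ w.r.t. a semi-metric $d$ if $\Pi(d((\theta,f),(\theta_0,f_0))<\delta_n\mid X^{(n)})\to1$ in $P^n_{\theta_0,f_0}$-probability for some $\delta_n\downarrow0$. Least favourable direction. $\gamma_{\theta,f}\in H$ denotes an element with $\langle\dot K_\theta f-K_\theta\gamma_{\theta,f},K_\theta h\rangle_{H_2}=0$ for all $h\in H$ (assumed to exist whenever it is used). The efficient Fisher information is $\tilde i_{\theta,f}=\|\dot K_\theta f-K_\theta\gamma_{\theta,f}\|_{H_2}^2=\|\dot K_\theta f\|_{H_2}^2-\|K_\theta\gamma_{\theta,f}\|_{H_2}^2$. Space $S$. $S\subset H_2$ is a normed space with norm $\|\cdot\|_S$ stronger than that of $H_2$, with $K_\theta H\subset S$, and $\int_0^1\sqrt{\log N(\varepsilon,\{h:\|h\|_S\le1\},\|\cdot\|_{H_2})}\,d\varepsilon<\infty$, where $N(\varepsilon,A,d)$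 is the minimal number of $d$-balls of radius $\varepsilon$ covering $A$. Bernstein-von Mises. ''The Bernstein-von Mises theorem holds at $(\theta_0,f_0)$'' means that, in $P^n_{\theta_0,f_0}$-probability as $n\to\infty$, $\bigl\|\Pi(\theta\in\cdot\mid X^{(n)})-N\bigl(\theta_0+\tfrac1{\sqrt n}\Delta^n_{\theta_0,f_0},\tfrac1n\tilde i_{\theta_0,f_0}^{-1}\bigr)\bigr\|_{TV}\to0$, where $\Delta^n_{\theta_0,f_0}=\tilde i_{\theta_0,f_0}^{-1}\langle\dot K_{\theta_0}f_0-K_{\theta_0}\gamma_{\theta_0,f_0},\dot W\rangle\sim N(0,\tilde i_{\theta_0,f_0}^{-1})$, with $\dot W=\sqrt n(X^{(n)}-K_{\theta_0}f_0)$, and $\|P-Q\|_{TV}=2\sup_F|P(F)-Q(F)|$.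
   Formalization: The positive Lebesgue density of the prior on θ is additionally assumed to be continuous at θ_0 (relative to Θ); for a density with a jump at θ_0 the claim fails, since the rescaled posterior keeps the jump and is not asymptotically normal. *)

(* Defs.v *)
From HB Require Import structures.
From mathcomp Require Import all_boot all_order all_algebra.
From mathcomp Require Import all_classical all_reals all_analysis.

Set Implicit Arguments.
Unset Strict Implicit.
Unset Printing Implicit Defensive.

Import Order.TTheory GRing.Theory Num.Theory.
Import numFieldNormedType.Exports.

Local Open Scope classical_set_scope.
Local Open Scope ring_scope.

HB.mixin Record NormedModule_isInnerProduct (R : realType) V
    & NormedModule R V := {
  inner : V -> V -> R ;
  innerC : forall x y, inner x y = inner y x ;
  inner_linearl : forall a x y z,
    inner (a *: x + y) z = a * inner x z + inner y z ;
  inner_norm : forall x, inner x x = `|x| ^+ 2 }.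

#[short(type="hilbertType")]
HB.structure Definition Hilbert (R : realType) :=
  { V of NormedModule_isInnerProduct R V & CompleteNormedModule R V }.

Definition separable (T : topologicalType) : Prop :=
  exists2 A : set T, countable A & dense A.

(* A linear subspace with its own norm; [ns_norm] is meaningless outside
   [ns_set]. *)
Record normed_subspace (R : realType) (V : lmodType R) := NormedSubspace {
  ns_set : set V ;
  ns_norm : V -> R ;
  ns_set0 : ns_set 0 ;
  ns_set_linear : forall a x y, ns_set x -> ns_set y -> ns_set (a *: x + y) ;
  ns_norm0_eq0 : forall x, ns_set x -> ns_norm x = 0 -> x = 0 ;
  ns_normZ : forall a x, ns_set x -> ns_norm (a *: x) = `|a| * ns_norm x ;
  ns_normD : forall x y, ns_set x -> ns_set y ->
    ns_norm (x + y) <= ns_norm x + ns_norm y }.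

(* A bound on a norm of the subspace includes membership in the subspace. *)
Definition ns_le (R : realType) (V : lmodType R) (N : normed_subspace V)
  (x : V) (c : R) : Prop := ns_set N x /\ ns_norm N x <= c.

Definition stronger_norm (R : realType) (V : normedModType R)
  (N : normed_subspace V) : Prop :=
  exists C : R, forall x, ns_set N x -> `|x| <= C * ns_norm N x.

(* +oo when no finite family of balls covers A *)
Definition covering_number (R : realType) (V : normedModType R) (e : R)
  (A : set V) : \bar R :=
  ereal_inf [set (m%:R)%:E | m in [set m : nat |
    exists c : 'I_m -> V, A `<=` \bigcup_i ball (c i) e]].

Definition finite_entropy_integral (R : realType) (V : normedModType R)
  (N : normed_subspace V) : Prop :=
  (\int[lebesgue_measure]_(e in `]0%R, 1%R[)
     sqrte (lne (covering_number e [set h | ns_le N h 1])) < +oo)%E.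

Definition borel (T : ptopologicalType) := g_sigma_algebraType (@open T).

(* The case s = 0 is separated because [normal_prob m 0] is not the point mass
   at m. *)
Definition gaussian_law (R : realType) (m s : R) (A : set (measurableTypeR R)) :
  \bar R := if s == 0 then \d_m A else normal_prob m s A.

Definition gaussian_rv (R : realType) d (Omega : measurableType d)
  (P : probability Omega R) (X : Omega -> measurableTypeR R) : Prop :=
  measurable_fun setT X /\
  exists m s : R, 0 <= s /\
    forall A, measurable A -> P (X @^-1` A) = gaussian_law m s A.

Definition gaussian_process (R : realType) d (Omega : measurableType d)
  (P : probability Omega R) (I : Type) (W : I -> Omega -> R) : Prop :=
  forall (m : nat) (a : 'I_m -> R) (h : 'I_m -> I),
    gaussian_rv P (fun w => \sum_(i < m) a i * W (h i) w).

(* The iso-Gaussian process of V, in a version that is jointly measurable in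
   the index and the sample point.  Such a version exists when V is separable;
   it is what makes the likelihood below measurable in the parameter. *)
Definition iso_gaussian (R : realType) d (Omega : measurableType d)
  (P : probability Omega R) (V : hilbertType R) (W : V -> Omega -> R) : Prop :=
  [/\ gaussian_process P W,
      forall h, ('E_P[W h] = 0)%E,
      forall h h', covariance P (W h) (W h') = (inner h h')%:E &
      measurable_fun setT
        ((fun p => W p.1 p.2) : borel V * Omega -> measurableTypeR R)].

(* [mu_ext P] is the outer measure of P, so that Y need not be measurable. *)
Definition cvg_in_prob (R : realType) d (Omega : measurableType d)
  (P : probability Omega R) (Y : nat -> Omega -> \bar R) (c : \bar R) : Prop :=
  forall e : R, 0 < e ->
    mu_ext P [set w | (e%:E <= `|Y n w - c|)%E] @[n --> \oo] --> 0%E.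

Definition tv_norm (R : realType) d (T : measurableType d)
  (mu nu : set T -> \bar R) : \bar R :=
  (2%:E * ereal_sup [set `|mu F - nu F| | F in measurable])%E.

Definition is_density (R : realType) d (T : measurableType d)
  (nu : set T -> \bar R) (mu : {measure set T -> \bar R}) (p : T -> R) : Prop :=
  [/\ forall x, 0 <= p x,
      measurable_fun setT (p : T -> measurableTypeR R) &
      forall A, measurable A -> nu A = (\int[mu]_(x in A) (p x)%:E)%E].

(* q is a density of pi with respect to Lebesgue measure on Theta, positive on
   Theta and continuous at th0 relative to Theta. *)
Definition positive_density (R : realType) (Theta : set R) (th0 : R)
  (pi : probability (measurableTypeR R) R) : Prop :=
  exists q : R -> R,
    [/\ measurable_fun Theta (q : measurableTypeR R -> measurableTypeR R),
        forall th, Theta th -> 0 < q th,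
        q th @[th --> within Theta (nbhs th0)] --> q th0 &
        forall A : set (measurableTypeR R), measurable A ->
          pi A = (\int[lebesgue_measure]_(th in A `&` Theta) (q th)%:E)%E].

(* The process X^(n) = K_theta f + n^(-1/2) W, with h = K_theta f *)
Definition observation (R : realType) (V : hilbertType R) (Omega : Type)
  (W : V -> Omega -> R) (n : nat) (h : V) (w : Omega) : V -> R :=
  fun v => inner h v + (Num.sqrt n%:R)^-1 * W v w.

(* dP_h/dP_0 at the path x, with P_0 the law of n^(-1/2) W *)
Definition likelihood (R : realType) (V : hilbertType R) (n : nat)
  (x : V -> R) (h : V) : R :=
  expR (n%:R * x h - n%:R / 2 * `|h| ^+ 2).

(* Bayes's formula, for a prior mu supported on D and the signal m p at the
   parameter p *)
Definition posterior (R : realType) (V : hilbertType R) d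
  (T : measurableType d) (mu : {measure set T -> \bar R}) (D : set T)
  (m : T -> V) (n : nat) (x : V -> R) (B : set T) : \bar R :=
  ((\int[mu]_(p in B `&` D) (likelihood n x (m p))%:E) /
   (\int[mu]_(p in D) (likelihood n x (m p))%:E))%E.

Section inverse_problem.
Variables (R : realType) (H1 H2 : hilbertType R) (K : R -> {linear H1 -> H2}).
Variables (Theta : set R) (H : normed_subspace H1).

(* Points t with th + t outside Theta are excluded from the limit. *)
Definition Kdot_quotient (th : R) (f : H1) (t : R) : H2 :=
  t^-1 *: (K (th + t) f - K th f).

Definition Kdot_filter (th : R) : set_system R :=
  within [set t | Theta (th + t)] 0^'.

Definition Kdot (th : R) (f : H1) : H2 :=
  lim (Kdot_quotient th f t @[t --> Kdot_filter th]).

Definition Kdot_exists (th : R) (f : H1) : Prop :=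
  cvg (Kdot_quotient th f t @[t --> Kdot_filter th]).

Definition least_favourable (th : R) (f gam : H1) : Prop :=
  ns_set H gam /\
  forall h, ns_set H h -> inner (Kdot th f - K th gam) (K th h) = 0.

(* gam is the least favourable direction at (th, f). *)
Definition eff_info (th : R) (f gam : H1) : R := `|Kdot th f - K th gam| ^+ 2.

Definition param_set : set (measurableTypeR R * borel H1) :=
  Theta `*` ns_set H.

Definition joint_posterior (pi_theta : probability (measurableTypeR R) R)
    (pi_f : probability (borel H1) R) (n : nat) (x : H2 -> R)
    (B : set (measurableTypeR R * borel H1)) : \bar R :=
  posterior (pi_theta \x pi_f)%E param_set (fun p => K p.1 p.2) n x B.

Definition known_theta_posterior (th0 : R) (pi_f : probability (borel H1) R)
    (n : nat) (x : H2 -> R) (B : set (borel H1)) : \bar R :=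
  posterior pi_f (ns_set H) (fun f => K th0 f) n x B.

Section data.
Variables (pi_theta : probability (measurableTypeR R) R).
Variables (pi_f : probability (borel H1) R).
Variables (d : measure_display) (Omega : measurableType d).
Variables (P : probability Omega R) (W : H2 -> Omega -> R).
Variables (th0 : R) (f0 : H1).

(* The data X^(n) ~ P^n_{th0, f0} *)
Definition data (n : nat) (w : Omega) : H2 -> R :=
  observation W n (K th0 f0) w.

(* dist th f stands for d((th, f), (th0, f0)). *)
Definition consistent (dist : R -> H1 -> R) : Prop :=
  exists delta : nat -> R,
    [/\ {homo delta : m n / (m <= n)%N >-> n <= m},
        delta n @[n --> \oo] --> (0 : R) &
        cvg_in_prob P (fun n w =>
          joint_posterior pi_theta pi_f n (data n w)
            [set p | param_set p /\ dist p.1 p.2 < delta n]) 1%E].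

Definition bernstein_von_mises (gam0 : H1) : Prop :=
  let i0 := eff_info th0 f0 gam0 in
  let Delta w := i0^-1 * W (Kdot th0 f0 - K th0 gam0) w in
  cvg_in_prob P (fun n w =>
    tv_norm
      (fun F : set (measurableTypeR R) =>
         joint_posterior pi_theta pi_f n (data n w) (F `*` setT))
      (normal_prob (th0 + (Num.sqrt n%:R)^-1 * Delta w)
                   (Num.sqrt (n%:R^-1 * i0^-1)))) 0%E.

End data.
End inverse_problem.

(* Main.v *)
Require Import Defs.
From HB Require Import structures.
From mathcomp Require Import all_boot all_order all_algebra.
From mathcomp Require Import all_classical all_reals all_analysis.
From mathcomp Require Import measurable_realfun simple_functions ring lra.

(** The marginal posterior of the parameter is compared with the normal
    distribution through its values at pairs of parameters.

    Along the path from [(th, f)] to [(th', f + (th - th') *: gam_ n)] the signal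
    moves almost in the direction of the efficient slope
    [g = Kdot th0 f0 - K th0 (gam f0)]. The increment of the log-likelihood along
    this path ([signal_slope], [quadratic_expansion], [noise_expansion]) is
    therefore close to the logarithm of the ratio of the limiting normal density
    at [th] and at [th']. The error is at most [kap * (1 + |s|)] with [s] the
    scaled distance of [th] from [th0] ([local_comparison]). It has a bias part,
    which the orthogonality of the least favourable direction reduces to the
    assumed vanishing inner products, and a noise part, the Gaussian process at
    small vectors taken from a ball of the space [S] or from a Lipschitz curve.
    The entropy condition and chaining make the noise small on one event of large
    probability ([chaining_small]), almost surely for each parameter separately.
    Fubini's theorem then gives almost every parameter almost surely
    ([ae_exchange]), so that continuity of the sample paths is not at issue.

    Moving the prior of [f] along [gam_ n] costs a density ratio that is close to
    one ([bayes_shift]). Let [M th] be the likelihood integrated over all [f] and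
    [N th] the likelihood integrated over a set of [f] that carries almost all
    posterior mass, and let [phi] be the limiting normal density. Then
    [N th * phi th' <= M th' * (expR (kap * (1 + |s|)) * phi th)] for almost all
    pairs at a distance of order [n^(-1/2)]. Integrated over pairs of central
    points this bounds the posterior mass of every set in the centre by its
    normal mass; comparing a point of the tail with points closer to the centre
    shows that the tails are negligible ([normal_approximation]). An upper bound
    for all sets bounds complements too, hence the total variation distance
    ([posterior_tv]).

    The argument uses the prior of the parameter near [th0] only, where it is
    almost a multiple of Lebesgue measure ([density_local]). By Baire's theorem
    the parameter set contains a neighbourhood of [th0], because the scaled
    sieves fill the line ([scaled_cover_nbhs]). *)

Set Implicit Arguments.
Unset Strict Implicit.
Unset Printing Implicit Defensive.

Import Order.TTheory GRing.Theory Num.Theory.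
Import numFieldNormedType.Exports.

Local Open Scope classical_set_scope.
Local Open Scope ring_scope.

(** * Inner products and normed subspaces *)

Section inner_theory.
Variables (R : realType) (V : hilbertType R).
Implicit Types (x y z : V) (a : R).

Lemma innerDl x y z : inner (x + y) z = inner x z + inner y z.
Proof. by have := inner_linearl 1 x y z; rewrite scale1r mul1r. Qed.

Lemma inner0l z : inner 0 z = 0.
Proof. by have := innerDl 0 0 z; rewrite addr0 => /eqP; rewrite -subr_eq0 opprD addrA subrr sub0r oppr_eq0 => /eqP. Qed.

Lemma innerZl a x z : inner (a *: x) z = a * inner x z.
Proof. by have := inner_linearl a x 0 z; rewrite addr0 inner0l addr0. Qed.

Lemma innerNl x z : inner (- x) z = - inner x z.
Proof. by rewrite -scaleN1r innerZl mulN1r. Qed.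

Lemma innerBl x y z : inner (x - y) z = inner x z - inner y z.
Proof. by rewrite innerDl innerNl. Qed.

Lemma innerDr z x y : inner z (x + y) = inner z x + inner z y.
Proof. by rewrite innerC innerDl !(innerC z). Qed.

Lemma innerZr a z x : inner z (a *: x) = a * inner z x.
Proof. by rewrite innerC innerZl (innerC z). Qed.

Lemma innerNr z x : inner z (- x) = - inner z x.
Proof. by rewrite innerC innerNl (innerC z). Qed.

Lemma innerBr z x y : inner z (x - y) = inner z x - inner z y.
Proof. by rewrite innerDr innerNr. Qed.

Lemma normD_sqr x y : `|x + y| ^+ 2 = `|x| ^+ 2 + 2 * inner x y + `|y| ^+ 2.
Proof.
by rewrite -!inner_norm !innerDl !innerDr (innerC y x) mulr_natl mulr2n !addrA.
Qed.

Lemma normB_sqr x y : `|x - y| ^+ 2 = `|x| ^+ 2 - 2 * inner x y + `|y| ^+ 2.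
Proof. by rewrite normD_sqr innerNr normrN mulrN. Qed.

(** From the triangle inequality for both [x + y] and [x - y], so that
    neither vector has to be normalized. *)
Lemma cauchy_schwarz x y : `|inner x y| <= `|x| * `|y|.
Proof.
have h z : inner x z <= `|x| * `|z|.
  have h1 : `|x + z| ^+ 2 <= (`|x| + `|z|) ^+ 2.
    by rewrite lerXn2r ?nnegrE ?addr_ge0// ler_normD.
  move: h1; rewrite normD_sqr sqrrD; lra.
by rewrite ler_norml h andbT lerNl -innerNr -(normrN y) h.
Qed.

Lemma continuous_inner x : continuous (inner x : V -> R^o).
Proof.
move=> y; apply/cvgrPdist_lt => e e0; near=> z.
rewrite -innerBr; apply: le_lt_trans (cauchy_schwarz _ _) _.
apply: (@le_lt_trans _ _ ((`|x| + 1) * `|y - z|)).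
  by rewrite ler_wpM2r// lerDl.
rewrite -ltr_pdivlMl; last by rewrite ltr_wpDl.
near: z; apply: (@cvgr_dist_lt _ _ _ (nbhs y) _ id) => //.
by rewrite mulr_gt0// invr_gt0 ltr_wpDl.
Unshelve. all: by end_near. Qed.

End inner_theory.

Section normed_subspace_theory.
Variables (R : realType) (V : lmodType R) (N : normed_subspace V).
Implicit Types (x y : V) (a c : R).

Lemma ns_setD x y : ns_set N x -> ns_set N y -> ns_set N (x + y).
Proof. by move=> hx hy; rewrite -(scale1r x); exact: ns_set_linear. Qed.

Lemma ns_setZ a x : ns_set N x -> ns_set N (a *: x).
Proof. by move=> hx; rewrite -[_ *: _]addr0; apply: ns_set_linear => //; exact: ns_set0. Qed.

Lemma ns_setN x : ns_set N x -> ns_set N (- x).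
Proof. by rewrite -scaleN1r; exact: ns_setZ. Qed.

Lemma ns_setB x y : ns_set N x -> ns_set N y -> ns_set N (x - y).
Proof. by move=> hx hy; apply: ns_setD => //; exact: ns_setN. Qed.

Lemma ns_norm0 : ns_norm N 0 = 0.
Proof. by rewrite -(scale0r 0) ns_normZ ?normr0 ?mul0r//; exact: ns_set0. Qed.

Lemma ns_normN x : ns_set N x -> ns_norm N (- x) = ns_norm N x.
Proof. by move=> hx; rewrite -scaleN1r ns_normZ// normrN1 mul1r. Qed.

Lemma ns_norm_ge0 x : ns_set N x -> 0 <= ns_norm N x.
Proof.
move=> hx; have := ns_normD hx (ns_setN hx).
rewrite subrr ns_norm0 ns_normN//; lra.
Qed.

Lemma ns_normB x y : ns_set N x -> ns_set N y ->
  ns_norm N (x - y) <= ns_norm N x + ns_norm N y.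
Proof. by move=> hx hy; rewrite -(ns_normN hy); apply: ns_normD => //; exact: ns_setN. Qed.

Lemma ns_leD x y a c : ns_le N x a -> ns_le N y c -> ns_le N (x + y) (a + c).
Proof.
by move=> [hx xa] [hy yc]; split; [exact: ns_setD|
  apply: le_trans (ns_normD hx hy) _; exact: lerD].
Qed.

Lemma ns_leN x a : ns_le N x a -> ns_le N (- x) a.
Proof. by move=> [hx xa]; split; [exact: ns_setN|rewrite ns_normN]. Qed.

Lemma ns_leZ b x a : ns_le N x a -> ns_le N (b *: x) (`|b| * a).
Proof.
by move=> [hx xa]; split; [exact: ns_setZ|rewrite ns_normZ// ler_wpM2l].
Qed.

Lemma ns_leW x a b : a <= b -> ns_le N x a -> ns_le N x b.
Proof. by move=> ab [hx xa]; split => //; exact: le_trans ab. Qed.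

Lemma ns_le_ge0 x a : ns_le N x a -> 0 <= a.
Proof. by move=> [hx xa]; apply: le_trans xa; exact: ns_norm_ge0. Qed.

End normed_subspace_theory.

Lemma stronger_norm_pos (R : realType) (V : normedModType R)
  (N : normed_subspace V) : stronger_norm N ->
  exists2 C : R, 0 < C & forall x c, ns_le N x c -> `|x| <= C * c.
Proof.
move=> [C hC]; exists (`|C| + 1); first by rewrite ltr_wpDl.
move=> x c hx; have c0 := ns_le_ge0 hx; case: hx => hx xc.
apply: le_trans (hC _ hx) _; apply: (@le_trans _ _ (`|C| * ns_norm N x)).
  by rewrite ler_wpM2r ?ler_norm// ns_norm_ge0.
by apply: ler_pM => //; [exact: ns_norm_ge0|rewrite lerDl].
Qed.

(** * Integrals against a density *)

Section integral_density.
Import HBNNSimple.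

(** Holds for indicators by hypothesis, hence for nonnegative measurable
    functions by linearity and monotone convergence. *)
Lemma ge0_integral_density (R : realType) d (T : measurableType d)
    (nu mu : {measure set T -> \bar R}) (p : T -> R) (D : set T)
    (f : T -> \bar R) :
  (forall x, 0 <= p x) -> measurable_fun setT p ->
  (forall A, measurable A -> nu A = (\int[mu]_(x in A) (p x)%:E)%E) ->
  measurable D -> measurable_fun D f -> (forall x, D x -> (0 <= f x)%E) ->
  (\int[nu]_(x in D) f x = \int[mu]_(x in D) (f x * (p x)%:E))%E.
Proof.
move=> p0 mp hp mD mf f0.
have mpE : measurable_fun setT (fun x => (p x)%:E) by apply/measurable_EFinP.
pose h := nnsfun_approx mD mf.
transitivity (limn (fun n => \int[nu]_(x in D) (h n x)%:E)%E).
  rewrite -monotone_convergence//.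
  - by apply: eq_integral => x /set_mem Dx; apply/esym/cvg_lim => //; apply: cvg_nnsfun_approx.
  - by move=> n; exact/measurable_EFinP/measurable_funTS.
  - by move=> n x _; rewrite lee_fin.
  - by move=> x _ m n mn; rewrite lee_fin; exact/lefP/nd_nnsfun_approx.
transitivity (limn (fun n => \int[mu]_(x in D) ((h n x)%:E * (p x)%:E))%E); last first.
  rewrite -monotone_convergence//.
  - apply: eq_integral => x /set_mem Dx; apply/cvg_lim => //.
    by apply: cvgeZr => //; apply: cvg_nnsfun_approx.
  - move=> n; apply/measurable_funTS/emeasurable_funM => //.
    exact/measurable_EFinP.
  - by move=> n x _; rewrite -EFinM lee_fin mulr_ge0.
  - move=> x _ m n mn; rewrite -!EFinM lee_fin ler_wpM2r//.
    exact/lefP/nd_nnsfun_approx.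
congr (limn _); apply/funext => n.
have mh r : measurable (h n @^-1` [set r]) by exact: measurable_sfunP.
transitivity (\int[nu]_(x in D)
   (\sum_(y \in range (h n)) (y * \1_(h n @^-1` [set y]) x)%:E))%E.
  by apply: eq_integral => t tE; rewrite /= fimfunE -fsumEFin.
have mind r : measurable_fun D (fun x => (r * \1_(h n @^-1` [set r]) x)%:E).
  by apply/measurable_funTS/measurable_EFinP/measurable_funM.
rewrite ge0_integral_fsum//; last by move=> m y Ey; exact: nnfun_muleindic_ge0.
transitivity (\int[mu]_(x in D) (\sum_(y \in range (h n))
    ((y * \1_(h n @^-1` [set y]) x)%:E * (p x)%:E)))%E; last first.
  apply: eq_integral => x xE.
  rewrite -ge0_mule_fsuml => [|y]; last exact: nnfun_muleindic_ge0.
  by rewrite fsumEFin // -(fimfunE _ x).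
rewrite ge0_integral_fsum//; last 2 first.
  - by move=> y; apply: emeasurable_funM => //; exact: measurable_funTS.
  - move=> m y Ey; apply: mule_ge0; last by rewrite lee_fin.
    exact: nnfun_muleindic_ge0.
apply: eq_fsbigr => r; rewrite inE => -[x0 _ <-].
rewrite integralZl_indic_nnsfun// integral_indic//.
under [RHS]eq_integral do rewrite EFinM -muleA.
rewrite ge0_integralZl//; last 3 first.
- apply: emeasurable_funM; last exact: measurable_funTS.
  exact/measurable_funTS/measurable_EFinP.
- by move=> x _; rewrite mule_ge0 ?lee_fin.
- by rewrite lee_fin.
congr (_ * _)%E.
transitivity (\int[mu]_(x in D) ((fun x => (p x)%:E) \_ (h n @^-1` [set h n x0])) x)%E.
  rewrite -integral_mkcondr setIC; apply: hp.
  by apply: measurableI => //; exact: mh.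
by apply: eq_integral => x _; rewrite epatch_indic /= muleC.
Qed.

End integral_density.

Lemma ge0_markov (R : realType) d (T : measurableType d)
    (mu : {measure set T -> \bar R}) (g : T -> R) (c : R) :
  0 < c -> measurable_fun setT g -> (forall x, 0 <= g x) ->
  (mu [set x | c <= g x]%R <= (c^-1)%:E * \int[mu]_x (g x)%:E)%E.
Proof.
move=> c0 mg g0.
have mA : measurable [set x | c <= g x].
  have -> : [set x | c <= g x] = setT `&` g @^-1` `[c, +oo[.
    by apply/seteqP; split => x /=; rewrite in_itv/= andbT//; case.
  exact: mg.
rewrite -lee_pdivrMl ?invr_gt0// invrK -[X in mu X]setIT -integral_indic//.
rewrite -ge0_integralZl//; last 2 first.
- exact/measurable_EFinP.
- by rewrite lee_fin ltW.
apply: ge0_le_integral => //.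
- by move=> x _; rewrite mule_ge0 ?lee_fin// ltW.
- by apply: emeasurable_funM => //; exact/measurable_EFinP.
- exact/measurable_EFinP.
move=> x _; rewrite -EFinM lee_fin indicE.
by case: (boolP (x \in _)) => [/set_mem|_]; rewrite ?mulr1 ?mulr0.
Qed.

Lemma measurable_set_le (R : realType) d (T : measurableType d) (f g : T -> R) :
  measurable_fun setT f -> measurable_fun setT g ->
  measurable [set x | f x <= g x].
Proof.
move=> mf mg; rewrite [X in measurable X](_ : _ = setT `&` (g \- f) @^-1` `[0, +oo[).
  by apply: measurable_funB.
by apply/seteqP; split => x /=; rewrite in_itv/= andbT subr_ge0//; case.
Qed.

Lemma measurable_set_lt (R : realType) d (T : measurableType d) (f g : T -> R) :
  measurable_fun setT f -> measurable_fun setT g ->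
  measurable [set x | f x < g x].
Proof.
move=> mf mg; rewrite [X in measurable X](_ : _ = ~` [set x | g x <= f x]).
  by apply: measurableC; exact: measurable_set_le.
by apply/seteqP; split => x /=; rewrite ltNge => /negP.
Qed.

Lemma ge0_integral_setU_le (R : realType) d (T : measurableType d)
    (mu : {measure set T -> \bar R}) (A B : set T) (f : T -> \bar R) :
  measurable A -> measurable B -> measurable_fun setT f ->
  (forall x, (0 <= f x)%E) ->
  (\int[mu]_(x in A `|` B) f x <=
   \int[mu]_(x in A) f x + \int[mu]_(x in B) f x)%E.
Proof.
move=> mA mB mf f0.
have -> : A `|` B = A `|` (B `\` A).
  apply/seteqP; split => x [Ax|Bx]; [by left| |by left|by right; case: Bx].
  by have [Ax|nA] := pselect (A x); [left|right].
have mBA : measurable (B `\` A) by exact: measurableD.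
rewrite ge0_integral_setU//; last 2 first.
- exact: measurable_funTS.
- by apply/disj_setPS => x [Ax [_]].
by rewrite leeD2l//; apply: ge0_subset_integral => //; exact: measurable_funTS.
Qed.

(** * Gaussian variables *)

Lemma ge0_integral_law (R : realType) d d' (X : measurableType d)
    (Y : measurableType d') (mu : {measure set X -> \bar R})
    (nu : {measure set Y -> \bar R}) (phi : X -> Y) (f : Y -> \bar R) :
  measurable_fun setT phi ->
  (forall A, measurable A -> mu (phi @^-1` A) = nu A) ->
  measurable_fun setT f -> (forall y, (0 <= f y)%E) ->
  (\int[mu]_x f (phi x) = \int[nu]_y f y)%E.
Proof.
move=> mphi law mf f0.
transitivity (\int[pushforward mu phi]_y f y)%E.
  by rewrite (ge0_integral_pushforward mphi)//; move=> y _; exact: f0.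
apply: eq_measure_integral => A mA _; rewrite -law//.
Qed.

Lemma normal_pdf_tilt (R : realType) (m s l x : R) : s != 0 ->
  expR (l * x) * normal_pdf m s x =
  expR (l * m + l ^+ 2 * s ^+ 2 / 2) * normal_pdf (m + l * s ^+ 2) s x.
Proof.
move=> s0; rewrite !normal_pdfE// /normal_fun mulrCA [RHS]mulrCA; congr (_ * _).
by rewrite -!expRD; congr expR; field.
Qed.

Lemma gaussian_mgf (R : realType) (m s l : R) d (T : measurableType d)
    (P : probability T R) (X : T -> R) :
  measurable_fun setT X ->
  (forall A, measurable A -> P (X @^-1` A) = gaussian_law m s A) ->
  (\int[P]_w (expR (l * X w))%:E = (expR (l * m + l ^+ 2 * s ^+ 2 / 2))%:E)%E.
Proof.
move=> mX; have mexp : measurable_fun setT (fun x : R => (expR (l * x))%:E).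
  apply/measurable_EFinP/measurableT_comp => //; exact: measurable_funM.
rewrite /gaussian_law; have [->|s0] := eqVneq s 0 => law.
  rewrite (ge0_integral_law mX law mexp); last by move=> y; rewrite lee_fin expR_ge0.
  by rewrite integral_dirac// diracT mul1e expr0n mulr0 mul0r addr0.
rewrite (ge0_integral_law (nu := normal_prob m s) mX law mexp); last first.
  by move=> y; rewrite lee_fin expR_ge0.
rewrite (ge0_integral_density (mu := lebesgue_measure) (p := normal_pdf m s)) //.
- under eq_integral do rewrite -EFinM normal_pdf_tilt// EFinM.
  rewrite ge0_integralZl//.
  + by rewrite integral_normal_pdf mule1.
  + by apply/measurable_EFinP; exact: measurable_normal_pdf.
  + by move=> x _ /=; rewrite lee_fin normal_pdf_ge0.
- by move=> x; rewrite normal_pdf_ge0.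
- exact: measurable_normal_pdf.
Qed.

(** The peak of the normal density is small enough that the interval of
    length [s] around the origin has mass at most 1/2. *)
Lemma gaussian_spread (R : realType) (m s : R) d (T : measurableType d)
    (P : probability T R) (X : T -> R) :
  measurable_fun setT X -> 0 <= s ->
  (forall A, measurable A -> P (X @^-1` A) = gaussian_law m s A) ->
  ((s ^+ 2)%:E <= 8%:E * \int[P]_w (X w ^+ 2)%:E)%E.
Proof.
move=> mX s0 law.
have [->|sn0] := eqVneq s 0.
  by rewrite expr0n mule_ge0// integral_ge0// => x _; rewrite lee_fin sqr_ge0.
have sp : 0 < s by rewrite lt_def sn0.
pose c := (s / 2) ^+ 2.
have c0 : 0 < c by rewrite exprn_gt0// divr_gt0.
have mX2 : measurable_fun setT (fun w => X w ^+ 2) by exact: measurable_funX.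
have mk := ge0_markov P c0 mX2 (fun w => sqr_ge0 _).
have mI : measurable (`]-(s/2), (s/2)[%classic : set R) by exact: measurable_itv.
have PI : (P (X @^-1` `](-(s/2))%R, (s/2)%R[) <= (1/2)%:E)%E.
  rewrite law// /gaussian_law (negbTE sn0) /normal_prob.
  apply: (@le_trans _ _ (\int[lebesgue_measure]_(x in `](-(s/2))%R, (s/2)%R[) (normal_peak s)%:E)%E).
    apply: ge0_le_integral => //.
    - by move=> x _; rewrite lee_fin normal_pdf_ge0.
    - by apply/measurable_funTS/measurable_EFinP; exact: measurable_normal_pdf.
    - by move=> x _; rewrite lee_fin normal_pdf_ub.
  rewrite integral_cst//= lebesgue_measure_itv/= lte_fin ifT; last lra.
  rewrite -EFinB -EFinM lee_fin opprK.
  have -> : s / 2 + s / 2 = s by lra.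
  have h : 2 * s <= Num.sqrt (s ^+ 2 * pi *+ 2).
    rewrite -(ger0_norm (_ : 0 <= 2 * s)) ?mulr_ge0// -sqrtr_sqr ler_wsqrtr//.
    by have := pi_ge2 R; have : 0 < s ^+ 2 by [exact: exprn_gt0]; nra.
  rewrite /normal_peak mulrC ler_pdivrMr; lra.
have mA : measurable (X @^-1` `](-(s/2))%R, (s/2)%R[).
  by rewrite -[X in measurable X]setTI; exact: mX.
have PA : (P [set w | c <= X w ^+ 2]%R >= (1/2)%:E)%E.
  have -> : [set w | c <= X w ^+ 2] = ~` (X @^-1` `](-(s/2))%R, (s/2)%R[).
    apply/seteqP; split => w /=; rewrite in_itv/= -ltr_norml /c -(real_normK (num_real (X w))).
      by move=> h; apply/negP; rewrite -leNgt -(ler_pXn2r (n := 2))// nnegrE// divr_ge0.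
    by move/negP; rewrite -leNgt => h; rewrite ler_pXn2r// nnegrE// divr_ge0.
  rewrite probability_setC// leeBrDl; last by rewrite fin_num_measure.
  have -> : (1 = (1/2)%:E + (1/2)%:E :> \bar R)%E by rewrite -EFinD; congr _%:E; lra.
  exact: leeD.
have := le_trans PA mk; rewrite lee_pdivlMl// -EFinM => h.
apply: (@le_trans _ _ (8%:E * (c * (1/2))%:E)%E); last by rewrite lee_pmul2l.
by rewrite -EFinM lee_fin /c; lra.
Qed.

Section iso_gaussian_theory.
Variables (R : realType) (d : measure_display) (Omega : measurableType d).
Variables (P : probability Omega R) (V : hilbertType R) (W : V -> Omega -> R).
Hypothesis isoW : iso_gaussian P W.
Implicit Types (h x y : V) (a b l c : R).

Lemma iso_law h : gaussian_rv P (W h).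
Proof.
have [gW _ _ _] := isoW.
have := gW 1%N (fun=> 1) (fun=> h).
by congr gaussian_rv; apply/funext => w; rewrite big_ord1 mul1r.
Qed.

Lemma iso_measurable h : measurable_fun setT (W h).
Proof. by have [] := iso_law h. Qed.

Lemma iso_sqr h : (\int[P]_w (W h w ^+ 2)%:E = (`|h| ^+ 2)%:E)%E.
Proof.
have [_ E0 cov _] := isoW.
rewrite -inner_norm -cov covariance.unlock E0 /= unlock.
by apply: eq_integral => w _ /=; rewrite !fctE /= subr0 expr2.
Qed.

Lemma iso_Lfun2 h : W h \in Lfun P 2%:E.
Proof.
rewrite inE; apply/andP; split; rewrite inE/=; first exact: iso_measurable.
rewrite /finite_norm unlock /= poweR_lty//.
rewrite (eq_integral (fun w => (W h w ^+ 2)%:E)); last first.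
  by move=> w _; rewrite powR_mulrn//= real_normK// num_real.
by rewrite iso_sqr ltry.
Qed.

(** The law of [W h] is Gaussian with unknown parameters. Since [exp] lies above
    its tangent the zero expectation forces the centre to be zero, and the
    second moment controls the spread. *)
Lemma iso_mgf h l :
  (\int[P]_w (expR (l * W h w))%:E <= (expR (4 * l ^+ 2 * `|h| ^+ 2))%:E)%E.
Proof.
have [mW [m [s [s0 law]]]] := iso_law h.
have mgf k : (\int[P]_w (expR (k * W h w))%:E = (expR (k * m + k ^+ 2 * s ^+ 2 / 2))%:E)%E.
  exact: gaussian_mgf.
have intW : P.-integrable setT (EFin \o W h).
  by apply/Lfun1_integrable; apply: Lfun_subset12 (iso_Lfun2 h); rewrite fin_num_measure.
have EW : (\int[P]_w (W h w)%:E = 0)%E.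
  by have [_ E0 _ _] := isoW; have := E0 h; rewrite unlock.
have pos k : 0 <= k * m + k ^+ 2 * s ^+ 2 / 2.
  rewrite -ler_expR expR0 -lee_fin -mgf.
  have -> : 1%:E = (\int[P]_w (1%:E + k%:E * (W h w)%:E))%E.
    rewrite integralD//; last 2 first.
    - exact: finite_measure_integrable_cst.
    - exact: integrableZl.
    by rewrite integral_cst//= probability_setT mule1 integralZl// EW mule0 adde0.
  apply: le_integral => //.
  - apply: integrableD => //; first exact: finite_measure_integrable_cst.
    exact: integrableZl.
  - apply/integrableP; split.
      apply/measurable_EFinP/measurableT_comp => //; exact: measurable_funM.
    under eq_integral do rewrite gee0_abs ?lee_fin ?expR_ge0//.
    by rewrite mgf ltry.
  by move=> w _; rewrite -EFinM -EFinD lee_fin expR_ge1Dx.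
have m0 : m = 0.
  have := pos (- m / (s ^+ 2 + 1)).
  have s1 : 0 < s ^+ 2 + 1 by rewrite ltr_wpDl ?sqr_ge0.
  have -> : - m / (s ^+ 2 + 1) * m + (- m / (s ^+ 2 + 1)) ^+ 2 * s ^+ 2 / 2 =
     - (m ^+ 2 * (s ^+ 2 + 2) / (2 * (s ^+ 2 + 1) ^+ 2)).
    by field; rewrite gt_eqF.
  rewrite oppr_ge0 => h1; apply/eqP; rewrite -sqrf_eq0 eq_le sqr_ge0 andbT.
  rewrite -(pmulr_lle0 (x := (s ^+ 2 + 2) / (2 * (s ^+ 2 + 1) ^+ 2)) (m ^+ 2)).
    by rewrite mulrA.
  by rewrite divr_gt0 ?mulr_gt0 ?exprn_gt0// ltr_wpDl ?sqr_ge0.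
have s8 : s ^+ 2 <= 8 * `|h| ^+ 2.
  have := gaussian_spread mW s0 law; rewrite iso_sqr.
  by rewrite -[in X in (_ <= X)%E -> _]EFinM lee_fin.
rewrite mgf m0 lee_fin ler_expR mulr0 add0r -mulrA mulrCA -mulrA.
have := sqr_ge0 l; nra.
Qed.

Lemma iso_exp_markov h l c : 0 < l ->
  (P [set w | c <= W h w]%R <= (expR (4 * l ^+ 2 * `|h| ^+ 2 - l * c))%:E)%E.
Proof.
move=> l0.
have -> : [set w | c <= W h w] = [set w | expR (l * c) <= expR (l * W h w)].
  by apply/seteqP; split => w /=; rewrite ler_expR ler_pM2l.
apply: le_trans (ge0_markov P (expR_gt0 _) _ _) _.
- by apply: measurableT_comp => //; apply: measurable_funM => //; exact: iso_measurable.
- by move=> w; exact: expR_ge0.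
rewrite expRB EFinM muleC -expRN lee_wpmul2r ?lee_fin ?expR_ge0//.
exact: iso_mgf.
Qed.

(** The difference of the two sides has variance zero. *)
Lemma iso_linear a x y :
  {ae P, forall w, W (a *: x + y) w = a * W x w + W y w}.
Proof.
have L2 := iso_Lfun2.
have [_ _ cov _] := isoW.
have aL2 b z : b \o* W z \in Lfun P 2%:E by apply: Lfun_scale => //; rewrite ler1n.
pose Y := (W (a *: x + y) \- (a \o* W x \+ W y))%R.
have L2S : (a \o* W x \+ W y)%R \in Lfun P 2%:E by rewrite rpredD ?lee1n//=.
have Lf1 f : f \in Lfun P 2%:E -> f \in Lfun P 1.
  by move=> hf; apply: Lfun_subset12 hf; rewrite fin_num_measure.
have L2Y : Y \in Lfun P 2%:E by rewrite rpredB ?lee1n//=.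
have covYz z : covariance P Y (W z) = 0%E.
  rewrite covarianceBl// covarianceDl// covarianceZl; [|exact: Lf1|exact: Lf1|exact: Lfun2_mul_Lfun1].
  by rewrite !cov -EFinM -EFinD innerDl innerZl subrr.
have varY : covariance P Y Y = 0%E.
  rewrite {2}/Y covarianceBr// covarianceDr// covarianceZr; [|exact: Lf1|exact: Lf1|exact: Lfun2_mul_Lfun1].
  by rewrite !covYz mule0 adde0 sube0.
have EY : ('E_P[Y] = 0)%E.
  have [_ E0 _ _] := isoW.
  by rewrite expectationB ?expectationD ?expectationZl ?Lf1// !E0 mule0 adde0 sube0.
have mY : measurable_fun setT Y by have := sub_Lfun_mfun L2Y; rewrite inE.
have IY : (\int[P]_w `|((Y w) ^+ 2)%:E| = 0)%E.
  rewrite -varY covariance.unlock EY /= unlock.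
  by apply: eq_integral => w _ /=; rewrite !fctE /= subr0 ger0_norm ?sqr_ge0// expr2.
have := ae_eq_integral_abs P measurableT (f := fun w => ((Y w) ^+ 2)%:E).
have mY2 : measurable_fun setT (fun w => ((Y w) ^+ 2)%:E).
  by apply/measurable_EFinP; exact: measurable_funX.
move=> /(_ mY2)[/(_ IY) + _]; apply: filterS => w /(_ I) [] /eqP.
by rewrite sqrf_eq0 /Y /= subr_eq0 => /eqP ->; rewrite mulrC.
Qed.

Lemma iso_tail h (x s : R) : 0 < s -> `|h| <= s -> 0 <= x ->
  (P [set w | x <= `|W h w|]%R <= (2 * expR (- (x ^+ 2 / (16 * s ^+ 2))))%:E)%E.
Proof.
move=> s0 hs x0; have s2 : 0 < s ^+ 2 by rewrite exprn_gt0.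
have hs2 : `|h| ^+ 2 <= s ^+ 2 by rewrite ler_pXn2r ?nnegrE// ltW.
have mset (z : V) : measurable [set w | x <= W z w].
  have -> : [set w | x <= W z w] = setT `&` W z @^-1` `[x, +oo[.
    by apply/seteqP; split => w /=; rewrite in_itv/= andbT//; case.
  exact: iso_measurable.
have [x00|xp] := eqVneq x 0.
  apply: le_trans (probability_le1 _ _) _.
    rewrite x00 (_ : [set _ | _] = setT)//.
    by apply/seteqP; split => // w _ /=.
  rewrite x00 expr0n mul0r oppr0 expR0 mulr1 lee_fin; lra.
have xpos : 0 < x by rewrite lt_def xp.
have half (z : V) : `|z| <= s ->
    (P [set w | x <= W z w]%R <= (expR (- (x ^+ 2 / (16 * s ^+ 2))))%:E)%E.
  move=> zs; have zs2 : `|z| ^+ 2 <= s ^+ 2 by rewrite ler_pXn2r ?nnegrE// ltW.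
  have l0 : 0 < x / (8 * s ^+ 2) by rewrite divr_gt0 ?mulr_gt0.
  apply: le_trans (iso_exp_markov z x l0) _; rewrite lee_fin ler_expR.
  apply: (@le_trans _ _ (4 * (x / (8 * s ^+ 2)) ^+ 2 * s ^+ 2 - x / (8 * s ^+ 2) * x)).
    by rewrite lerB// ler_wpM2l// mulr_ge0// sqr_ge0.
  by rewrite le_eqVlt; apply/orP; left; apply/eqP; field; rewrite gt_eqF.
(* The lower tail is the upper tail of the variable at [- h]. *)
have neg : {ae P, forall w, W (- h) w = - W h w}.
  have := iso_linear (-1) h 0; have := iso_linear 1 0 0.
  apply: filterS2 => w; rewrite scale1r addr0 mul1r => h0; rewrite scaleN1r addr0 => ->.
  have -> : W 0 w = 0 by lra.
  lra.
have mA : measurable [set w | x <= - W h w].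
  have -> : [set w | x <= - W h w] = setT `&` W h @^-1` `]-oo, (- x)].
    by apply/seteqP; split => w /=; rewrite in_itv/= lerNr//; case.
  exact: iso_measurable.
have negle : (P [set w | x <= - W h w]%R <= P [set w | x <= W (- h) w]%R)%E.
  have [N [mN N0 hN]] := neg.
  apply: (@le_trans _ _ (P ([set w | x <= W (- h) w]%R `|` N))).
    apply: le_measure; rewrite ?inE//; first exact: measurableU.
    move=> w /= xw; have [?|/hN ?] := pselect (W (- h) w = - W h w); last by right.
    by left; lra.
  apply: le_trans (measureU2 _ _ _) _ => //.
  by rewrite [X in (_ + X)%E](_ : _ = 0%E) ?adde0.
have -> : [set w | x <= `|W h w|] = [set w | x <= W h w] `|` [set w | x <= - W h w].
  apply/seteqP; split => w /=; rewrite ler_normr; first by case/orP; [left|right].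
  by case=> ->; rewrite ?orbT.
apply: le_trans (measureU2 _ _ _) _ => //.
rewrite mulr_natl mulr2n EFinD leeD ?half//.
by apply: le_trans negle _; rewrite half// normrN.
Qed.

Lemma iso_chebyshev h (x : R) : 0 < x ->
  (P [set w | x <= `|W h w|]%R <= (`|h| ^+ 2 / x ^+ 2)%:E)%E.
Proof.
move=> x0.
have -> : [set w | x <= `|W h w|] = [set w | x ^+ 2 <= W h w ^+ 2].
  have xn : x \is Num.nneg by rewrite nnegrE ltW.
  by apply/seteqP; split => w /=; rewrite -(real_normK (num_real (W h w))) ler_pXn2r// nnegrE.
apply: le_trans (@ge0_markov _ _ _ P (fun w => W h w ^+ 2) (x ^+ 2) _ _ _) _.
- by rewrite exprn_gt0.
- by apply: measurable_funX; exact: iso_measurable.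
- by move=> w; exact: sqr_ge0.
by rewrite iso_sqr -EFinM mulrC.
Qed.

End iso_gaussian_theory.

(** * Chaining *)

Lemma measure_bigsetU_le (R : realType) d (T : measurableType d)
    (mu : {measure set T -> \bar R}) (I : finType) (F : I -> set T) (c : R) :
  (forall i, measurable (F i)) -> (forall i, (mu (F i) <= c%:E)%E) ->
  (mu (\big[setU/set0]_i F i) <= (#|I|%:R * c)%:E)%E.
Proof.
move=> mF hF; rewrite mulr_natl -sumr_const -sumEFin.
have [_ ->//] : measurable (\big[setU/set0]_(i in I) F i) /\
  (mu (\big[setU/set0]_(i in I) F i) <= \sum_(i in I) c%:E)%E.
apply: (big_ind2 (fun A b => measurable A /\ (mu A <= b)%E)).
- by rewrite measure0.
- move=> A b B e [mA hA] [mB hB]; split; first exact: measurableU.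
  by apply: le_trans (measureU2 _ mA mB) _; exact: leeD.
- by move=> i _; split.
Qed.

Section chaining.
Variables (R : realType) (d : measure_display) (Omega : measurableType d).
Variables (P : probability Omega R) (V : hilbertType R) (W : V -> Omega -> R).
Hypothesis isoW : iso_gaussian P W.

(** [U] is covered by [m] balls of radius [e]; the centres may lie outside of
    [U]. *)
Definition covered (U : set V) (e : R) (m : nat) :=
  exists c : 'I_m -> V, U `<=` \bigcup_i ball (c i) e.

Definition link_entropy (m : nat -> nat) (k : nat) : R :=
  ln (m k)%:R + ln (m k.+1)%:R + k.+1%:R.

(** The largest increment tolerated between the nets of level [k] and [k + 1],
    chosen so that the union bound over all pairs of net points leaves a
    summable failure probability. *)
Definition link_bound (m : nat -> nat) (k : nat) : R :=
  8 * 2 ^- k * Num.sqrt (link_entropy m k).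

(** Bounds every chain that starts at level [k]: one bound for the first net
    point and one for each later increment. *)
Definition chain_tail (m : nat -> nat) (k : nat) : R :=
  link_bound m k + (limn (series (link_bound m)) - series (link_bound m) k).

Lemma link_entropy_ge0 (m : nat -> nat) k : (forall k, (0 < m k)%N) ->
  0 <= link_entropy m k.
Proof. by move=> m0; rewrite /link_entropy !addr_ge0// ln_ge0// ler1n. Qed.

Lemma expR_link_entropy (m : nat -> nat) k : (forall k, (0 < m k)%N) ->
  (m k)%:R * (m k.+1)%:R * (2 * expR (- link_entropy m k)) <= 2 / (2 ^ k.+1)%:R.
Proof.
move=> m0; have mR j : ((m j)%:R : R) \is Num.pos by rewrite posrE ltr0n.
rewrite /link_entropy !opprD !expRD !expRN !lnK//.
have mj j : (m j)%:R != 0 :> R by rewrite pnatr_eq0 -lt0n.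
have -> : (m k)%:R * (m k.+1)%:R * (2 * ((m k)%:R^-1 / (m k.+1)%:R / expR k.+1%:R))
  = 2 / expR k.+1%:R :> R by field; rewrite gt_eqF ?expR_gt0//= !mj.
rewrite ler_pM2l// lef_pV2 ?posrE ?expR_gt0 ?ltr0n ?expn_gt0//.
rewrite -[k.+1%:R]mulr_natr mul1r -[k.+1%:R]mul1r mulrC expRM_natl natrX.
rewrite lerXn2r ?nnegrE ?expR_ge0//.
by have := expR_ge1Dx (1 : R); rewrite (natrD _ 1 1).
Qed.

Variables (m : nat -> nat).
Hypothesis m_gt0 : forall k, (0 < m k)%N.
Hypothesis summable_bound : cvgn (series (link_bound m)).

Local Notation x := (link_bound m).

Let x_ge0 k : 0 <= x k.
Proof. by rewrite /link_bound mulr_ge0 ?sqrtr_ge0// mulr_ge0// invr_ge0 exprn_ge0. Qed.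

Local Notation tail := (chain_tail m).

Let tail_to0 : tail k @[k --> \oo] --> (0 : R).
Proof.
rewrite -[X in _ --> X]addr0 -[X in _ --> _ + X](subrr (limn (series x))).
apply: cvgD; first exact: cvg_series_cvg_0.
by apply: cvgB => //; exact: cvg_cst.
Qed.

Section nets.
Variables (U : set V) (net : forall k, 'I_(m k) -> V) (k0 : nat).
Arguments net : clear implicits.
Hypothesis netP : forall k, U `<=` \bigcup_i ball (net k i) (2 ^- k).

Let pairs k := ('I_(m k) * 'I_(m k.+1))%type.

Let link k (ij : pairs k) : set Omega :=
  [set w | `|net k.+1 ij.2 - net k ij.1| <= 2 * 2 ^- k /\
           x k <= `|W (net k.+1 ij.2 - net k ij.1) w|].

Let base (i : 'I_(m k0)) : set Omega :=
  [set w | `|net k0 i| <= 2 * 2 ^- k0 /\ x k0 <= `|W (net k0 i) w|].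

Let mabs h c : measurable [set w | c <= `|W h w|].
Proof.
rewrite [X in measurable X](_ : _ = setT `&` (fun w => `|W h w|) @^-1` `[c, +oo[).
  by apply: measurableT_comp => //; exact: (iso_measurable isoW).
by apply/seteqP; split => w /=; rewrite in_itv/= andbT//; case.
Qed.

Let tailP k h : `|h| <= 2 * 2 ^- k ->
  (P [set w | x k <= `|W h w|]%R <= (2 * expR (- link_entropy m k))%:E)%E.
Proof.
move=> hk.
have s0 : 0 < 2 * 2 ^- k :> R by rewrite mulr_gt0// invr_gt0 exprn_gt0.
apply: le_trans (iso_tail isoW s0 hk (x_ge0 k)) _.
rewrite lee_fin ler_pM2l// ler_expR lerN2 le_eqVlt; apply/orP; left; apply/eqP.
rewrite /link_bound exprMn sqr_sqrtr; last exact: link_entropy_ge0.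
by field; rewrite expf_neq0.
Qed.

Let meas_guard (Q : Prop) (A : set Omega) : measurable A ->
  measurable [set w | Q /\ A w].
Proof.
move=> mA; have [q|nq] := pselect Q.
  by rewrite [X in measurable X](_ : _ = A)//; apply/seteqP; split => w //= [].
by rewrite [X in measurable X](_ : _ = set0)//; apply/seteqP; split => w //= [].
Qed.

Let prob_guard (Q : Prop) (A : set Omega) (c : R) : measurable A -> 0 <= c ->
  (Q -> (P A <= c%:E)%E) -> (P [set w | Q /\ A w] <= c%:E)%E.
Proof.
move=> mA c0 h; have [q|nq] := pselect Q.
  rewrite [X in P X](_ : _ = A); first exact: h.
  by apply/seteqP; split => w //= [].
by rewrite [X in P X](_ : _ = set0) ?measure0//; apply/seteqP; split => w //= [].
Qed.

Let bad : set Omega := (\big[setU/set0]_i base i) `|`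
  \bigcup_k (\big[setU/set0]_(ij : pairs (k0 + k)) link ij).

Let mlink k ij : measurable (@link k ij).
Proof.
exact: (@meas_guard _ [set w | x k <= `|W (net k.+1 ij.2 - net k ij.1) w|]).
Qed.

Let Plink k ij : (P (@link k ij) <= (2 * expR (- link_entropy m k))%:E)%E.
Proof.
apply: (@prob_guard _ [set w | x k <= `|W (net k.+1 ij.2 - net k ij.1) w|]).
- exact: mabs.
- by rewrite mulr_ge0// expR_ge0.
- exact: tailP.
Qed.

Let mbase i : measurable (base i).
Proof. exact: (@meas_guard _ [set w | x k0 <= `|W (net k0 i) w|]). Qed.

Let Pbase i : (P (base i) <= (2 * expR (- link_entropy m k0))%:E)%E.
Proof.
apply: (@prob_guard _ [set w | x k0 <= `|W (net k0 i) w|]).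
- exact: mabs.
- by rewrite mulr_ge0// expR_ge0.
- exact: tailP.
Qed.

Let mbigU (I : finType) (F : I -> set Omega) : (forall i, measurable (F i)) ->
  measurable (\big[setU/set0]_i F i).
Proof. by move=> mF; exact: bigsetU_measurable. Qed.

Let mbad : measurable bad.
Proof.
apply: measurableU; first exact: mbigU.
by apply: bigcup_measurable => k _; exact: mbigU.
Qed.

Let Pbad : (P bad <= (4 / 2 ^+ k0)%:E)%E.
Proof.
have e0 k : 0 <= 2 * expR (- link_entropy m k) by rewrite mulr_ge0// expR_ge0.
have -> : 4 / 2 ^+ k0 = 2 / 2 ^+ k0 + 2 / 2 ^+ k0 :> R by lra.
have p0 : 0 < 2 ^+ k0 :> R by rewrite exprn_gt0.
rewrite EFinD; apply: le_trans (measureU2 _ _ _) _.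
- exact: mbigU.
- by apply: bigcup_measurable => k _; exact: mbigU.
apply: leeD.
  apply: le_trans (measure_bigsetU_le mbase Pbase) _.
  rewrite lee_fin card_ord; apply: le_trans (_ : _ <= 2 / (2 ^ k0.+1)%:R) _.
    apply: le_trans (expR_link_entropy k0 m_gt0).
    by rewrite ler_wpM2r// ler_peMr// ler1n.
  rewrite ler_pM2l// lef_pV2 ?posrE ?ltr0n ?expn_gt0//.
  by rewrite natrX ler_eXn2l// ltr1n.
apply: le_trans (@measure_sigma_subadditive _ _ _ P _
  (fun k => \big[setU/set0]_(ij : pairs (k0 + k)) link ij) _ _ _) _.
- by move=> k; exact: mbigU.
- by apply: bigcup_measurable => k _; exact: mbigU.
- by [].
apply: le_trans (epsilon_trick0 xpredT _); last by rewrite divr_ge0// ltW.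
apply: lee_nneseries => // k _.
apply: le_trans (measure_bigsetU_le (@mlink _) (@Plink _)) _.
rewrite lee_fin card_prod !card_ord natrM.
apply: le_trans (expR_link_entropy (k0 + k) m_gt0) _.
by rewrite -addnS expnD natrM natrX invfM mulrA.
Qed.

Let badN_base w : ~ bad w -> forall i, `|net k0 i| <= 2 * 2 ^- k0 ->
  `|W (net k0 i) w| < x k0.
Proof.
move=> nb i hi; rewrite ltNge; apply/negP => xi; apply: nb; left.
by rewrite (bigD1 i)//=; left; split.
Qed.

Let badN_link w : ~ bad w -> forall k ij, (k0 <= k)%N ->
  `|net k.+1 ij.2 - net k ij.1| <= 2 * 2 ^- k ->
  `|W (net k.+1 ij.2 - net k ij.1) w| < x k.
Proof.
move=> nb k ij k0k; rewrite -(subnKC k0k) in ij * => hij.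
rewrite ltNge; apply/negP => xi; apply: nb; right; exists (k - k0)%N => //.
by rewrite (bigD1 ij)//=; left; split.
Qed.

Let sum_x K : x k0 + \sum_(k0 <= j < k0 + K) x j <= tail k0.
Proof.
rewrite lerD2l lerBrDl; have -> : series x k0 + \sum_(k0 <= j < k0 + K) x j = series x (k0 + K)%N.
  by rewrite /series /= -big_cat_nat//= leq_addr.
apply: nondecreasing_cvgn_le => //; apply/nondecreasing_seqP => n.
by rewrite /series /= big_nat_recr//= lerDl.
Qed.

(** Outside of [bad] every chain of net points that converges to [h] keeps
    [W] below [tail k0]; the value at [h] itself is reached in probability,
    which is enough for a statement about a single [h]. *)
Lemma chaining_net : exists E : set Omega,
  [/\ measurable E, (P (~` E) <= (4 / 2 ^+ k0)%:E)%E &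
    forall h, U h -> `|h| <= 2 ^- k0 ->
      {ae P, forall w, E w -> `|W h w| <= tail k0}].
Proof.
exists (~` bad); split; [exact: measurableC|by rewrite setCK|].
move=> h Uh hk0.
have ex k : exists i : 'I_(m k), `|net k i - h| <= 2 ^- k.
  by have [i _] := @netP k _ Uh; rewrite -ball_normE /= => /ltW hb; exists i.
pose c k := net k (sval (cid (ex k))).
have ch k : `|c k - h| <= 2 ^- k by rewrite /c; case: (cid (ex k)).
have dc k : `|c k.+1 - c k| <= 2 * 2 ^- k.
  have -> : c k.+1 - c k = (c k.+1 - h) - (c k - h) by rewrite opprB addrA subrK.
  rewrite mulr_natl mulr2n; apply: le_trans (ler_normB _ _) _; apply: lerD => //.
  apply: le_trans (ch _) _; rewrite lef_pV2 ?posrE ?exprn_gt0//.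
  by rewrite ler_eXn2l// ltr1n.
have c0 : `|c k0| <= 2 * 2 ^- k0.
  have -> : c k0 = (c k0 - h) + h by rewrite subrK.
  by rewrite mulr_natl mulr2n; apply: le_trans (ler_normD _ _) _; exact: lerD.
have lin k : {ae P, forall w, W (c k.+1) w = W (c k.+1 - c k) w + W (c k) w}.
  have := iso_linear isoW 1 (c k.+1 - c k) (c k).
  by rewrite scale1r subrK; apply: filterS => w; rewrite mul1r.
have chain : {ae P, forall w, ~ bad w -> forall K, `|W (c (k0 + K)%N) w| <= tail k0}.
  have := ae_foralln lin; apply: filterS => w lw nb K.
  suff : `|W (c (k0 + K)%N) w| <= x k0 + \sum_(k0 <= j < k0 + K) x j.
    by move/le_trans; apply; exact: sum_x.
  elim: K => [|K IH].
    by rewrite addn0 big_geq// addr0 ltW//; exact: badN_base.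
  rewrite addnS big_nat_recr ?leq_addr//= addrA lw addrC.
  apply: le_trans (ler_normD _ _) _; apply: lerD => //; apply: ltW.
  rewrite /c; apply: (badN_link nb (ij := (_, _))) => /=; first exact: leq_addr.
  exact: dc.
have split K : {ae P, forall w, W h w = W (h - c K) w + W (c K) w}.
  have := iso_linear isoW 1 (h - c K) (c K).
  by rewrite scale1r subrK; apply: filterS => w; rewrite mul1r.
suff step n : {ae P, forall w, ~ bad w -> `|W h w| < tail k0 + n.+1%:R^-1}.
  have := ae_foralln step; apply: filterS => w hw nb.
  apply/ler_addgt0Pr => e e0; have [n] := ltr_add_invr e0; rewrite add0r => hn.
  by apply: le_trans (ltW (hw n nb)) _; rewrite lerD2l ltW.
have mh := mabs h (tail k0 + n.+1%:R^-1).
exists (~` bad `&` [set w | tail k0 + n.+1%:R^-1 <= `|W h w|]); split.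
- by apply: measurableI => //; exact: measurableC.
- apply/eqP; rewrite eq_le measure_ge0 andbT; apply/lee_addgt0Pr => e e0.
  rewrite add0e.
  have e1 : 0 < e * n.+1%:R^-1 ^+ 2 by rewrite mulr_gt0// exprn_gt0// invr_gt0.
  have [K hK] : exists K, (2 ^- K) ^+ 2 <= e * n.+1%:R^-1 ^+ 2.
    exists (Num.trunc ((e * n.+1%:R^-1 ^+ 2)^-1)).+1.
    set b := e * _ in e1 *; rewrite -exprVn -exprM -[leRHS]invrK exprVn.
    rewrite lef_pV2 ?posrE ?exprn_gt0 ?invr_gt0//.
    apply: (@le_trans _ _ (2 ^+ (Num.trunc b^-1).+1)).
      apply: le_trans (ltW (truncnS_gt _)) _.
      by rewrite -natrX ler_nat ltnW// ltn_expl.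
    by rewrite ler_weXn2l ?ler1n// leq_pmulr.
  have cheb := iso_chebyshev isoW (h - c (k0 + K)%N) (x := n.+1%:R^-1) ltac:(by rewrite invr_gt0).
  have := chain; have := split (k0 + K)%N => -[N1 [mN1 N10 hN1]] [N2 [mN2 N20 hN2]].
  apply: (@le_trans _ _ (P ([set w | n.+1%:R^-1 <= `|W (h - c (k0 + K)%N) w|]%R `|` (N1 `|` N2)))).
    apply: le_measure; rewrite ?inE.
    + by apply: measurableI => //; exact: measurableC.
    + by apply: measurableU => //; exact: measurableU.
    move=> w [/= nb hw].
    have [w1|/hN1 ?] := pselect (W h w = W (h - c (k0 + K)%N) w + W (c (k0 + K)%N) w); last by right; left.
    have [w2|/hN2 ?] := pselect (~ bad w -> forall K, `|W (c (k0 + K)%N) w| <= tail k0); last by right; right.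
    left => /=; rewrite -(lerD2l (tail k0)); apply: le_trans hw _; rewrite w1.
    by apply: le_trans (ler_normD _ _) _; rewrite addrC lerD2r; exact: w2.
  apply: le_trans (measureU2 _ _ _) _ => //; first exact: measurableU.
  rewrite [X in (_ + X)%E](_ : _ = 0%E) ?adde0; last first.
    apply/eqP; rewrite eq_le measure_ge0 andbT; apply: le_trans (measureU2 _ mN1 mN2) _.
    by rewrite [X in (X + _)%E]N10 [X in (_ + X)%E]N20 adde0.
  apply: le_trans cheb _; rewrite lee_fin ler_pdivrMr ?exprn_gt0 ?invr_gt0//.
  apply: le_trans hK; rewrite lerXn2r ?nnegrE//.
  rewrite -opprB normrN; apply: le_trans (ch _) _.
  by rewrite lef_pV2 ?posrE ?exprn_gt0// ler_weXn2l ?ler1n// leq_addl.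
by move=> w /= /not_implyP [nb /negP]; rewrite -leNgt.
Qed.

End nets.

(** The radius depends on the covering numbers only, so that it serves all
    sets with these covering numbers at once. *)
Lemma chaining_small (eta : R) : 0 < eta -> exists2 dl : R, 0 < dl &
  forall U : set V, (forall k, covered U (2 ^- k) (m k)) ->
  exists E : set Omega, [/\ measurable E, (P (~` E) <= eta%:E)%E &
    forall h, U h -> `|h| <= dl -> {ae P, forall w, E w -> `|W h w| <= eta}].
Proof.
move=> eta0.
have /cvgrPdist_le/(_ _ eta0) h1 := tail_to0.
have h2 : (4 / 2 ^+ k : R) @[k --> \oo] --> (0 : R).
  rewrite -(mulr0 4); apply: cvgMr; under eq_fun do rewrite -exprVn.
  by apply: cvg_expr; rewrite gtr0_norm ?invr_gt0// invf_lt1// ltr1n.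
move/cvgrPdist_le/(_ _ eta0) : h2 => h2.
have [k0 _ /(_ k0 (leqnn _))[t0 t1]] := filterI h1 h2.
exists (2 ^- k0) => [|U cU]; first by rewrite invr_gt0 exprn_gt0.
pose net k := sval (cid (cU k)).
have netP k : U `<=` \bigcup_i ball (net k i) (2 ^- k).
  by rewrite /net; case: (cid (cU k)).
have [E [mE PE hE]] := chaining_net k0 netP.
exists E; split => //.
  apply: le_trans PE _; rewrite lee_fin.
  by move: t1; rewrite sub0r normrN; exact/le_trans/ler_norm.
move=> h Uh hk; apply: filterS (hE h Uh hk) => w h3 Ew.
apply: le_trans (h3 Ew) _; move: t0; rewrite sub0r normrN.
exact/le_trans/ler_norm.
Qed.

End chaining.

(** * Summable entropies *)

Lemma sqrt_subadditive (R : realType) (a b : R) : 0 <= a -> 0 <= b ->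
  Num.sqrt (a + b) <= Num.sqrt a + Num.sqrt b.
Proof.
move=> a0 b0; rewrite -[leRHS]ger0_norm ?addr_ge0// -sqrtr_sqr ler_wsqrtr//.
rewrite sqrrD !sqr_sqrtr// -addrA lerD2l lerDr -mulr_natr.
by rewrite !mulr_ge0.
Qed.

Lemma pow2_sqrt_le_geometric (R : realType) k :
  2 ^- k * Num.sqrt k.+1%:R <= geometric (1 : R) (Num.sqrt 2^-1) k.
Proof.
have z0 : 0 <= Num.sqrt (2^-1 : R) by rewrite sqrtr_ge0.
rewrite /geometric /= mul1r -exprVn.
have {1}-> : 2^-1 = Num.sqrt 2^-1 * Num.sqrt 2^-1 :> R by rewrite -expr2 sqr_sqrtr.
rewrite exprMn -mulrA ler_piMr ?exprn_ge0//.
rewrite -(ger0_norm (exprn_ge0 _ z0)) -sqrtr_sqr -sqrtrM ?sqr_ge0//.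
rewrite -[leRHS]sqrtr1 ler_wsqrtr// exprAC sqr_sqrtr// exprVn ler_pdivrMl ?exprn_gt0//.
by rewrite mulr1 -natrX ler_nat ltn_expl.
Qed.

Lemma cvg_geometric_sqrt_half (R : realType) :
  cvgn (series (geometric (1 : R) (Num.sqrt 2^-1))).
Proof.
apply: is_cvg_geometric_series; rewrite ger0_norm ?sqrtr_ge0//.
by rewrite -[X in _ < X]sqrtr1 ltr_sqrt// invf_lt1// ltr1n.
Qed.

Lemma cvg_link_bound (R : realType) (m : nat -> nat) :
  (forall k, (0 < m k)%N) ->
  cvgn (series (fun k => 2 ^- k * Num.sqrt (ln (m k)%:R)) : nat -> R) ->
  cvgn (series (link_bound R m)).
Proof.
move=> m0 cv; set u := fun k => _ in cv.
have ln0 k : 0 <= ln (m k)%:R :> R by rewrite ln_ge0// ler1n.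
have u0 k : 0 <= u k by rewrite /u mulr_ge0 ?sqrtr_ge0// invr_ge0 exprn_ge0.
have p0 k : 0 <= 2 ^- k :> R by rewrite invr_ge0 exprn_ge0.
pose g := geometric (1 : R) (Num.sqrt 2^-1).
have z0 : 0 <= Num.sqrt (2^-1 : R) by rewrite sqrtr_ge0.
have cg : cvgn (series g) by exact: cvg_geometric_sqrt_half.
have cu1 : cvgn (series (fun k => u k.+1)).
  have -> : series (fun k => u k.+1) = fun n => series u n.+1 - u 0%N.
    apply/funext => n; rewrite /series /= big_nat_recl//= addrAC subrr add0r.
    by [].
  apply: is_cvgB; last exact: is_cvg_cst.
  by move/cvg_ex : cv => [l hl]; apply/cvg_ex; exists l; rewrite (cvg_shiftS (series u)).
pose v k := 8 * (u k + 2 * u k.+1 + g k).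
have cv' : cvgn (series v).
  have -> : v = 8 *: ((u + 2 *: (fun k => u k.+1)) + g) by [].
  apply: is_cvg_seriesZ; apply: is_cvg_seriesD => //.
  by apply: is_cvg_seriesD => //; exact: is_cvg_seriesZ.
apply: series_le_cvg cv' => k.
- by rewrite /link_bound mulr_ge0 ?sqrtr_ge0// mulr_ge0.
- by rewrite /v mulr_ge0// !addr_ge0 ?mulr_ge0// exprn_ge0.
rewrite /link_bound /v /link_entropy -mulrA ler_pM2l//.
have -> : 2 * u k.+1 = 2 ^- k * Num.sqrt (ln (m k.+1)%:R).
  by rewrite /u mulrA; congr (_ * _); rewrite exprS; field; rewrite expf_neq0.
have gk := pow2_sqrt_le_geometric R k.
have -> : u k = 2 ^- k * Num.sqrt (ln (m k)%:R) by [].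
rewrite -mulrDr; apply: le_trans (lerD (lexx _) gk); rewrite -mulrDr ler_wpM2l//.
apply: le_trans (sqrt_subadditive _ _) _; rewrite ?addr_ge0// lerD2r.
exact: sqrt_subadditive.
Qed.

Lemma antitone_emeasurable (R : realType) (f : R -> \bar R) :
  (forall x y, x <= y -> (f y <= f x)%E) ->
  measurable_fun [set: R] f.
Proof.
move=> hf _; apply: (measurability _ (ErealGenOInfty.measurableE R)) => //.
move=> /= _ [_ [r ->] <-]; apply: is_interval_measurable => s t /=.
rewrite !in_itv/= !andbT => -[_ rs] [_ rt] u /andP[su ut].
by split=> //; rewrite in_itv/= andbT (lt_le_trans rt)// hf.
Qed.

Section entropy_integral.
Variables (R : realType) (V : hilbertType R) (N : normed_subspace V).
Hypothesis entN : finite_entropy_integral N.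

Let U := [set h | ns_le N h 1].
Let cov (e : R) : \bar R := covering_number e U.
Let f (e : R) : \bar R := sqrte (lne (cov e)).

Let U0 : U 0.
Proof. by split; [exact: ns_set0|rewrite ns_norm0]. Qed.

Let cov_ge1 e : (1 <= cov e)%E.
Proof.
apply/ereal_infP => _ [m [c hc] <-]; rewrite lee_fin ler1n.
by have [i _ _] := hc _ U0; case: m c hc i => // c hc [].
Qed.

Let cov_antitone e e' : e <= e' -> (cov e' <= cov e)%E.
Proof.
move=> ee'; apply: ereal_inf_le_tmp => _ [m [c hc] <-]; exists m => //; exists c.
by move=> h /hc[i _ hi]; exists i => //; apply: le_ball hi.
Qed.

Let f_antitone e e' : e <= e' -> (f e' <= f e)%E.
Proof.
move=> ee'; rewrite /f lee_sqrt ?lne_ge0//.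
rewrite lee_lne; first exact: cov_antitone.
all: by rewrite in_itv/= leey andbT (le_trans _ (cov_ge1 _)).
Qed.

Let mf (D : set R) : measurable_fun D f.
Proof. by apply: measurable_funTS; exact: antitone_emeasurable. Qed.

Let J (k : nat) : \bar R := (\int[lebesgue_measure]_(e in `]0%R, (2 ^- k)%R[) f e)%E.

Let J_step k : (J k.+1 + (2 ^- k.+1)%:E * f (2 ^- k) <= J k)%E.
Proof.
have p0 j : 0 < 2 ^- j :> R by rewrite invr_gt0 exprn_gt0.
have half : 2 ^- k = 2 ^- k.+1 + 2 ^- k.+1 :> R.
  by rewrite exprS invfM; have := p0 k; lra.
have sub : `](0:R), 2 ^- k.+1[%classic `|` `]2 ^- k.+1, (2 ^- k : R)[%classic `<=` `](0:R), 2 ^- k[%classic.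
  move=> e /= []; rewrite !in_itv/= => /andP[h1 h2]; apply/andP; split => //.
    by rewrite (lt_trans h2)// half ltrDl.
  exact: lt_trans h1.
apply: le_trans (ge0_subset_integral lebesgue_measure _ _ _ _ sub); last first.
- by move=> e _; exact: sqrte_ge0.
- exact: mf.
- exact: measurable_itv.
- by apply: measurableU; exact: measurable_itv.
rewrite ge0_integral_setU//=; last 3 first.
- exact: mf.
- by move=> e _; exact: sqrte_ge0.
- apply/disj_setPS => e; rewrite /setI /= !in_itv/= => -[/andP[_ h1] /andP[h2 _]].
  by have := lt_trans h1 h2; rewrite ltxx.
rewrite leeD2l//.
have -> : ((2 ^- k.+1)%:E * f (2 ^- k))%E =
    (\int[lebesgue_measure]_(e in `](2 ^- k.+1)%R, (2 ^- k)%R[) (f (2 ^- k)))%E.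
  rewrite integral_cst//= lebesgue_measure_itv/= lte_fin.
  rewrite ifT; last by rewrite half ltrDl.
  by rewrite muleC -EFinB; congr (_ * _%:E)%E; rewrite half addrK.
apply: ge0_le_integral => //.
- by move=> e _; exact: sqrte_ge0.
- exact: mf.
- by move=> e /=; rewrite in_itv/= => /andP[_ h]; apply: f_antitone; exact: ltW.
Qed.

(** The entropy integral dominates its lower dyadic Riemann sums. *)
Let J_sum K : (\sum_(0 <= k < K) (2 ^- k.+1)%:E * f (2 ^- k) <= J 0)%E.
Proof.
suff : (J K + \sum_(0 <= k < K) (2 ^- k.+1)%:E * f (2 ^- k) <= J 0)%E.
  by apply: le_trans; rewrite leeDr// integral_ge0// => e _; exact: sqrte_ge0.
elim: K => [|K IH]; first by rewrite big_geq// adde0.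
apply: le_trans IH; rewrite big_nat_recr//= addeA [X in (_ <= X)%E]addeC.
by rewrite [X in (X <= _)%E]addeAC [X in (X <= _)%E]addeC leeD2l.
Qed.

Let J0_fin : (J 0 < +oo)%E.
Proof. by have := entN; rewrite /finite_entropy_integral /J expr0 invr1. Qed.

Let f_fin k : (f (2 ^- k) < +oo)%E.
Proof.
rewrite ltNge leye_eq; apply/negP => /eqP fy.
have := J_sum k.+1; rewrite big_nat_recr//= fy mulry gtr0_sg ?invr_gt0 ?exprn_gt0//.
rewrite mul1e addey; last first.
  rewrite gt_eqF// (@lt_le_trans _ _ 0%E)// sume_ge0// => i _.
  by rewrite mule_ge0 ?sqrte_ge0// lee_fin invr_ge0 exprn_ge0.
by rewrite leye_eq => /eqP J0; have := J0_fin; rewrite J0 ltxx.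
Qed.

(** Since covering numbers are infima over natural numbers they are attained
    as soon as they are finite. *)
Lemma entropy_covering : exists2 m : nat -> nat,
  (forall k, (0 < m k)%N) /\ (forall k, covered U (2 ^- k) (m k)) &
  cvgn (series (link_bound R m)).
Proof.
have ex k : exists2 m : nat, covered U (2 ^- k) m & cov (2 ^- k) = (m%:R)%:E.
  have [[m hm]|no] := pselect (exists m, covered U (2 ^- k) m); last first.
    have covy : cov (2 ^- k) = +oo%E.
      rewrite /cov /covering_number (_ : [set _ | _ in _] = set0) ?ereal_inf0//.
      by apply/seteqP; split => // y [m hm _]; case: no; exists m.
    by have := f_fin k; rewrite /f covy.
  have ex : exists m, `[< covered U (2 ^- k) m >] by exists m; apply/asboolP.
  exists (ex_minn ex); case: ex_minnP => n /asboolP hn nmin //.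
  apply/eqP; rewrite eq_le; apply/andP; split.
    by apply: ge_ereal_inf; exists (n%:R)%:E => //; exists n.
  apply/ereal_infP => _ [j hj <-]; rewrite lee_fin ler_nat.
  by apply: nmin; apply/asboolP.
have [m hm covm] : exists2 m : nat -> nat,
    (forall k, covered U (2 ^- k) (m k)) & forall k, cov (2 ^- k) = ((m k)%:R)%:E.
  exists (fun k => s2val (cid2 (ex k))) => k; first exact: s2valP (cid2 (ex k)).
  exact: s2valP' (cid2 (ex k)).
have m0 k : (0 < m k)%N.
  by have := cov_ge1 (2 ^- k); rewrite covm lee_fin ler1n.
exists m => //; apply: cvg_link_bound => //.
set u := fun k => _.
have u0 k : 0 <= u k by rewrite /u mulr_ge0 ?sqrtr_ge0// invr_ge0 exprn_ge0.
have fE k : f (2 ^- k) = (Num.sqrt (ln (m k)%:R))%:E.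
  by rewrite /f covm lne_EFin ?ltr0n.
apply: nnseries_is_cvg => //; apply: (@le_lt_trans _ _ (2%:E * J 0)%E); last first.
  by rewrite lte_mul_pinfty.
apply: lime_le; first by apply: is_cvg_nneseries => k _ _; rewrite lee_fin.
apply: nearW => K /=; rewrite -lee_pdivrMl// ge0_sume_distrr; last first.
  by move=> i _ /=; rewrite lee_fin.
rewrite (le_trans _ (J_sum K))// le_eqVlt; apply/orP; left; apply/eqP.
apply: eq_bigr => k _; rewrite fE -!EFinM /u; congr _%:E.
by rewrite exprS invfM mulrA.
Qed.

End entropy_integral.

(** For the covering numbers of a Lipschitz curve, which double at each level. *)
Lemma cvg_link_bound_pow (R : realType) (c : nat) :
  cvgn (series (link_bound R (fun k => (c.+1 * 2 ^ k)%N))).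
Proof.
apply: cvg_link_bound => [k|]; first by rewrite muln_gt0 expn_gt0.
pose v := c.+1%:R *: geometric (1 : R) (Num.sqrt 2^-1).
have cv : cvgn (series v) by apply: is_cvg_seriesZ; exact: cvg_geometric_sqrt_half.
apply: series_le_cvg cv => k.
- by rewrite mulr_ge0 ?sqrtr_ge0// invr_ge0 exprn_ge0.
- by rewrite /v mulr_ge0// /geometric /= mul1r exprn_ge0// sqrtr_ge0.
apply: le_trans (_ : c.+1%:R * (2 ^- k * Num.sqrt k.+1%:R) <= _); last first.
  by rewrite ler_wpM2l// pow2_sqrt_le_geometric.
rewrite mulrCA ler_wpM2l ?invr_ge0 ?exprn_ge0//.
have c2 : 0 <= c.+1%:R :> R by [].
rewrite -[X in _ <= X * _](ger0_norm c2) -sqrtr_sqr -sqrtrM ?sqr_ge0// ler_wsqrtr//.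
apply: (@le_trans _ _ (c.+1%:R + k%:R)).
  rewrite natrM lnM ?posrE ?ltr0n ?expn_gt0// natrX lnXn// lerD//.
    by apply: ltW; apply: ln_sublinear; rewrite ltr0n.
  rewrite -[leLHS]mulr_natl -[leRHS]mulr1 ler_wpM2l//.
  by rewrite (natrD _ 1 1) le_ln1Dx// (@lt_trans _ _ 0)// oppr_lt0.
rewrite -natrX -natrM -natrD ler_nat.
by rewrite mulnS leq_add// ?leq_pmull ?expn_gt0// expnS expn1 leq_pmulr.
Qed.

(** * The parameter set contains a neighbourhood of the true parameter *)

(** By Baire's theorem some [A m] is dense in an interval [`]a, b[] with
    [0 < a]. As [T] is closed it contains [`]a, b[ / sqrt n] for every
    [n >= m], and these intervals overlap for large [n]. *)
Lemma scaled_cover_right (R : realType) (T : set R) (A : nat -> set R) :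
  closed T -> \bigcup_(n in [set n | (0 < n)%N]) A n = setT ->
  (forall m n s, (0 < m)%N -> (m <= n)%N -> A m s -> T (s / Num.sqrt n%:R)) ->
  exists2 x1 : R, 0 < x1 & forall x, 0 < x -> x <= x1 -> T x.
Proof.
move=> cT cover AT.
pose C m : set R := \bigcap_(n in [set n | (m < n)%N]) [set s | T (s / Num.sqrt n%:R)].
have cC m : closed (C m).
  apply: closed_bigI => n _.
  apply: (preimage_closed (f := fun s : R => s / Num.sqrt n%:R) (D := T)) => // s _.
  exact: mulrr_continuous.
have AC m s : A m.+1 s -> C m s by move=> As n /= mn; exact: AT As.
pose F m : set R := ~` C m `|` [set s | s < 1].
have oF m : open (F m).
  by apply: openU; [exact: closed_openC|exact: open_lt].
have [m ndF] : exists m, ~ dense (F m).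
  apply: contrapT => /forallNP dF.
  have := @Baire R R^o F (fun m => conj (oF m) (contrapT (dF m))).
  move=> /(_ [set s : R | 1 < s]) [].
  - by exists 2 => /=; rewrite ltr1n.
  - exact: open_gt.
  move=> s /= [s1 Fs].
  have : setT s by []. rewrite -cover => -[[//|n] _ Ans].
  have [hC|/= hs] := Fs n I; first by apply: hC; exact: AC.
  by have := lt_trans s1 hs; rewrite ltxx.
have [G [[s Gs] oG GF]] : exists G : set R, [/\ G !=set0, open G & G `&` F m = set0].
  apply: contrapT => h; apply: ndF => G G0 oG; apply/set0P/eqP => e; apply: h.
  by exists G.
have GC u : G u -> C m u /\ 1 <= u.
  move=> Gu; split.
    by apply: contrapT => nC; have : (G `&` F m) u; [by split => //; left|rewrite GF].
  by rewrite leNgt; apply/negP => u1; have : (G `&` F m) u; [by split => //; right|rewrite GF].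
have [e e0 sG] : exists2 e : R, 0 < e & forall u, `|s - u| < e -> G u.
  have /nbhs_ballP[e /= e0 he] := open_nbhs_nbhs (conj oG Gs).
  by exists e => // u su; apply: he; rewrite -ball_normE.
have s1 := (GC s Gs).2.
pose b := s + e / 2.
have sb : s < b by rewrite ltrDl divr_gt0.
have s0 : 0 < s by rewrite (lt_le_trans ltr01).
have sbC u : s <= u -> u < b -> C m u.
  by move=> su ub; apply: (GC u _).1; apply: sG; rewrite ler0_norm ?subr_le0// /b in ub *; lra.
have d0 : 0 < b ^+ 2 - s ^+ 2 by rewrite subr_gt0 ltr_pXn2r ?nnegrE// ltW// (lt_trans s0).
pose x1 := Num.sqrt (Num.min (b ^+ 2 - s ^+ 2) (s ^+ 2 / m.+1%:R) / 2).
have min0 : 0 < Num.min (b ^+ 2 - s ^+ 2) (s ^+ 2 / m.+1%:R) / 2.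
  by rewrite divr_gt0// lt_min d0 divr_gt0 ?exprn_gt0.
exists x1 => [|x x0 xx1]; first by rewrite sqrtr_gt0.
have x20 : 0 < x ^+ 2 by rewrite exprn_gt0.
have xx : x ^+ 2 < Num.min (b ^+ 2 - s ^+ 2) (s ^+ 2 / m.+1%:R).
  apply: (@le_lt_trans _ _ (x1 ^+ 2)).
    by rewrite ler_pXn2r ?nnegrE ?sqrtr_ge0// ltW.
  by rewrite sqr_sqrtr ?(ltW min0)// ltr_pdivrMr// ltr_pMr ?ltr1n//; move: min0; rewrite pmulr_lgt0.
move: xx; rewrite lt_min => /andP[xb xm].
pose n := (Num.trunc (s ^+ 2 / x ^+ 2)).+1.
have q0 : 0 <= s ^+ 2 / x ^+ 2 by rewrite divr_ge0// sqr_ge0.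
have nlb : s ^+ 2 / x ^+ 2 < n%:R by exact: truncnS_gt.
have nub : n%:R <= s ^+ 2 / x ^+ 2 + 1.
  by rewrite /n -natr1 lerD2r; have /andP[] := truncn_itv q0.
have mn : (m < n)%N.
  rewrite -(ltr_nat R); apply: lt_trans nlb; rewrite ltr_pdivlMr//.
  apply: (@lt_le_trans _ _ (m.+1%:R * x ^+ 2)); first by rewrite ltr_pM2r// ltr_nat.
  by rewrite mulrC -ler_pdivlMr// ltW.
have n0 : 0 < Num.sqrt n%:R :> R by rewrite sqrtr_gt0.
have sx y z : 0 <= y -> y ^+ 2 / x ^+ 2 <= z -> y <= x * Num.sqrt z.
  move=> y0; rewrite ler_pdivrMr// => h.
  rewrite -(ger0_norm y0) -(ger0_norm (ltW x0)) -!sqrtr_sqr -sqrtrM ?sqr_ge0//.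
  by rewrite ler_wsqrtr// mulrC.
have := sbC (x * Num.sqrt n%:R) _ _ n mn; rewrite /= mulfK ?gt_eqF//; apply.
  by apply: sx => //; exact: ltW.
have b0 : 0 < b by exact: lt_trans sb.
rewrite -(ger0_norm (ltW x0)) -(ger0_norm (ltW b0)) -!sqrtr_sqr -sqrtrM ?sqr_ge0//.
rewrite ltr_sqrt ?exprn_gt0//; apply: le_lt_trans (_ : x ^+ 2 * (s ^+ 2 / x ^+ 2 + 1) < _).
  by rewrite ler_wpM2l// ltW.
by rewrite mulrDr mulr1 mulrCA divff ?gt_eqF// mulr1; lra.
Qed.

Lemma scaled_cover_nbhs (R : realType) (Theta : set R) (th0 : R)
    (Theta_ : nat -> set R) :
  closed Theta -> (forall n, Theta_ n `<=` Theta) ->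
  (forall m n, (0 < m)%N -> (m <= n)%N ->
    [set Num.sqrt m%:R * (th - th0) | th in Theta_ m] `<=`
    [set Num.sqrt n%:R * (th - th0) | th in Theta_ n]) ->
  \bigcup_(n in [set n | (0 < n)%N])
    [set Num.sqrt n%:R * (th - th0) | th in Theta_ n] = setT ->
  exists2 x0 : R, 0 < x0 & forall th, `|th - th0| <= x0 -> Theta th.
Proof.
move=> cT sub incr full.
pose S n := [set Num.sqrt n%:R * (th - th0) | th in Theta_ n].
have S_Theta m n s : (0 < m)%N -> (m <= n)%N -> S m s -> Theta (th0 + s / Num.sqrt n%:R).
  move=> m0 mn /(incr m n m0 mn) [th Th <-].
  have n0 : Num.sqrt n%:R != 0 :> R by rewrite sqrtr_eq0 -ltNge ltr0n (leq_trans m0).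
  by rewrite mulrAC divff// mul1r addrC subrK; exact: sub Th.
have [x1 x10 h1] : exists2 x1 : R, 0 < x1 & forall x, 0 < x -> x <= x1 -> Theta (th0 + x).
  apply: (@scaled_cover_right _ [set x | Theta (th0 + x)] S) => //.
  apply: (preimage_closed (f := fun x : R => th0 + x) (D := Theta)) => // x _.
  by apply: continuousD; [exact: cst_continuous|exact: id].
have [x2 x20 h2] : exists2 x1 : R, 0 < x1 & forall x, 0 < x -> x <= x1 -> Theta (th0 - x).
  apply: (@scaled_cover_right _ [set x | Theta (th0 - x)] (fun n => [set s | S n (- s)])) => //.
  - apply: (preimage_closed (f := fun x : R => th0 - x) (D := Theta)) => // x _.
    by apply: continuousB; [exact: cst_continuous|exact: id].
  - apply/seteqP; split => // s _.
    have : setT (- s) by []. by rewrite -full => -[n n0 Sn]; exists n.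
  - by move=> m n s m0 mn /S_Theta => /(_ n m0 mn) /=; rewrite mulNr.
have Th0 : Theta th0.
  have : setT (0 : R) by []. rewrite -full => -[n n0 Sn].
  by have := S_Theta n n 0 n0 (leqnn n) Sn; rewrite mul0r addr0.
exists (Num.min x1 x2) => [|th]; first by rewrite lt_min x10.
have -> : th = th0 + (th - th0) by rewrite addrC subrK.
rewrite [in `|_|]addrC addKr; set x := th - th0; rewrite le_min => /andP[hx1 hx2].
have [x0|x0|->] := ltrgt0P x; last by rewrite addr0.
- by apply: h1 => //; rewrite -(gtr0_norm x0).
- by rewrite -(opprK x); apply: h2; rewrite ?oppr_gt0// -(ltr0_norm x0).
Qed.

(** * Comparison of densities *)

(** Both sides are integrated over [E], the left one first in its second
    variable and the right one first in its first variable. *)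
Lemma pair_integral (R : realType) d (T : measurableType d)
    (pi : probability T R) (E : set (T * T)) (B : set T)
    (N M : T -> \bar R) (g h : T -> R) (alpha beta : R) :
  measurable E -> measurable B -> measurable_fun setT N -> measurable_fun setT M ->
  measurable_fun setT g -> measurable_fun setT h ->
  (forall x, (0 <= N x)%E) -> (forall x, (0 <= M x)%E) ->
  (forall x, 0 <= g x) -> (forall x, 0 <= h x) -> 0 <= alpha ->
  {ae (pi \x pi)%E, forall z, E z -> (N z.1 * (g z.2)%:E <= M z.2 * (h z.1)%:E)%E} ->
  (forall x, B x -> (alpha%:E <= \int[pi]_(y in xsection E x) (g y)%:E)%E) ->
  (forall y, (\int[pi]_(x in ysection E y) (h x)%:E <= beta%:E)%E) ->
  (alpha%:E * \int[pi]_(x in B) N x <= beta%:E * \int[pi]_y M y)%E.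
Proof.
move=> mE mB mN mM mg mh N0 M0 g0 h0 a0 ae_le lower upper.
pose G1 (z : T * T) := (N z.1 * (g z.2 * \1_E z)%:E)%E.
pose G2 (z : T * T) := (M z.2 * (h z.1 * \1_E z)%:E)%E.
have m1E : measurable_fun setT (\1_E : T * T -> R) by exact: measurable_indic.
have mG1 : measurable_fun setT G1.
  apply: emeasurable_funM; first exact: measurableT_comp.
  apply/measurable_EFinP; apply: measurable_funM => //; exact: measurableT_comp.
have mG2 : measurable_fun setT G2.
  apply: emeasurable_funM; first exact: measurableT_comp.
  apply/measurable_EFinP; apply: measurable_funM => //; exact: measurableT_comp.
have G10 z : (0 <= G1 z)%E by rewrite mule_ge0// lee_fin mulr_ge0.
have G20 z : (0 <= G2 z)%E by rewrite mule_ge0// lee_fin mulr_ge0.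
have sec1 x : (\int[pi]_y (g y * \1_E (x, y))%:E = \int[pi]_(y in xsection E x) (g y)%:E)%E.
  rewrite [RHS]integral_mkcond; apply: eq_integral => y _.
  rewrite patchE indicE mem_xsection; case: ifPn => _; rewrite ?mulr1 ?mulr0//.
have sec2 y : (\int[pi]_x (h x * \1_E (x, y))%:E = \int[pi]_(x in ysection E y) (h x)%:E)%E.
  rewrite [RHS]integral_mkcond; apply: eq_integral => x _.
  rewrite patchE indicE mem_ysection; case: ifPn => _; rewrite ?mulr1 ?mulr0//.
have m1x x : measurable_fun setT (fun y => (g y * \1_E (x, y))%:E).
  apply/measurable_EFinP; apply: measurable_funM => //.
  by apply: measurableT_comp => //; exact: measurable_pair1.
have m1y y : measurable_fun setT (fun x => (h x * \1_E (x, y))%:E).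
  apply/measurable_EFinP; apply: measurable_funM => //.
  by apply: measurableT_comp => //; exact: measurable_pair2.
have step1 : (alpha%:E * \int[pi]_(x in B) N x <= \int[(pi \x pi)%E]_z G1 z)%E.
  rewrite (fubini_tonelli1 _ mG1 G10) -ge0_integralZl//; last exact: measurable_funTS.
  apply: (@le_trans _ _ (\int[pi]_(x in B) \int[pi]_y G1 (x, y))%E); last first.
    apply: ge0_subset_integral => //; first exact: measurable_fun_fubini_tonelli_F.
    by move=> x _; exact: integral_ge0.
  apply: ge0_le_integral => //.
  - by move=> x Bx; rewrite mule_ge0.
  - by apply: measurable_funTS; apply: emeasurable_funM.
  - by apply: measurable_funTS; exact: (measurable_fun_fubini_tonelli_F _ mG1 G10).
  move=> x Bx; rewrite /G1 /= ge0_integralZl//; last first.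
    by move=> y _; rewrite lee_fin mulr_ge0.
  by rewrite muleC lee_wpmul2l// sec1; exact: lower.
have step2 : (\int[(pi \x pi)%E]_z G2 z <= beta%:E * \int[pi]_y M y)%E.
  have beta0 : 0 <= beta.
    by rewrite -lee_fin; apply: le_trans (upper point); apply: integral_ge0 => x _; rewrite lee_fin.
  rewrite (fubini_tonelli2 _ mG2 G20) -ge0_integralZl//.
  apply: ge0_le_integral => //.
  - by move=> y _; exact: integral_ge0.
  - exact: (measurable_fun_fubini_tonelli_G _ mG2 G20).
  - by apply: emeasurable_funM.
  move=> y _; rewrite /fubini_G /G2 /= ge0_integralZl//; last first.
    by move=> x _; rewrite lee_fin mulr_ge0.
  by rewrite [leRHS]muleC lee_wpmul2l// sec2; exact: upper.
apply: le_trans step1 _; apply: le_trans step2.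
apply: ae_ge0_le_integral => //.
apply: filterS ae_le => z Ez _; rewrite /G1 /G2 indicE.
have [zE|_] := boolP (z \in E); last by rewrite !mulr0 !mule0.
by rewrite !mulr1; apply: Ez; rewrite -inE.
Qed.

Lemma lebesgue_measure_affine (R : realType) (c b : R) (A : set R) :
  0 < c -> measurable A ->
  lebesgue_measure [set x | A (c * (x - b))] = ((c^-1)%:E * lebesgue_measure A)%E.
Proof.
move=> c0 mA.
pose phi (x : measurableTypeR R) : measurableTypeR R := c * (x - b).
have mphi : measurable_fun setT phi.
  by apply: measurable_funM => //; apply: measurable_funB.
suff h : pushforward (mscale (NngNum (ltW c0)) lebesgue_measure) phi A = lebesgue_measure A.
  rewrite -h /pushforward /mscale /= muleA -EFinM mulVf ?gt_eqF// mul1e.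
  by [].
apply/esym/lebesgue_measure_unique => //= _ [[u v]] _ <-.
rewrite /mscale /pushforward /=.
have -> : phi @^-1` `]u, v] = `](b + u / c), (b + v / c)]%classic.
  apply/seteqP; split => x /=; rewrite !in_itv/= /phi.
    by rewrite -ltrBrDl -lerBlDl ltr_pdivrMr// ler_pdivlMr// ![_ * c]mulrC.
  by rewrite -ltrBrDl -lerBlDl ltr_pdivrMr// ler_pdivlMr// ![_ * c]mulrC.
rewrite !lebesgue_measure_itv/= !lte_fin ltrD2l ltr_pM2r ?invr_gt0//.
case: ifPn => _; last by rewrite mule0.
rewrite -!EFinB -EFinM; congr _%:E; field; exact: lt0r_neq0.
Qed.

(** * The normal approximation on the real line *)

(** Markov's inequality for an exponential moment. *)
Lemma normal_prob_tail (R : realType) (m s t : R) : 0 < s ->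
  (normal_prob m s [set x | t * s <= `|x - m|]%R <= (2 * expR (2^-1 - t))%:E)%E.
Proof.
move=> s0; have sn0 : s != 0 by rewrite gt_eqF.
have mid : measurable_fun setT (id : R -> R) by exact: measurable_id.
have law A : measurable A -> normal_prob m s (id @^-1` A) = gaussian_law m s A.
  by rewrite /gaussian_law (negbTE sn0).
have half l : l ^+ 2 = s ^- 2 -> (normal_prob m s [set x | t <= l * (x - m)]%R <= (expR (2^-1 - t))%:E)%E.
  move=> l2.
  have -> : [set x | t <= l * (x - m)] = [set x | expR (t + l * m) <= expR (l * x)].
    by apply/seteqP; split => x /=; rewrite ler_expR mulrBr lerBrDr.
  apply: le_trans (ge0_markov (normal_prob m s) (expR_gt0 _) _ _) _.
  - by apply: measurableT_comp => //; exact: measurable_funM.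
  - by move=> x; exact: expR_ge0.
  rewrite (@gaussian_mgf R m s l _ _ (normal_prob m s) id mid law) -expRN -EFinM -expRD lee_fin ler_expR l2.
  have -> : s ^- 2 * s ^+ 2 = 1 by rewrite mulVf// expf_neq0.
  lra.
have mset l : measurable ([set x : R | t <= l * (x - m)] : set (measurableTypeR R)).
  rewrite [X in measurable X](_ : _ = setT `&` (fun x : R => l * (x - m)) @^-1` `[t, +oo[).
    have : measurable_fun setT (fun x : R => l * (x - m)).
      by apply: measurable_funM => //; exact: measurable_funB.
    by apply => //; exact: measurable_itv.
  by apply/seteqP; split => x /=; rewrite in_itv/= andbT//; case.
have -> : [set x | t * s <= `|x - m|] =
    [set x | t <= s^-1 * (x - m)] `|` [set x | t <= - s^-1 * (x - m)].
  apply/seteqP; split => x /=.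
    by rewrite ler_normr -ler_pdivlMr// -ler_pdivlMr// !(mulrC _ s^-1) mulrN mulNr => /orP.
  by rewrite ler_normr -ler_pdivlMr// -ler_pdivlMr// !(mulrC _ s^-1) mulrN mulNr => -[]->; rewrite ?orbT.
apply: le_trans (measureU2 _ (mset _) (mset _)) _.
rewrite mulr_natl mulr2n EFinD leeD//; apply: half.
  by rewrite exprVn.
by rewrite sqrrN exprVn.
Qed.

Lemma normal_pdf_gt0 (R : realType) (m s x : R) : s != 0 -> 0 < normal_pdf m s x.
Proof. by move=> s0; rewrite normal_pdfE// mulr_gt0 ?normal_peak_gt0 ?expR_gt0. Qed.

Section local_normal.
Variables (R : realType) (th0 r i0 V : R).
Hypotheses (r0 : 0 < r) (i00 : 0 < i0).

Let m := th0 + r^-1 * (i0^-1 * V).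
Let s := Num.sqrt (r ^- 2 * i0^-1).

Let s2 : s ^+ 2 = r ^- 2 * i0^-1.
Proof. by rewrite sqr_sqrtr// mulr_ge0// ?invr_ge0 ?exprn_ge0// ltW. Qed.

Lemma local_normal_sd_gt0 : 0 < s.
Proof. by rewrite sqrtr_gt0 mulr_gt0// invr_gt0 ?exprn_gt0. Qed.

Let sn0 : s != 0. Proof. by rewrite gt_eqF// local_normal_sd_gt0. Qed.

Lemma local_normal_sdE : s = (r * Num.sqrt i0)^-1.
Proof.
by rewrite /s sqrtrM ?invr_ge0 ?exprn_ge0 ?ltW// !sqrtrV ?exprn_ge0 ?ltW// sqrtr_sqr gtr0_norm// invfM.
Qed.

Lemma local_normal_ratio x y :
  normal_pdf m s x = normal_pdf m s y *
    expR (r * (x - y) * V - r * (x - y) * (r * (x - th0)) * i0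
          + (r * (x - y)) ^+ 2 * i0 / 2).
Proof.
rewrite !normal_pdfE// /normal_fun s2 -[RHS]mulrA; congr (_ * _).
rewrite -expRD; congr expR; rewrite /m; field.
by rewrite !gt_eqF.
Qed.

Lemma local_normal_ub x : normal_pdf m s x <= r * Num.sqrt i0.
Proof.
apply: le_trans (normal_pdf_ub _ _ sn0) _.
have -> : r * Num.sqrt i0 = s^-1 by rewrite local_normal_sdE invrK.
rewrite /normal_peak lef_pV2 ?posrE ?local_normal_sd_gt0//; last first.
  by rewrite sqrtr_gt0 pmulrn_lgt0// mulr_gt0 ?pi_gt0// exprn_gt0// local_normal_sd_gt0.
rewrite -[leLHS](ger0_norm (ltW local_normal_sd_gt0)) -sqrtr_sqr ler_wsqrtr//.
have := pi_ge2 R; have : 0 < s ^+ 2 by rewrite exprn_gt0// local_normal_sd_gt0.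
nra.
Qed.

End local_normal.

Lemma lebesgue_measure_slab (R : realType) (r b sg : R) : 0 < r ->
  sg = 1 \/ sg = -1 ->
  lebesgue_measure [set x | 1 <= sg * (r * (x - b)) <= 2] = (r^-1)%:E.
Proof.
move=> r0 [->|->].
  rewrite (lebesgue_measure_affine b (A := [set x | 1 <= 1 * x <= 2]) r0).
    rewrite [X in lebesgue_measure X](_ : _ = `[1, 2]%classic).
      by rewrite lebesgue_measure_itv/= lte_fin ltr1n -EFinB -EFinM; congr _%:E; lra.
    by apply/seteqP; split => x /=; rewrite in_itv/= mul1r.
  rewrite [X in measurable X](_ : _ = `[1, 2]%classic)//.
  by apply/seteqP; split => x /=; rewrite in_itv/= mul1r.
have e : [set x : R | 1 <= -1 * x <= 2] = `[-2, -1]%classic.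
  apply/seteqP; split => x /=; rewrite in_itv/= mulN1r => /andP[h1 h2]; apply/andP; split; lra.
rewrite (lebesgue_measure_affine b (A := [set x | 1 <= -1 * x <= 2]) r0); last first.
  by rewrite e.
rewrite e lebesgue_measure_itv/= lte_fin ltrN2 ltr1n -EFinB -EFinM; congr _%:E; lra.
Qed.

Section normal_approximation.
Variables (R : realType).
Notation TR := (measurableTypeR R).
Variables (pi : probability TR R).
Variables (th0 r i0 V v0 rho q0 kap L A : R) (D T : set TR) (N M : TR -> \bar R).
Hypotheses (r0 : 0 < r) (i00 : 0 < i0) (Vv0 : `|V| <= v0) (q00 : 0 < q0).
Hypotheses (kap0 : 0 < kap) (kap1 : kap < 1) (L0 : 0 < L) (LA : 2 * L <= A).
Hypotheses (A2 : 2 <= A) (Arho : A / r <= rho / 2).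
Hypotheses (mD : measurable D) (mT : measurable T).
Hypotheses (mN : measurable_fun setT N) (mM : measurable_fun setT M).
Hypotheses (N0 : forall x, (0 <= N x)%E) (M0 : forall x, (0 <= M x)%E).
Hypothesis T_rho : forall x, T x -> `|x - th0| <= rho / 2.
Local Notation J := [set v : TR | (`|r * v| <= A)%R].
Hypothesis D_full :
  (lebesgue_measure (J `\` D) <= (kap / r)%:E)%E.
Hypothesis pi_le : forall (B : set TR) (f : TR -> R), measurable B ->
  B `<=` [set x | `|x - th0| <= rho] -> measurable_fun setT f ->
  (forall x, 0 <= f x) ->
  (\int[pi]_(x in B) (f x)%:E <=
   ((1 + kap) * q0)%:E * \int[lebesgue_measure]_(x in B) (f x)%:E)%E.
Hypothesis pi_ge : forall (B : set TR) (f : TR -> R), measurable B ->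
  B `<=` [set x | `|x - th0| <= rho] -> measurable_fun setT f ->
  (forall x, 0 <= f x) ->
  (((1 - kap) * q0)%:E * \int[lebesgue_measure]_(x in B) (f x)%:E <=
   \int[pi]_(x in B) (f x)%:E)%E.

Let m := th0 + r^-1 * (i0^-1 * V).
Let s := Num.sqrt (r ^- 2 * i0^-1).
Let phi := normal_pdf m s.

(** The comparison of two marginal posterior densities, up to the relative
    error that the local expansion of the likelihood leaves. *)
Hypothesis compare : {ae (pi \x pi)%E, forall z : TR * TR,
  T z.1 -> D (z.2 - z.1) -> `|r * (z.1 - z.2)| <= A ->
  (N z.1 * (phi z.2)%:E <=
   M z.2 * (expR (kap * (1 + `|r * (z.1 - th0)|)) * phi z.1)%:E)%E}.

Let sn0 : s != 0. Proof. by rewrite gt_eqF// local_normal_sd_gt0. Qed.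

Let phi_ge0 x : 0 <= phi x. Proof. exact: normal_pdf_ge0. Qed.

Let mphi : measurable_fun setT (phi : TR -> R). Proof. exact: measurable_normal_pdf. Qed.

Let msub : measurable_fun setT (fun z : TR * TR => z.2 - z.1 : TR).
Proof. by apply: measurable_funB. Qed.

Let m_pre (f : TR * TR -> TR) (B : set TR) : measurable_fun setT f ->
  measurable B -> measurable [set z | B (f z)].
Proof. by move=> mf mB; rewrite -[X in measurable X]setTI; exact: mf. Qed.

Let m_pre1 (f : TR -> TR) (B : set TR) : measurable_fun setT f ->
  measurable B -> measurable [set z | B (f z)].
Proof. by move=> mf mB; rewrite -[X in measurable X]setTI; exact: mf. Qed.

Let m_le (c : R) : measurable ([set x | `|x| <= c] : set TR).
Proof.
rewrite [X in measurable X](_ : _ = `[- c, c]%classic)//.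
by apply/seteqP; split => x /=; rewrite in_itv/= ler_norml.
Qed.

Let center : set TR := [set x | `|r * (x - th0)| <= L].

Let m_aff b : measurable_fun setT (fun x : TR => r * (x - b) : TR).
Proof. by apply: measurable_funM => //; exact: measurable_funB. Qed.

Let mcenter : measurable center.
Proof. exact: (m_pre1 (m_aff th0) (m_le L)). Qed.

Let center_rho : center `<=` [set x | `|x - th0| <= rho].
Proof.
move=> x; rewrite /center /= normrM gtr0_norm// -ler_pdivlMl// => h.
apply: le_trans h _; rewrite mulrC; 
have LA' : L <= A by move: (L0) (LA); lra.
have h1 : L / r <= A / r by rewrite ler_pM2r ?invr_gt0.
have h2 : 0 <= L / r by rewrite divr_ge0// ltW.
by move: (Arho); lra.
Qed.

Let shift_D (x : R) : (lebesgue_measure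
  [set y : TR | (J `\` D) (y - x)%R] <= (kap / r)%:E)%E.
Proof.
have mB : measurable (J `\` D).
  apply: measurableD => //.
  have : measurable_fun setT (fun v : TR => r * v : TR) by exact: measurable_funM.
  by move=> mm; exact: (m_pre1 mm (m_le A)).
have := @lebesgue_measure_affine R 1 x _ ltr01 mB.
rewrite invr1 mul1e => e; apply: le_trans D_full.
rewrite -e le_eqVlt; apply/orP; left; apply/eqP; congr (lebesgue_measure _).
by apply/seteqP; split => y /=; rewrite mul1r.
Qed.

(** [compare] is integrated over pairs of central points. The first point then
    carries the normal mass of [F], and the second one the normal mass of the
    centre, which is close to one. *)
Lemma center_bound (e : R) (F : set TR) : measurable F ->
  (normal_prob m s (~` center) <= e%:E)%E ->
  0 <= 1 - e - Num.sqrt i0 * kap ->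
  (((1 - kap) * q0 * (1 - e - Num.sqrt i0 * kap))%:E *
     \int[pi]_(x in F `&` center `&` T) N x <=
   (expR (kap * (1 + L)) * ((1 + kap) * q0) * fine (normal_prob m s F))%:E *
     \int[pi]_y M y)%E.
Proof.
move=> mF ce a0.
set E : set (TR * TR) := [set z | (F `&` center `&` T) z.1 /\ center z.2 /\ D (z.2 - z.1)].
have mB : measurable (F `&` center `&` T) by do 2 apply: measurableI => //.
have mE : measurable E.
  apply: measurableI; first exact: (m_pre (@measurable_fst _ _ _ _) mB).
  by apply: measurableI; [exact: (m_pre (@measurable_snd _ _ _ _) mcenter)|exact: m_pre].
apply: (pair_integral (E := E) (g := phi) (h := fun x => expR (kap * (1 + L)) * phi x)) => //.
- exact: measurable_funM.
- by move=> x; rewrite mulr_ge0// expR_ge0.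
- by rewrite mulr_ge0// mulr_ge0// ?subr_ge0 ltW.
- apply: filterS compare => z hz [[[Fz cz] Tz] [cz2 Dz]].
  apply: le_trans (hz Tz Dz _) _.
    have -> : r * (z.1 - z.2) = r * (z.1 - th0) - r * (z.2 - th0) by ring.
    apply: le_trans (ler_normB _ _) _; move: cz cz2 (LA); rewrite /center /=; lra.
  by rewrite lee_wpmul2l// lee_fin ler_wpM2r// ler_expR ler_pM2l// lerD2l.
- move=> x [[Fx cx] Tx].
  have -> : xsection E x = center `&` [set y | D (y - x)].
    by apply/seteqP; split => y; rewrite /xsection /= inE /E /=; [case=> _ []|case].
  have mshift : measurable_fun setT (fun y : TR => y - x : TR) by exact: measurable_funB.
  have mC : measurable (center `&` [set y | D (y - x)]).
    by apply: measurableI => //; exact: (m_pre1 mshift mD).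
  apply: le_trans (pi_ge mC _ mphi phi_ge0); last first.
    by apply: subset_trans center_rho; exact: subIsetl.
  rewrite EFinM; apply: lee_wpmul2l.
    by rewrite lee_fin mulr_ge0 ?(ltW q00)// subr_ge0 ltW.
  set C := _ `&` _ in mC *.
  suff : ((1 - e - Num.sqrt i0 * kap)%:E <= normal_prob m s C)%E by [].
  have mCC : measurable (~` C) by exact: measurableC.
  have PC : (normal_prob m s (~` C) <= e%:E + (Num.sqrt i0 * kap)%:E)%E.
    have mQ : measurable [set y : TR | (J `\` D) (y - x)%R].
      apply: (m_pre1 mshift); apply: measurableD => //.
      have mm : measurable_fun setT (fun v : TR => r * v : TR) by exact: measurable_funM.
      exact: (m_pre1 mm (m_le A)).
    apply: (@le_trans _ _ (normal_prob m s (~` center `|`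
        [set y : TR | (J `\` D) (y - x)%R]))).
      apply: le_measure; rewrite ?inE//; first by apply: measurableU => //; exact: measurableC.
      move=> y; have [cy|ncy] := pselect (center y); last by left.
      move=> nC; right; split => /=.
        have -> : r * (y - x) = r * (y - th0) - r * (x - th0) by ring.
        apply: le_trans (ler_normB _ _) _; move: cx cy (LA); rewrite /center /=; lra.
      by move=> Dy; apply: nC.
    apply: le_trans (measureU2 _ _ _) _ => //; first exact: measurableC.
    apply: leeD => //.
    apply: (@le_trans _ _ (\int[lebesgue_measure]_(y in [set y : TR | (J `\` D) (y - x)%R]) (r * Num.sqrt i0)%:E)%E).
      apply: ge0_le_integral => //.
      - by move=> y _; rewrite lee_fin.
      - by apply/measurable_funTS/measurable_EFinP.
      - by move=> y _; rewrite lee_fin; exact: local_normal_ub.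
    rewrite integral_cst//=.
    apply: le_trans (_ : (r * Num.sqrt i0)%:E * (kap / r)%:E <= _)%E.
      by rewrite lee_wpmul2l ?shift_D// lee_fin mulr_ge0 ?sqrtr_ge0// ltW.
    by rewrite -EFinM lee_fin le_eqVlt; apply/orP; left; apply/eqP; field; rewrite gt_eqF.
  have := probability_setC (normal_prob m s) mC => /= pc.
  have fC : normal_prob m s C \is a fin_num by exact: fin_num_measure.
  move: PC; rewrite pc -(fineK fC) -EFinB -EFinD !lee_fin; lra.
- move=> y.
  have mS : measurable (ysection E y) by exact: measurable_ysection.
  have subS : ysection E y `<=` F `&` center.
    by move=> x; rewrite /ysection /= inE /E /= => -[[]].
  apply: le_trans (pi_le mS _ _ _) _.
  - by apply: subset_trans center_rho => x /subS[].
  - exact: measurable_funM.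
  - by move=> x; rewrite mulr_ge0// expR_ge0.
  rewrite [X in (_ <= X)%E](_ : _ = (((1 + kap) * q0)%:E *
    (expR (kap * (1 + L)) * fine (normal_prob m s F))%:E)%E); last first.
    by rewrite -EFinM; congr _%:E; ring.
  apply: lee_wpmul2l.
    by rewrite lee_fin mulr_ge0 ?(ltW q00)// addr_ge0// ltW.
  rewrite EFinM.
  under eq_integral do rewrite EFinM.
  rewrite ge0_integralZl//; last 2 first.
  - by apply/measurable_funTS/measurable_EFinP.
  - by move=> x _; rewrite lee_fin.
  rewrite lee_wpmul2l ?lee_fin ?expR_ge0// fineK ?fin_num_measure//.
  apply: ge0_subset_integral => //.
  - by apply/measurable_funTS/measurable_EFinP.
  - by move=> x _; rewrite lee_fin.
  - by move=> x /subS[].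
Qed.

(** A point of the tail on the side [sg] is compared with the points that are
    between one and two scaled units closer to the centre. There the normal
    density is larger by a factor that is exponential in [L]. *)
Lemma tail_bound (sg : R) : sg = 1 \/ sg = -1 -> kap <= i0 / 2 ->
  (((1 - kap) * q0 * ((1 - kap) / r))%:E *
     \int[pi]_(x in T `&` [set x : TR | (L < sg * (r * (x - th0)))%R]) N x <=
   (expR (2 * v0 + 3 * i0 - L * i0 / 2) * ((1 + kap) * q0) / r)%:E *
     \int[pi]_y M y)%E.
Proof.
move=> sgP kapi.
pose slab (b : R) : set TR := [set x | 1 <= sg * (r * (x - b)) <= 2].
have sgsg : sg * sg = 1 by case: sgP => ->; rewrite ?mulr1// mulrNN mulr1.
have sgn u : `|sg * u| = `|u| by rewrite normrM; case: sgP => ->; rewrite ?normrN normr1 mul1r.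
have maff b : measurable_fun setT (fun x : TR => sg * (r * (x - b)) : TR).
  by apply: measurable_funM => //; exact: m_aff.
have mslab b : measurable (slab b).
  rewrite [X in measurable X](_ : _ = [set x | `[1, 2]%classic (sg * (r * (x - b)))]).
    exact: (m_pre1 (maff b)).
  by apply/seteqP; split => x /=; rewrite in_itv.
set B := T `&` _.
have mB : measurable B.
  apply: measurableI => //.
  rewrite [X in measurable X](_ : _ = [set x | `]L, +oo[%classic (sg * (r * (x - th0)))]).
    exact: (m_pre1 (maff th0)).
  by apply/seteqP; split => x /=; rewrite in_itv/= andbT.
have T_slab x y : T x -> slab y x -> `|x - th0| <= rho /\ `|y - th0| <= rho.
  move=> Tx /andP[h1 h2]; have Tr := T_rho Tx.
  have : `|sg * (r * (x - y))| <= A by rewrite ger0_norm; move: (A2); lra.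
  rewrite sgn normrM gtr0_norm// -ler_pdivlMl// => h3.
  have h4 : `|x - y| <= rho / 2 by apply: le_trans h3 _; rewrite mulrC.
  have r2 : 0 <= rho / 2 by apply: le_trans Tr.
  split; first lra.
  have -> : y - th0 = (x - th0) - (x - y) by ring.
  by apply: le_trans (ler_normB _ _) _; lra.
set E : set (TR * TR) := [set z | B z.1 /\ slab z.2 z.1 /\ D (z.2 - z.1)].
have mE : measurable E.
  apply: measurableI; first exact: (m_pre (@measurable_fst _ _ _ _) mB).
  apply: measurableI; last exact: m_pre.
  rewrite [X in measurable X](_ : _ = [set z : TR * TR | `[1, 2]%classic (sg * (r * (z.1 - z.2)))]).
    apply: (@m_pre (fun z => sg * (r * (z.1 - z.2)))) => //.
    apply: measurable_funM => //; apply: measurable_funM => //.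
    exact: measurable_funB.
  by apply/seteqP; split => x /=; rewrite in_itv.
set C := expR _.
apply: (pair_integral (E := E) (g := fun=> 1) (h := fun=> C)) => //.
- by move=> x; exact: expR_ge0.
- by rewrite !mulr_ge0 ?invr_ge0 ?subr_ge0 ?ltW.
- apply: filterS compare => z hz [[Tz Lz] [sz Dz]].
  have hA : `|r * (z.1 - z.2)| <= A.
    by move: (sz) => /andP[h1 h2]; rewrite -sgn ger0_norm; move: (A2); lra.
  have := hz Tz Dz hA; rewrite /phi (local_normal_ratio th0 V r0 i00 z.1 z.2) -/m -/s -/phi.
  set a := r * (z.1 - z.2); set u := r * (z.1 - th0).
  have p0 : 0 < phi z.2 by exact: normal_pdf_gt0.
  move=> h; rewrite mule1 -(@lee_pmul2r _ (phi z.2)%:E)// ?lte_fin//.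
  apply: le_trans h _; rewrite -muleA; apply: lee_wpmul2l => //.
  rewrite -EFinM lee_fin mulrCA -expRD mulrC ler_pM2r// ler_expR.
  pose a1 := sg * a; pose u1 := sg * u; pose V1 := sg * V.
  have a1b : 1 <= a1 <= 2 by [].
  have u1b : L < u1 by [].
  have V1b : V1 <= v0 by apply: le_trans (ler_norm _) _; rewrite sgn.
  have -> : `|u| = u1 by rewrite -sgn gtr0_norm// (lt_trans L0).
  have -> : a * V - a * u * i0 + a ^+ 2 * i0 / 2 = a1 * V1 - a1 * u1 * i0 + a1 ^+ 2 * i0 / 2.
    by rewrite /a1 /u1 /V1; case: sgP => ->; ring.
  move/andP: a1b => [a1l a1u].
  have v00 : 0 <= v0 by apply: le_trans Vv0.
  have e1 : a1 * V1 <= 2 * v0.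
    apply: (@le_trans _ _ (a1 * v0)); first by rewrite ler_pM2l// (lt_le_trans ltr01).
    by rewrite ler_wpM2r.
  have e2 : u1 * i0 <= a1 * u1 * i0.
    by rewrite ler_pM2r// ler_peMl// ltW// (lt_trans L0).
  have e3 : a1 ^+ 2 * i0 <= 4 * i0.
    rewrite ler_pM2r//; have -> : 4 = 2 ^+ 2 :> R by rewrite -natrX.
    by rewrite ler_pXn2r ?nnegrE//; lra.
  have e4 : kap * (1 + u1) <= i0 / 2 * (1 + u1).
    by rewrite ler_wpM2r// addr_ge0// ltW// (lt_trans L0).
  have e5 : L * i0 <= u1 * i0 by rewrite ler_pM2r// ltW.
  move: (i00); lra.
- move=> x Bx.
  have mQ : measurable [set y : TR | (J `\` D) (y - x)%R].
    have mshift : measurable_fun setT (fun y : TR => y - x : TR) by exact: measurable_funB.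
    apply: (m_pre1 mshift); apply: measurableD => //.
    have mm : measurable_fun setT (fun v : TR => r * v : TR) by exact: measurable_funM.
    exact: (m_pre1 mm (m_le A)).
  have mX : measurable (xsection E x) by exact: measurable_xsection.
  have Xrho : xsection E x `<=` [set y | `|y - th0| <= rho].
    move=> y; rewrite /xsection /= inE /E /= => -[[Tx _] [sxy _]].
    exact: (T_slab x y Tx sxy).2.
  apply: le_trans (pi_ge mX Xrho _ _) => //.
  rewrite EFinM; apply: lee_wpmul2l.
    by rewrite lee_fin mulr_ge0 ?(ltW q00)// subr_ge0 ltW.
  rewrite integral_cst// mul1e.
  pose slab' : set TR := [set y | 1 <= (- sg) * (r * (y - x)) <= 2].
  have slab'E y : slab y x <-> slab' y.
    by rewrite /slab /slab' /= -[x - y]opprB !mulrN mulNr.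
  have Lslab : lebesgue_measure slab' = (r^-1)%:E.
    by apply: lebesgue_measure_slab => //; case: sgP => ->; rewrite ?opprK; [right|left].
  have mslab' : measurable slab'.
    rewrite [X in measurable X](_ : _ = [set y | `[-2, -1]%classic (sg * (r * (y - x)))]).
      exact: (m_pre1 (maff x)).
    by apply/seteqP; split => y; rewrite /slab' /= in_itv/= mulNr => /andP[h1 h2]; apply/andP; split; lra.
  have : (lebesgue_measure slab' <= lebesgue_measure (xsection E x) +
      lebesgue_measure [set y : TR | (J `\` D) (y - x)%R])%E.
    apply: le_trans (measureU2 _ mX mQ).
    apply: le_measure; rewrite ?inE//; first exact: measurableU.
    move=> y sy; have [Dy|nD] := pselect (D (y - x)).
      by left; rewrite /xsection /= inE /E /=; split => //; split => //; apply/slab'E.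
    right; split => //=; move: sy => /slab'E /andP[h1 h2].
    by rewrite -normrN -mulrN opprB -sgn ger0_norm; move: (A2); lra.
  rewrite Lslab => h; have {h} := le_trans h (leeD2l _ (shift_D x)).
  rewrite -leeBlDr// -EFinB; congr (_%:E <= _)%E.
  by field; rewrite gt_eqF.
- move=> y.
  have mX : measurable (ysection E y) by exact: measurable_ysection.
  have Xrho : ysection E y `<=` [set x | `|x - th0| <= rho].
    move=> x; rewrite /ysection /= inE /E /= => -[[Tx _] [sxy _]].
    exact: (T_slab x y Tx sxy).1.
  apply: le_trans (pi_le mX Xrho _ _) _ => //; first by move=> x; exact: expR_ge0.
  have -> : C * ((1 + kap) * q0) / r = ((1 + kap) * q0) * (C * r^-1) by ring.
  rewrite [X in (_ <= X)%E]EFinM; apply: lee_wpmul2l.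
    by rewrite lee_fin mulr_ge0 ?(ltW q00)// addr_ge0// ltW.
  rewrite integral_cst// EFinM; apply: lee_wpmul2l; first by rewrite lee_fin expR_ge0.
  rewrite -(lebesgue_measure_slab y r0 sgP); apply: le_measure; rewrite ?inE//.
    exact: (mslab y).
  by move=> x; rewrite /ysection /= inE /E /= => -[_ []].
Qed.

End normal_approximation.

Lemma expR_le_small (R : realType) (x : R) : 0 <= x -> x <= 2^-1 -> expR x <= 1 + 2 * x.
Proof.
move=> x0 x1; have h := expR_ge1Dx (- x).
have h1 : 0 < 1 - x by lra.
rewrite -[expR x]invrK -expRN; apply: (@le_trans _ _ (1 - x)^-1).
  by rewrite lef_pV2 ?posrE ?expR_gt0.
by rewrite -[leLHS]mul1r ler_pdivrMr//; nra.
Qed.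

(** The comparison of densities says that the density [N] of most of the
    posterior mass is at most proportional to the normal density in the
    centre, and decreases geometrically away from it. Since the total mass is
    one, an upper bound is all that is needed. *)
Lemma normal_approximation (R : realType) (i0 v0 eps : R) :
  0 < i0 -> 0 < v0 -> 0 < eps -> exists A kap : R, [/\ 2 <= A, 0 < kap & kap < 1] /\
  forall (pi : probability (measurableTypeR R) R) (th0 r V rho q0 Z : R)
    (D T F : set (measurableTypeR R)) (N M : measurableTypeR R -> \bar R),
  let normal := normal_prob (th0 + r^-1 * (i0^-1 * V)) (Num.sqrt (r ^- 2 * i0^-1)) in
  let phi := normal_pdf (th0 + r^-1 * (i0^-1 * V)) (Num.sqrt (r ^- 2 * i0^-1)) in
  0 < r -> `|V| <= v0 -> 0 < q0 -> A / r <= rho / 2 ->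
  measurable D -> measurable T -> measurable F ->
  measurable_fun setT N -> measurable_fun setT M ->
  (forall x, (0 <= N x)%E) -> (forall x, (N x <= M x)%E) ->
  (forall x, T x -> `|x - th0| <= rho / 2) ->
  (lebesgue_measure ([set v | (`|r * v| <= A)%R] `\` D) <= (kap / r)%:E)%E ->
  (forall (B : set (measurableTypeR R)) (f : measurableTypeR R -> R), measurable B ->
    B `<=` [set x | `|x - th0| <= rho] -> measurable_fun setT f ->
    (forall x, 0 <= f x) ->
    (\int[pi]_(x in B) (f x)%:E <=
     ((1 + kap) * q0)%:E * \int[lebesgue_measure]_(x in B) (f x)%:E)%E /\
    (((1 - kap) * q0)%:E * \int[lebesgue_measure]_(x in B) (f x)%:E <=
     \int[pi]_(x in B) (f x)%:E)%E) ->
  {ae (pi \x pi)%E, forall z : measurableTypeR R * measurableTypeR R,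
    T z.1 -> D (z.2 - z.1) -> `|r * (z.1 - z.2)| <= A ->
    (N z.1 * (phi z.2)%:E <=
     M z.2 * (expR (kap * (1 + `|r * (z.1 - th0)|)) * phi z.1)%:E)%E} ->
  0 < Z -> (\int[pi]_x M x = Z%:E)%E ->
  (((1 - kap) * Z)%:E <= \int[pi]_(x in T) N x)%E ->
  (\int[pi]_(x in F) M x <= (normal F + eps%:E) * Z%:E)%E.
Proof.
move=> i00 v00 eps0.
pose e := Num.min 1 eps / 100.
have min0 : 0 < Num.min 1 eps by rewrite lt_min ltr01.
have e0 : 0 < e by rewrite divr_gt0.
have e1 : e <= 100^-1 by rewrite ler_pdivrMr// mulVf// ge_min lexx.
have e2 : 100 * e <= eps by rewrite /e mulrC divfK// ge_min lexx orbT.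
(* [L] makes the tails and the normal mass outside of the centre at most [e]. *)
pose L := Num.max 1 (Num.max (2 * (2 * v0 + 3 * i0 - ln e) / i0)
  (v0 / i0 + (2^-1 + ln 2 - ln e) / Num.sqrt i0)).
have L1 : 1 <= L by rewrite le_max lexx.
have L0 : 0 < L by rewrite (lt_le_trans ltr01).
have Lt : expR (2 * v0 + 3 * i0 - L * i0 / 2) <= e.
  rewrite -[X in _ <= X]lnK ?posrE// ler_expR.
  have : 2 * (2 * v0 + 3 * i0 - ln e) / i0 <= L by rewrite !le_max lexx orbT.
  rewrite ler_pdivrMr//; lra.
have si0 : 0 < Num.sqrt i0 by rewrite sqrtr_gt0.
pose tau := Num.sqrt i0 * (L - v0 / i0).
have Ltau : 2 * expR (2^-1 - tau) <= e.
  rewrite -[X in _ <= X]lnK ?posrE// -[X in X * _ <= _]lnK ?posrE// -expRD ler_expR.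
  have : v0 / i0 + (2^-1 + ln 2 - ln e) / Num.sqrt i0 <= L by rewrite !le_max lexx !orbT.
  rewrite -lerBrDl ler_pdivrMr// mulrC -/tau; lra.
pose kap := Num.min (e / (1 + L)) (Num.min (e / (1 + Num.sqrt i0)) (i0 / 2)).
have kap0 : 0 < kap by rewrite !lt_min !divr_gt0// ltr_wpDl// ltW.
have kL : kap * (1 + L) <= e.
  by rewrite -ler_pdivlMr ?ltr_wpDl ?(ltW L0)// ge_min lexx.
have ks : kap * (1 + Num.sqrt i0) <= e.
  by rewrite -ler_pdivlMr ?ltr_wpDl ?sqrtr_ge0// !ge_min lexx orbT.
have ki : kap <= i0 / 2 by rewrite !ge_min lexx !orbT.
have ke : kap <= e by apply: le_trans kL; rewrite ler_peMr ?(ltW kap0)// lerDl ltW.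
have ks' : Num.sqrt i0 * kap <= e.
  by apply: le_trans ks; rewrite mulrDr mulr1 mulrC lerDr ltW.
have kap1 : kap < 1 by lra.
exists (2 * L), kap; split; first by split => //; lra.
move=> pi th0 r V rho q0 Z D T F N M normal phi r0 Vv0 q00 Arho mD mT mF mN mM N0 NM
  T_rho D_full pi_loc compare Z0 ZE TN.
have M0 x : (0 <= M x)%E by apply: le_trans (NM x).
have pi_le B f mB sB mf f0 := (pi_loc B f mB sB mf f0).1.
have pi_ge B f mB sB mf f0 := (pi_loc B f mB sB mf f0).2.
have A2 : 2 <= 2 * L by clear -L1; lra.
pose center : set (measurableTypeR R) := [set x | `|r * (x - th0)| <= L].
pose Tp : set (measurableTypeR R) := T `&` [set x | L < 1 * (r * (x - th0))].
pose Tm : set (measurableTypeR R) := T `&` [set x | L < -1 * (r * (x - th0))].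
have mcenter : measurable center.
  by apply: measurable_set_le => //; apply: measurableT_comp => //; apply: measurable_funM => //; exact: measurable_funB.
have cen : (normal (~` center) <= e%:E)%E.
  apply: (@le_trans _ _ (2 * expR (2^-1 - tau))%:E); last by rewrite lee_fin.
  have sd0 := local_normal_sd_gt0 r0 i00.
  apply: le_trans (normal_prob_tail _ tau sd0); apply: le_measure; rewrite ?inE//.
  - by apply: measurableC; exact: mcenter.
  - by apply: measurable_set_le => //; apply: measurableT_comp => //; exact: measurable_funB.
  move=> y /negP; rewrite -ltNge => hy /=.
  have -> : tau * Num.sqrt (r ^- 2 / i0) = (L - v0 / i0) / r.
    by rewrite (local_normal_sdE r0 i00) /tau; field; rewrite !gt_eqF.
  set m := th0 + _.
  have h1 : L / r < `|y - th0|.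
    by rewrite ltr_pdivrMr// mulrC -[in ltRHS](gtr0_norm r0) -normrM.
  have -> : y - m = (y - th0) - r^-1 * (i0^-1 * V) by rewrite /m; ring.
  apply: (@le_trans _ _ (`|y - th0| - `|r^-1 * (i0^-1 * V)|)); last exact: lerB_dist.
  have -> : `|r^-1 * (i0^-1 * V)| = r^-1 * (i0^-1 * `|V|).
    by rewrite 2!normrM 2?gtr0_norm ?invr_gt0.
  rewrite mulrBl.
  apply: lerB; first exact: ltW.
  rewrite mulrC ler_pM2r ?invr_gt0//.
  by rewrite mulrC ler_pM2r ?invr_gt0.
have fZ x : (x%:E * Z%:E = (x * Z)%:E)%E by rewrite -EFinM.
have Vr (sg : R) (sgP : sg = 1 \/ sg = -1) :
   (\int[pi]_(x in T `&` [set x : measurableTypeR R | (L < sg * (r * (x - th0)))%R]) N x <= (3 * e * Z)%:E)%E.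
  have := tail_bound r0 i00 Vv0 q00 kap0 kap1 L0 A2 Arho mD mT mN mM N0 M0 T_rho D_full pi_le pi_ge compare sgP ki.
  have a0 : 0 < (1 - kap) * q0 * ((1 - kap) / r) by rewrite !mulr_gt0 ?invr_gt0// subr_gt0.
  rewrite ZE fZ -lee_pdivlMl// => /le_trans; apply; rewrite -EFinM lee_fin.
  rewrite ler_pdivrMl// [leRHS]mulrA ler_pM2r//.
  set C := expR _ in Lt *.
  have -> : C * ((1 + kap) * q0) / r = (C * (1 + kap)) * (q0 / r) by ring.
  have -> : (1 - kap) * q0 * ((1 - kap) / r) * (3 * e) = (3 * e * (1 - kap) ^+ 2) * (q0 / r) by ring.
  rewrite ler_pM2r ?divr_gt0//.
  have h1 : C * (1 + kap) <= e * (1 + kap) by rewrite ler_wpM2r// addr_ge0// ltW.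
  have h2 : 0 <= e * kap ^+ 2 by rewrite mulr_ge0 ?sqr_ge0// ltW.
  have h3 : e * kap <= e * 100^-1 by rewrite ler_pM2l// (le_trans ke).
  by rewrite sqrrB; clear -h1 h2 h3 e0; lra.
have cb : (\int[pi]_(x in F `&` center `&` T) N x <= (fine (normal F) + 12 * e)%:E * Z%:E)%E.
  have al0 : 0 < 1 - e - Num.sqrt i0 * kap by clear -e1 ks'; lra.
  have := center_bound r0 i00 q00 kap0 kap1 L0 (lexx (2 * L)) Arho mD mT mN mM N0 M0 D_full pi_le pi_ge compare mF cen (ltW al0).
  have a0 : 0 < (1 - kap) * q0 * (1 - e - Num.sqrt i0 * kap) by rewrite !mulr_gt0 ?invr_gt0// subr_gt0.
  rewrite ZE fZ -lee_pdivlMl// => /le_trans; apply; rewrite -EFinM fZ lee_fin.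
  rewrite ler_pdivrMl// [leRHS]mulrA ler_pM2r//.
  have nF0 : 0 <= fine (normal F) by rewrite fine_ge0.
  have nF1 : fine (normal F) <= 1.
    by rewrite -lee_fin fineK ?fin_num_measure// probability_le1.
  set nF := fine _ in nF0 nF1 *.
  have -> : expR (kap * (1 + L)) * ((1 + kap) * q0) * nF = (expR (kap * (1 + L)) * (1 + kap) * nF) * q0 by ring.
  have -> : (1 - kap) * q0 * (1 - e - Num.sqrt i0 * kap) * (nF + 12 * e) =
    ((1 - kap) * (1 - e - Num.sqrt i0 * kap) * (nF + 12 * e)) * q0 by ring.
  rewrite ler_pM2r//.
  have K1 : expR (kap * (1 + L)) <= 1 + 2 * e.
    apply: le_trans (_ : expR e <= _); first by rewrite ler_expR.
    by apply: expR_le_small; [exact: ltW|clear -e1; lra].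
  apply: (@le_trans _ _ ((1 + 2 * e) * (1 + e) * nF)).
    apply: ler_wpM2r => //; apply: ler_pM; rewrite ?expR_ge0//; last by rewrite lerD2l.
    by rewrite addr_ge0// ltW.
  apply: (@le_trans _ _ ((1 - e) * (1 - 2 * e) * (nF + 12 * e))); last first.
    apply: ler_wpM2r; first by rewrite addr_ge0// mulr_ge0// ltW.
    by apply: ler_pM; clear -e0 e1 ke ks'; lra.
  have h1 : e * nF <= e by rewrite ler_piMr// ltW.
  have h2 : e ^+ 2 <= e * 100^-1 by rewrite expr2 ler_pM2l.
  have h3 : 0 <= e ^+ 2 * e by rewrite mulr_ge0 ?sqr_ge0// ltW.
  have -> : (1 + 2 * e) * (1 + e) * nF = nF + 3 * (e * nF) + 2 * e ^+ 2 * nF by ring.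
  have -> : (1 - e) * (1 - 2 * e) * (nF + 12 * e) =
     nF - 3 * (e * nF) + 2 * e ^+ 2 * nF + 12 * e - 36 * e ^+ 2 + 24 * (e ^+ 2 * e) by ring.
  clear -h1 h2 h3 e0; lra.
have step : (\int[pi]_(x in F) M x <= \int[pi]_(x in F `&` T) N x + (e * Z)%:E)%E.
  have mFT : measurable (F `&` T) by exact: measurableI.
  have mCF : measurable (~` F) by exact: measurableC.
  have hM : (\int[pi]_(x in F) M x + \int[pi]_(x in ~` F) M x = Z%:E)%E.
    rewrite -ZE -ge0_integral_setU//; first by rewrite setUv.
    - exact: measurable_funTS.
    - by apply/disj_setPS => x [].
  have hN : (((1 - kap) * Z)%:E <= \int[pi]_(x in F `&` T) N x + \int[pi]_(x in ~` F) M x)%E.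
    have mCFT : measurable (~` F `&` T) by exact: measurableI.
    apply: le_trans TN _.
    apply: (@le_trans _ _ (\int[pi]_(x in (F `&` T) `|` (~` F `&` T)) N x)%E).
      by rewrite -setIUl setUv setTI.
    apply: le_trans (ge0_integral_setU_le _ mFT mCFT mN N0) _; rewrite leeD2l//.
    apply: (@le_trans _ _ (\int[pi]_(x in ~` F) N x)%E).
      by apply: ge0_subset_integral => //; exact: measurable_funTS.
    by apply: ge0_le_integral => //; exact: measurable_funTS.
  have fin A : measurable A -> (\int[pi]_(x in A) M x)%E \is a fin_num.
    move=> mA; rewrite ge0_fin_numE ?integral_ge0//.
    apply: (@le_lt_trans _ _ (\int[pi]_x M x)%E); last by rewrite ZE ltry.
    by apply: ge0_subset_integral.
  have finN : (\int[pi]_(x in F `&` T) N x)%E \is a fin_num.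
    rewrite ge0_fin_numE ?integral_ge0//.
    apply: (@le_lt_trans _ _ (\int[pi]_(x in F `&` T) M x)%E).
      by apply: ge0_le_integral => //; exact: measurable_funTS.
    by rewrite -ge0_fin_numE ?fin// integral_ge0.
  move: hM hN; rewrite -(fineK (fin _ mF)) -(fineK (fin _ mCF)) -(fineK finN) -!EFinD.
  move=> [hM]; rewrite !lee_fin => hN.
  have h : kap * Z <= e * Z by rewrite ler_pM2r.
  clear -hM hN h; lra.
apply: le_trans step _.
have sub : F `&` T `<=` (F `&` center `&` T) `|` (Tp `|` Tm).
  move=> x [Fx Tx]; have [cx|ncx] := pselect (center x); first by left.
  right; move/negP : ncx; rewrite -ltNge /= => h.
  have [p|q] := leP 0 (r * (x - th0)).
    by left; split => //=; rewrite mul1r -(ger0_norm p).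
  by right; split => //=; rewrite mulN1r -(ltr0_norm q).
have mFcT : measurable (F `&` center `&` T) by apply: measurableI => //; exact: measurableI.
have mhalf (sg : R) : measurable ([set x | L < sg * (r * (x - th0))] : set (measurableTypeR R)).
  by apply: measurable_set_lt => //; do 2 apply: measurable_funM => //; exact: measurable_funB.
have mTp : measurable Tp by exact: measurableI.
have mTm : measurable Tm by exact: measurableI.
have mTT : measurable (Tp `|` Tm) by exact: measurableU.
have NFT : (\int[pi]_(x in F `&` T) N x <=
   (fine (normal F) + 12 * e)%:E * Z%:E + ((3 * e * Z)%:E + (3 * e * Z)%:E))%E.
  apply: (@le_trans _ _ (\int[pi]_(x in (F `&` center `&` T) `|` (Tp `|` Tm)) N x)%E).
    apply: ge0_subset_integral => //; [exact: measurableI|exact: measurableU|exact: measurable_funTS].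
  apply: le_trans (ge0_integral_setU_le _ mFcT mTT mN N0) _; apply: leeD => //.
  apply: le_trans (ge0_integral_setU_le _ mTp mTm mN N0) _.
  by apply: leeD; apply: Vr; [left|right].
apply: le_trans (leeD2r _ NFT) _.
have fn : normal F \is a fin_num by exact: fin_num_measure.
rewrite -[in X in (_ <= X)%E](fineK fn) -!(EFinD, EFinM) lee_fin.
have h : 100 * e * Z <= eps * Z by rewrite ler_pM2r.
have h2 : 0 <= e * Z by rewrite mulr_ge0// ltW.
rewrite !mulrDl; clear -h h2; lra.
Qed.

(** * Measurability in separable normed spaces *)

Lemma countable_enum (T : pointedType) (A : set T) : countable A ->
  exists e : nat -> T, forall a, A a -> exists n, e n = a.
Proof.
move=> /countable_injP[f fi].
exists (fun n => xget point [set a | A a /\ f a = n]) => a Aa; exists (f a).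
case: xgetP => [b -> [Ab fb]|/(_ a)]; last by case.
by apply: fi; rewrite ?inE.
Qed.

(** Reals form a separable space, and separability passes to subsets. *)
Lemma dense_sequence_in (R : realType) (D : set R) : D !=set0 ->
  exists e : nat -> R, (forall n, D (e n)) /\
    forall x eps, D x -> 0 < eps -> exists n, `|e n - x| < eps.
Proof.
move=> [d0 Dd0].
pose near_set (i : rat * nat) : set R := [set y | D y /\ `|y - ratr i.1| < i.2.+1%:R^-1].
pose pt i := if pselect (near_set i !=set0) is left h then sval (cid h) else d0.
have ptD i : D (pt i).
  by rewrite /pt; case: pselect => // h; case: (cid h) => y [].
exists (fun n => if unpickle n is Some i then pt i else d0); split.
  by move=> n; case: unpickle.
move=> x eps Dx eps0.
have [k] := ltr_add_invr (divr_gt0 eps0 (ltr0n R 2)); rewrite add0r => hk.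
have k0 : 0 < k.+1%:R^-1 :> R by rewrite invr_gt0.
have [q] : exists q : rat, `|x - ratr q| < k.+1%:R^-1.
  have /rat_in_itvoo[q] : x - k.+1%:R^-1 < x + k.+1%:R^-1.
    by rewrite ltrD2l gtrN.
  rewrite in_itv/= => /andP[h1 h2]; exists q.
  by rewrite distrC ltr_distl h1 h2.
move=> xq; exists (pickle (q, k)); rewrite pickleK /pt.
case: pselect => [h|/=]; last by move=> h; exfalso; apply: h; exists x.
case: (cid h) => y /= [Dy yq].
have -> : y - x = (y - ratr q) - (x - ratr q) by rewrite opprB addrA subrK.
by apply: le_lt_trans (ler_normB _ _) _; move: (k.+1%:R^-1) hk yq xq => dk; lra.
Qed.

Section borel_measurability.
Variables (R : realType) (V : normedModType R).
Hypothesis sepV : separable V.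

(** Open sets are countable unions of balls around the points of a dense
    sequence. *)
Lemma measurable_fun_borel d (T : measurableType d) (D : set T) (f : T -> V) :
  measurable D ->
  (forall (c : V) (r : R), measurable (D `&` [set x | `|f x - c| < r])) ->
  measurable_fun D (f : T -> borel V).
Proof.
move=> mD hf; apply: (@measurability _ _ T (borel V) D f (@open V) erefl) => _ [U oU <-].
have [A cA dA] := sepV.
have [e eA] := countable_enum cA.
pose good (i : nat * nat) := ball (e i.1) (i.2.+1%:R^-1 : R) `<=` U.
pose B (n : nat) : set T := if unpickle n is Some i then
  (if pselect (good i) is left _ then D `&` [set x | `|f x - e i.1| < i.2.+1%:R^-1] else set0)
  else set0.
rewrite [X in measurable X](_ : _ = \bigcup_n B n).
  apply: bigcup_measurable => n _; rewrite /B; case: unpickle => // i.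
  by case: pselect.
apply/seteqP; split => x; last first.
  move=> [n _]; rewrite /B; case: unpickle => // i; case: pselect => // gi [Dx /= hx].
  by split => //; apply: gi; rewrite -ball_normE /= distrC.
move=> [Dx Ux].
have /nbhs_ballP[eps /= eps0 he] := open_nbhs_nbhs (conj oU Ux).
have [k] := ltr_add_invr (divr_gt0 eps0 (ltr0n R 2)); rewrite add0r => hk.
have [a [Aa ha]] : ball (f x) (k.+1%:R^-1 : R) `&` A !=set0.
  apply: dA; last exact: ball_open.
  by exists (f x); apply: ballxx.
have [n en] := eA _ ha.
exists (pickle (n, k)) => //; rewrite /B pickleK.
have xa : `|f x - e n| < k.+1%:R^-1 by move: Aa; rewrite -ball_normE en.
case: pselect => [_|ng]; first by split.
exfalso; apply: ng => y; rewrite -ball_normE /= => hy; apply: he; rewrite -ball_normE /=.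
have -> : f x - y = (f x - e n) + (e n - y) by rewrite addrA subrK.
by apply: le_lt_trans (ler_normD _ _) _; move: (k.+1%:R^-1) hk xa hy => dk; lra.
Qed.

Lemma continuous_borel (V' : ptopologicalType) (g : V -> V') :
  continuous g -> measurable_fun setT (g : borel V -> borel V').
Proof.
move=> cg; apply: (@measurability _ _ (borel V) (borel V') setT g (@open V') erefl) => _ [U oU <-].
rewrite setTI; apply: sub_sigma_algebra.
by apply: open_comp => // x _; exact: cg.
Qed.

Lemma continuous_borel_real (g : V -> R) :
  continuous g -> measurable_fun setT (g : borel V -> R).
Proof.
move=> cg; apply: (@measurability _ _ (borel V) R setT g _ (RGenOpens.measurableE R)).
move=> _ [_ [a [b ->]] <-].
rewrite setTI; apply: sub_sigma_algebra.
by apply: open_comp => // x _; exact: cg.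
Qed.

Lemma measurable_norm_dist d (T : measurableType d) (D : set T) (f : T -> V) (c : V) :
  measurable_fun D (f : T -> borel V) -> measurable_fun D (fun x => `|f x - c|).
Proof.
move=> mf; have h : measurable_fun setT ((fun y : V => `|y - c|) : borel V -> R).
  apply: continuous_borel_real => y; apply: (continuous_comp (f := fun y => y - c)).
    by apply: continuousB; [exact: id|exact: cst_continuous].
  exact: norm_continuous.
exact: (measurableT_comp h mf).
Qed.

(** By continuity, whether [F x y] lies in a ball can be tested at the points of
    a sequence of parameters that is dense in [D0]. *)
Lemma measurable_caratheodory d (Y : measurableType d)
    (D0 : set (measurableTypeR R)) (Y0 : set Y) (F : R -> Y -> V) :
  measurable D0 -> measurable Y0 ->
  (forall x, D0 x -> measurable_fun Y0 (F x : Y -> borel V)) ->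
  (forall x y eps, D0 x -> Y0 y -> 0 < eps -> exists2 dl, 0 < dl &
     forall x', D0 x' -> `|x' - x| < dl -> `|F x' y - F x y| < eps) ->
  measurable_fun (D0 `*` Y0)
    ((fun p => F p.1 p.2) : measurableTypeR R * Y -> borel V).
Proof.
move=> mD0 mY0 mF cF.
have mDY : measurable (D0 `*` Y0) by exact: measurableX.
have [D00|/set0P/negP/negPn/eqP D00] := pselect (D0 !=set0); last first.
  by rewrite D00 set0X; exact: measurable_fun_set0.
apply: measurable_fun_borel => // c r.
have [e [De dense_e]] := dense_sequence_in D00.
pose B (k m j : nat) : set (measurableTypeR R * Y) := [set p | (D0 `*` Y0) p /\
  (`|e j - p.1| < m.+1%:R^-1 -> `|F (e j) p.2 - c| <= r - k.+1%:R^-1)].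
have mB k m j : measurable (B k m j).
  have -> : B k m j =
    (D0 `&` [set x : measurableTypeR R | m.+1%:R^-1 <= `|e j - x|]) `*` Y0 `|`
    D0 `*` (Y0 `&` (fun y => `|F (e j) y - c|) @^-1` `]-oo, (r - k.+1%:R^-1)]).
    apply/seteqP; split => [[x y] [[/= Dx Yy] h]|[x y]].
      have [lt|le] := ltP `|e j - x| m.+1%:R^-1; [right|left] => //=.
      by split => //; split => //; rewrite in_itv/=; exact: h.
    by case=> /= -[]; [move=> [Dx h] Yy|move=> Dx [Yy]; rewrite in_itv/= => h];
      split => //= h2; move: h; rewrite ?leNgt ?h2.
  apply: measurableU; apply: measurableX => //.
    apply: measurableI => //; apply: measurable_set_le => //.
    by apply: measurableT_comp => //; exact: measurable_funB.
  by apply: measurable_norm_dist => //; exact: mF.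
rewrite [X in measurable X](_ : _ = \bigcup_k \bigcup_m \bigcap_j B k m j).
  apply: bigcup_measurable => k _; apply: bigcup_measurable => m _.
  by apply: bigcap_measurable => // j _.
apply/seteqP; split => [[x y] [[/= Dx Yy] h]|[x y] [k _ [m _ hB]]]; last first.
  have [[/= Dx Yy] _] := hB 0%N I; split => //=.
  have k0 : 0 < k.+1%:R^-1 :> R by rewrite invr_gt0.
  have [dl dl0 hdl] := cF x y _ Dx Yy k0.
  have min0 : 0 < Num.min dl m.+1%:R^-1 by rewrite lt_min dl0 invr_gt0 ltr0n.
  have [j] := dense_e x _ Dx min0; rewrite lt_min => /andP[j1 j2].
  have [_ /= /(_ j2) h1] := hB j I.
  have h2 := hdl _ (De j) j1.
  have -> : F x y - c = (F (e j) y - c) - (F (e j) y - F x y).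
    by rewrite opprB [RHS]addrC addrA subrK.
  by apply: le_lt_trans (ler_normB _ _) _; move: (k.+1%:R^-1) h1 h2 => dk; lra.
have rr : 0 < (r - `|F x y - c|) / 2 by rewrite divr_gt0// subr_gt0.
have [k] := ltr_add_invr rr; rewrite add0r => hk.
have [dl dl0 hdl] := cF x y _ Dx Yy rr.
have [m] := ltr_add_invr dl0; rewrite add0r => hm.
exists k => //; exists m => // j _; split => //= hj.
have h2 := hdl _ (De j) (lt_trans hj hm).
have -> : F (e j) y - c = (F (e j) y - F x y) + (F x y - c) by rewrite addrA subrK.
by apply: le_trans (ler_normD _ _) _; move: (k.+1%:R^-1) hk h2 => dk; lra.
Qed.

Lemma measurable_line (g : V) :
  measurable_fun setT ((fun p => p.2 + p.1 *: g) :
    measurableTypeR R * borel V -> borel V).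
Proof.
have := @measurable_caratheodory _ (borel V) setT setT (fun x f => f + x *: g).
rewrite setXTT; apply => //.
  move=> x _; apply: (@continuous_borel V) => y.
  by apply: (@cvgD R V); [exact: cvg_id|exact: cvg_cst].
move=> x y eps _ _ eps0; exists (eps / (`|g| + 1)).
  by rewrite divr_gt0// ltr_wpDl.
move=> x' _ hx; rewrite opprD addrACA subrr add0r -scalerBl normrZ.
apply: (@le_lt_trans _ _ (`|x' - x| * (`|g| + 1))).
  by rewrite ler_wpM2l// lerDl.
by rewrite -ltr_pdivlMr// ltr_wpDl.
Qed.

End borel_measurability.

(** * Differentiable families of operators *)

(** The Lipschitz bound makes the sublevel set relatively open in [D]. *)
Lemma measurable_lipschitz_lt (R : realType) (V : normedModType R)
    (D : set V) (g : V -> R) (L c : R) :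
  0 <= L -> measurable (D : set (borel V)) ->
  (forall x y, D x -> D y -> g x <= g y + L * `|x - y|) ->
  measurable (D `&` [set x | g x < c] : set (borel V)).
Proof.
move=> L0 mD lip.
have L1 : 0 < L + 1 by rewrite ltr_wpDl.
pose U := \bigcup_(x in D `&` [set x | g x < c]) ball x ((c - g x) / (L + 1)).
have -> : D `&` [set x | g x < c] = D `&` U.
  apply/seteqP; split => x [Dx hx]; split => //.
    by exists x => //; apply: ballxx; rewrite divr_gt0// subr_gt0.
  case: hx => y [Dy gy]; rewrite -ball_normE /= ltr_pdivlMr// => xy.
  apply: le_lt_trans (lip _ _ Dx Dy) _; rewrite distrC.
  by have := normr_ge0 (y - x); move: gy xy => /=; nra.
apply: measurableI => //; apply: sub_sigma_algebra.
by apply: bigcup_open => x _; exact: ball_open.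
Qed.

Lemma ler0_small (R : realType) (z c x0 : R) : 0 < x0 ->
  (forall t, 0 < t -> t <= x0 -> z <= t * c) -> z <= 0.
Proof.
move=> x00 h; rewrite leNgt; apply/negP => z0.
pose t := Num.min x0 (z / (2 * (`|c| + 1))).
have c1 : 0 < `|c| + 1 by rewrite ltr_wpDl.
have t0 : 0 < t by rewrite lt_min x00 divr_gt0// mulr_gt0.
have t1 : t <= x0 by rewrite ge_min lexx.
have t2 : t * (2 * (`|c| + 1)) <= z.
  by rewrite -ler_pdivlMr ?mulr_gt0// ge_min lexx orbT.
have := h t t0 t1; have := ler_norm c; clear h t1; nra.
Qed.

Section differentiable_family.
Variables (R : realType) (H1 H2 : hilbertType R) (K : R -> {linear H1 -> H2}).
Variables (H : normed_subspace H1) (D : R -> H1 -> H2) (th0 x0 C : R).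
Hypothesis x00 : 0 < x0.
Hypothesis expand : forall th th' f, `|th - th0| <= x0 -> `|th' - th0| <= x0 ->
  ns_set H f ->
  `|K th f - K th' f - (th - th') *: D th' f| <= C * `|th - th'| ^+ 2 * ns_norm H f.

Let center : `|th0 - th0| <= x0. Proof. by rewrite subrr normr0 ltW. Qed.

(** A derivative is determined by its first order expansion, and the linear
    combination of two expansions is an expansion. *)
Lemma derivative_linear a f g : ns_set H f -> ns_set H g ->
  D th0 (a *: f + g) = a *: D th0 f + D th0 g.
Proof.
move=> Hf Hg; have Hfg : ns_set H (a *: f + g) by exact: ns_set_linear.
apply/eqP; rewrite -subr_eq0 -normr_le0.
apply: (@ler0_small _ _ (C * (ns_norm H (a *: f + g) + `|a| * ns_norm H f + ns_norm H g)) x0) => // t t0 tx.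
have ht : `|th0 + t - th0| <= x0 by rewrite addrC addKr gtr0_norm.
have e z (Hz : ns_set H z) := expand ht center Hz.
rewrite -[th0 + t]addrC addrK (gtr0_norm t0) in e.
have e1 := e _ Hfg; have e2 := e _ Hf; have e3 := e _ Hg.
have key : t *: (D th0 (a *: f + g) - (a *: D th0 f + D th0 g)) =
    a *: (K (t + th0) f - K th0 f - t *: D th0 f) + (K (t + th0) g - K th0 g - t *: D th0 g)
    - (K (t + th0) (a *: f + g) - K th0 (a *: f + g) - t *: D th0 (a *: f + g)).
  have -> : K (t + th0) (a *: f + g) - K th0 (a *: f + g) =
      a *: (K (t + th0) f - K th0 f) + (K (t + th0) g - K th0 g).
    by rewrite (linearP (K (t + th0))) (linearP (K th0)) scalerBr opprD addrACA.
  rewrite !scalerBr opprB [X in _ = X + _]addrACA -opprD [RHS]addrC addrA subrK.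
  by rewrite scalerDr !scalerA (mulrC t a).
rewrite -(ler_pM2l t0) -[X in X * `|_|](gtr0_norm t0) -normrZ key.
apply: le_trans (ler_normB _ _) _.
apply: (@le_trans _ _ (`|a| * (C * t ^+ 2 * ns_norm H f) + C * t ^+ 2 * ns_norm H g + C * t ^+ 2 * ns_norm H (a *: f + g))).
  apply: lerD => //; apply: le_trans (ler_normD _ _) _; apply: lerD => //.
  by rewrite normrZ ler_wpM2l.
lra.
Qed.

Lemma derivativeD f g : ns_set H f -> ns_set H g ->
  D th0 (f + g) = D th0 f + D th0 g.
Proof. by move=> Hf Hg; have := derivative_linear 1 Hf Hg; rewrite !scale1r. Qed.

Lemma derivativeB f g : ns_set H f -> ns_set H g ->
  D th0 (f - g) = D th0 f - D th0 g.
Proof.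
move=> Hf Hg; have := derivative_linear (-1) Hg Hf.
by rewrite !scaleN1r (addrC (- g)) (addrC (- D th0 g)).
Qed.

(** The second order error of a step disappears when the segment between the
    two parameters is cut into many steps. *)
Lemma family_lipschitz D1 th th' f : ns_set H f ->
  (forall th, `|th - th0| <= x0 -> `|D th f| <= D1 * `|f|) ->
  `|th - th0| <= x0 -> `|th' - th0| <= x0 ->
  `|K th f - K th' f| <= D1 * `|th - th'| * `|f|.
Proof.
move=> Hf bD hth hth'.
pose c := C * `|th - th'| ^+ 2 * ns_norm H f.
rewrite -subr_le0; apply: (@ler0_small _ _ c 1) => // e e0 _.
have [m] := ltr_add_invr e0; rewrite add0r => hm.
pose N : R := m.+1%:R; have N0 : 0 < N by rewrite ltr0n.
pose pt (j : nat) := th' + j%:R / N * (th - th').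
have ptb j : (j <= m.+1)%N -> `|pt j - th0| <= x0.
  move=> jm; have l0 : 0 <= j%:R / N by rewrite divr_ge0// ltW.
  have l1 : j%:R / N <= 1 by rewrite ler_pdivrMr// mul1r ler_nat.
  have -> : pt j - th0 = j%:R / N * (th - th0) + (1 - j%:R / N) * (th' - th0).
    rewrite /pt; ring.
  apply: le_trans (ler_normD _ _) _; rewrite (normrM (j%:R / N)) (normrM (1 - _)) (ger0_norm l0) (ger0_norm (x := 1 - _)) ?subr_ge0//.
  move: (j%:R / N) l0 l1 => l l0 l1; move: hth hth' (normr_ge0 (th - th0)) (normr_ge0 (th' - th0)); nra.
have step j : (j < m.+1)%N -> `|K (pt j.+1) f - K (pt j) f| <= N^-1 * (D1 * `|th - th'| * `|f|) + N^-1 * N^-1 * c.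
  move=> jm.
  have d : pt j.+1 - pt j = N^-1 * (th - th') by rewrite /pt -[j.+1]addn1 natrD; ring.
  have := expand (ptb _ jm) (ptb _ (ltnW jm)) Hf; rewrite d => h.
  rewrite -[K _ f - K _ f](subrK ((N^-1 * (th - th')) *: D (pt j) f)).
  apply: le_trans (ler_normD _ _) _; rewrite addrC; apply: lerD.
    rewrite normrZ normrM gtr0_norm ?invr_gt0// -!mulrA ler_wpM2l ?invr_ge0 ?(ltW N0)//.
    by rewrite mulrCA ler_wpM2l// bD// ptb// ltnW.
  apply: le_trans h _; rewrite normrM gtr0_norm ?invr_gt0// /c.
  by rewrite le_eqVlt; apply/orP; left; apply/eqP; ring.
have tel j : (j <= m.+1)%N -> `|K (pt j) f - K th' f| <=
    j%:R * (N^-1 * (D1 * `|th - th'| * `|f|) + N^-1 * N^-1 * c).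
  elim: j => [_|j IH jm]; first by rewrite /pt !mul0r addr0 subrr normr0.
  rewrite -[K _ f](subrK (K (pt j) f)) -addrA.
  apply: le_trans (ler_normD _ _) (le_trans (lerD (step j jm) (IH (ltnW jm))) _).
  by rewrite -natr1 mulrDl mul1r addrC.
have := tel m.+1 (leqnn _); rewrite /pt divff ?gt_eqF// mul1r [th' + _]addrC subrK -/N => h.
have c0 : 0 <= c.
  have := expand hth hth' Hf; exact: le_trans.
have : N * (N^-1 * (D1 * `|th - th'| * `|f|) + N^-1 * N^-1 * c) = D1 * `|th - th'| * `|f| + N^-1 * c.
  by field; rewrite gt_eqF.
have : N^-1 * c <= e * c by rewrite ler_wpM2r// ltW.
move=> q1 q2; rewrite q2 in h; by rewrite lerBlDl (le_trans h)// lerD2l.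
Qed.

End differentiable_family.

(** * The local expansion of the likelihood *)

Lemma covered_lipschitz_curve (R : realType) (V : hilbertType R) (g : R -> V)
    (th0 x0 : R) (c : nat) :
  0 < x0 -> 2 * x0 < c.+1%:R ->
  (forall x y, `|x - th0| <= x0 -> `|y - th0| <= x0 -> `|g x - g y| <= `|x - y|) ->
  forall k, covered [set g x | x in [set x | `|x - th0| <= x0]] (2 ^- k) (c.+1 * 2 ^ k)%N.
Proof.
move=> x00 hc lip k.
have p0 : 0 < 2 ^+ k :> R by rewrite exprn_gt0.
pose pt (j : nat) : R := th0 - x0 + j%:R / 2 ^+ k.
exists (fun j => g (pt j)) => _ [x hx <-].
have /andP[l0 l1] : 0 <= x - th0 + x0 <= 2 * x0.
  by move: hx; rewrite /= ler_norml => /andP[]; lra.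
pose y := (x - th0 + x0) * 2 ^+ k.
have y0 : 0 <= y by rewrite mulr_ge0// ltW.
have /andP[j0 j1] := Num.Theory.truncn_itv y0.
set j := Num.truncn y in j0 j1.
have jb : (j < c.+1 * 2 ^ k)%N.
  rewrite -(ltr_nat R) (le_lt_trans j0)// natrM natrX /y ltr_pM2r//.
  exact: le_lt_trans hc.
have e1 : j%:R / 2 ^+ k <= x - th0 + x0 by rewrite ler_pdivrMr.
have e2 : x - th0 + x0 < j%:R / 2 ^+ k + 2 ^- k.
  have -> : j%:R / 2 ^+ k + 2 ^- k = j.+1%:R / 2 ^+ k :> R by rewrite -[j.+1]addn1 natrD mulrDl mul1r.
  by rewrite ltr_pdivlMr.
have e3 : 0 <= j%:R / 2 ^+ k :> R by rewrite divr_ge0// ltW.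
exists (Ordinal jb) => //=; rewrite -ball_normE /=.
have hp : `|pt j - th0| <= x0.
  move: (hx); rewrite /= !ler_norml /pt => /andP[a1 a2].
  by move: (j%:R / 2 ^+ k) e1 e3 => z e1 e3; apply/andP; split; lra.
apply: le_lt_trans (lip _ _ hp hx) _; rewrite /pt.
have aux (z w : R) : z <= x - th0 + x0 -> x - th0 + x0 < z + w ->
    `|th0 - x0 + z - x| < w.
  by clear; rewrite ltr_norml => h1 h2; apply/andP; split; lra.
exact: aux.
Qed.

(** The quadratic part of the likelihood expansion. The vector [g + e], with
    [e = e1 + e2 - e3 - e4], is the exact slope of the signal along the
    perturbed least favourable path, and [h] is the distance of the signal from
    the truth. The term linear in the bias [b] is the only one that does not
    come with a factor [t]: the estimate for it must be made on the projected
    slope [g + e2 - e4]. *)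
Lemma quadratic_expansion (R : realType) (V : hilbertType R)
    (g kd e1 e2 e3 e4 b r2 : V) (r u t A B ep : R) :
  let a := r * u in let s := r * t in
  let G := g + (e1 + e2 - e3 - e4) in
  let h := b + t *: (kd + e2) + r2 in
  0 <= r -> `|a| <= A -> `|g| <= B -> `|kd| <= B -> ep <= 1 ->
  inner kd g = `|g| ^+ 2 ->
  `|e1| <= ep -> `|e2| <= ep -> `|e3| <= ep -> `|e4| <= ep ->
  r * (`|b| * (`|e1| + `|e3|)) <= ep * (1 + `|s|) ->
  r * `|inner b (g + e2 - e4)| <= ep -> `|r2| <= ep * `|t| ->
  - (r ^+ 2 * inner h (u *: G)) + r ^+ 2 / 2 * `|u *: G| ^+ 2 <=
  - (a * s * `|g| ^+ 2) + a ^+ 2 * `|g| ^+ 2 / 2 +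
    ep * (A * (10 + 6 * B) + A ^+ 2 * (4 * B + 8)) * (1 + `|s|).
Proof.
move=> a s G h r0 aA gB kB ep1 kg he1 he2 he3 he4 hb hbias hr2.
have ep0 : 0 <= ep by apply: le_trans he1.
have B0 : 0 <= B by apply: le_trans gB.
have A0 : 0 <= A by apply: le_trans aA.
pose e := e1 + e2 - e3 - e4.
have he : `|e| <= 4 * ep.
  rewrite /e; apply: le_trans (ler_normB _ _) _.
  have := ler_normB (e1 + e2) e3; have := ler_normD e1 e2.
  move: he1 he2 he3 he4; lra.
have GE : G = g + e by [].
have cs (x y : V) p q : `|x| <= p -> `|y| <= q -> `|inner x y| <= p * q.
  by move=> hx hy; apply: le_trans (cauchy_schwarz _ _) _; exact: ler_pM.
have q1 : `| `|G| ^+ 2 - `|g| ^+ 2| <= (8 * B + 16) * ep.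
  have -> : `|G| ^+ 2 - `|g| ^+ 2 = 2 * inner g e + `|e| ^+ 2 by rewrite GE normD_sqr; ring.
  have h1 := cs _ _ _ _ gB he.
  have h2 : `|e| ^+ 2 <= 16 * ep.
    apply: (@le_trans _ _ ((4 * ep) ^+ 2)); first by rewrite lerXn2r ?nnegrE// mulr_ge0.
    by clear -ep0 ep1; nra.
  apply: le_trans (ler_normD _ _) _.
  rewrite normrM (ger0_norm (ler0n R 2)) (ger0_norm (sqr_ge0 _)).
  by move: h1 h2; lra.
have q2 : `|s * `|g| ^+ 2 - r * inner h G| <= ep * (10 + 6 * B) * (1 + `|s|).
  have -> : s * `|g| ^+ 2 - r * inner h G =
      - (r * inner b (g + e2 - e4)) - r * inner b (e1 - e3)
      - s * (inner e2 g + inner (kd + e2) e) - r * inner r2 G.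
    by rewrite GE /h /e /s !(innerDl, innerZl, innerDr, innerBr) kg; ring.
  have h1 : `|r * inner b (e1 - e3)| <= ep * (1 + `|s|).
    rewrite normrM (ger0_norm r0); apply: le_trans hb; rewrite ler_wpM2l//.
    apply: le_trans (cauchy_schwarz _ _) _; rewrite ler_wpM2l//; exact: ler_normB.
  have h2 : `|r * inner b (g + e2 - e4)| <= ep by rewrite normrM (ger0_norm r0).
  have h3 : `|s * (inner e2 g + inner (kd + e2) e)| <= `|s| * (ep * B + (B + ep) * (4 * ep)).
    rewrite normrM ler_wpM2l//; apply: le_trans (ler_normD _ _) _.
    apply: lerD; first exact: cs.
    by apply: cs => //; apply: le_trans (ler_normD _ _) _; exact: lerD.
  have h4 : `|r * inner r2 G| <= `|s| * (ep * (B + 4 * ep)).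
    rewrite normrM /s normrM -mulrA ler_wpM2l// mulrA [`|t| * ep]mulrC; apply: cs => //.
    by rewrite GE; apply: le_trans (ler_normD _ _) _; exact: lerD.
  apply: le_trans (ler_normB _ _) _; apply: le_trans (lerD (ler_normB _ _) (lexx _)) _.
  apply: le_trans (lerD (lerD (ler_normB _ _) (lexx _)) (lexx _)) _.
  rewrite normrN; have s0 := normr_ge0 s.
  apply: le_trans (lerD (lerD (lerD h2 h1) h3) h4) _.
  have : `|s| * (ep * ep) <= `|s| * ep by rewrite ler_wpM2l// ler_piMl.
  have : 0 <= `|s| * ep by exact: mulr_ge0.
  have : 0 <= ep * B by exact: mulr_ge0.
  clear -ep0; move: (`|s|) => x; lra.
have -> : - (r ^+ 2 * inner h (u *: G)) + r ^+ 2 / 2 * `|u *: G| ^+ 2 =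
    - (a * s * `|g| ^+ 2) + a ^+ 2 * `|g| ^+ 2 / 2 +
    a * (s * `|g| ^+ 2 - r * inner h G) + a ^+ 2 / 2 * (`|G| ^+ 2 - `|g| ^+ 2).
  by rewrite innerZr normrZ exprMn real_normK ?num_real// /a /s; field.
rewrite -[X in X <= _]addrA lerD2l.
have h1 : a * (s * `|g| ^+ 2 - r * inner h G) <= A * (ep * (10 + 6 * B) * (1 + `|s|)).
  by apply: le_trans (ler_norm _) _; rewrite normrM; exact: ler_pM.
have h2 : a ^+ 2 / 2 * (`|G| ^+ 2 - `|g| ^+ 2) <= A ^+ 2 / 2 * ((8 * B + 16) * ep).
  apply: le_trans (ler_norm _) _; rewrite normrM; apply: ler_pM => //.
  rewrite normrM (ger0_norm (x := 2^-1))// ler_pM2r// normrX.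
  by rewrite lerXn2r ?nnegrE.
have h3 : A ^+ 2 / 2 * ((8 * B + 16) * ep) <= A ^+ 2 / 2 * ((8 * B + 16) * ep) * (1 + `|s|).
  by rewrite ler_peMr ?lerDl// !mulr_ge0// ?addr_ge0 ?mulr_ge0// sqr_ge0.
apply: le_trans (lerD h1 (le_trans h2 h3)) _; clear; move: (`|s|) => x; lra.
Qed.

Lemma cross_term_le (R : realFieldType) (C L A s : R) :
  0 <= C -> 0 <= L -> 1 <= A -> 0 <= s ->
  C * (A + 2 * (A + s)) + L * (A + s) <= (3 * C + L) * A * (1 + s).
Proof.
move=> C0 L0 A1 s0; have h1 : s <= A * s by rewrite ler_peMl.
have h2 : C * s <= C * (A * s) by rewrite ler_wpM2l.
have h3 : L * s <= L * (A * s) by rewrite ler_wpM2l.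
have h4 : 0 <= C * (A * s) by rewrite !mulr_ge0// (le_trans _ A1).
lra.
Qed.

Lemma ae_and (R : realType) d (T : measurableType d)
    (mu : {measure set T -> \bar R}) (Q1 Q2 : T -> Prop) :
  {ae mu, forall w, Q1 w} -> {ae mu, forall w, Q2 w} ->
  {ae mu, forall w, Q1 w /\ Q2 w}.
Proof. by move=> h1 h2; apply: filterS2 h1 h2 => w. Qed.

Section noise_expansion.
Variables (R : realType) (d : measure_display) (Omega : measurableType d).
Variables (P : probability Omega R) (V : hilbertType R) (W : V -> Omega -> R).
Hypothesis isoW : iso_gaussian P W.

Definition log_likelihood (n : nat) (x : V -> R) (h : V) : R :=
  n%:R * x h - n%:R / 2 * `|h| ^+ 2.

Lemma iso_linear2 a b x y :
  {ae P, forall w, W (a *: x + b *: y) w = a * W x w + b * W y w}.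
Proof.
have h1 := iso_linear isoW a x (b *: y).
have h2 := iso_linear isoW b y 0.
have h3 := iso_linear isoW (-1) (0 : V) 0.
apply: filterS3 h1 h2 h3 => w; rewrite addr0 => -> ->.
by rewrite scaler0 addr0 => h; congr (_ + _); move: h; lra.
Qed.

Lemma iso_scale a x : {ae P, forall w, W (a *: x) w = a * W x w}.
Proof.
have := iso_linear2 a 0 x 0.
by apply: filterS => w; rewrite scaler0 addr0 mul0r addr0.
Qed.

(** Completing the square around the true signal [k0]. *)
Lemma log_likelihood_ratio (n : nat) (k0 k k' : V) : (0 < n)%N ->
  {ae P, forall w,
   log_likelihood n (observation W n k0 w) k -
   log_likelihood n (observation W n k0 w) k' =
   Num.sqrt n%:R * W (k - k') w
   - n%:R * inner (k - k0) (k - k') + n%:R / 2 * `|k - k'| ^+ 2}.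
Proof.
move=> n0; have := iso_linear2 1 (-1) k k'.
apply: filterS => w; rewrite scale1r scaleN1r => ->.
rewrite /log_likelihood /observation normB_sqr innerBl !innerBr -(inner_norm k) (innerC k0 k) (innerC k0 k').
have r0 : Num.sqrt n%:R != 0 :> R by rewrite gt_eqF// sqrtr_gt0 ltr0n.
have rn : n%:R = Num.sqrt n%:R ^+ 2 :> R by rewrite sqr_sqrtr.
by move: r0 rn; set r := Num.sqrt n%:R => r0 ->; field.
Qed.

(** The score [W g] is the linear part of the noise; on [E] the noise in the
    direction of the four remainders of the slope is at most [3 * eta]. *)
Lemma noise_expansion (E : set Omega) (n : nat) (k0 k k' : V)
    (g kd e1 e2 e3 e4 b r2 : V) (u t A B ep eta : R) :
  let r := Num.sqrt n%:R in
  let a := r * u in let s := r * t in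
  (0 < n)%N ->
  k - k' = u *: (g + (e1 + e2 - e3 - e4)) ->
  k - k0 = b + t *: (kd + e2) + r2 ->
  `|a| <= A -> `|g| <= B -> `|kd| <= B -> ep <= 1 -> 0 <= eta ->
  inner kd g = `|g| ^+ 2 ->
  `|e1| <= ep -> `|e2| <= ep -> `|e3| <= ep -> `|e4| <= ep ->
  r * (`|b| * (`|e1| + `|e3|)) <= ep * (1 + `|s|) ->
  r * `|inner b (g + e2 - e4)| <= ep -> `|r2| <= ep * `|t| ->
  {ae P, forall w, E w -> `|W (e1 + e2) w| <= eta} ->
  {ae P, forall w, E w -> `|W e3 w| <= eta} ->
  {ae P, forall w, E w -> `|W e4 w| <= eta} ->
  {ae P, forall w, E w ->
   log_likelihood n (observation W n k0 w) k -
   log_likelihood n (observation W n k0 w) k' <=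
   a * W g w - a * s * `|g| ^+ 2 + a ^+ 2 * `|g| ^+ 2 / 2 +
   (ep * (A * (10 + 6 * B) + A ^+ 2 * (4 * B + 8)) + 3 * A * eta) * (1 + `|s|)}.
Proof.
move=> r a s n0 psiE hE aA gB kB ep1 eta0 kg he1 he2 he3 he4 hb hbias hr2 w12 w3 w4.
have r0 : 0 <= r by exact: sqrtr_ge0.
have quad := quadratic_expansion r0 aA gB kB ep1 kg he1 he2 he3 he4 hb hbias hr2.
have l0 := log_likelihood_ratio k0 k k' n0.
have l1 := iso_linear2 u u g (e1 + e2 - e3 - e4).
have l2 := iso_linear2 1 (-1) (e1 + e2) (e3 + e4).
have l3 := iso_linear2 1 1 e3 e4.
have := ae_and l0 (ae_and (ae_and l1 (ae_and l2 l3)) (ae_and w12 (ae_and w3 w4))).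
apply: filterS.
move=> w [q0 [[q1 [q2 q3]] [p12 [p3 p4]]]] Ew.
have {}p12 := p12 Ew; have {}p3 := p3 Ew; have {}p4 := p4 Ew.
rewrite q0 psiE hE scalerDr q1 -scalerDr.
have {}q2 : W (e1 + e2 - e3 - e4) w = W (e1 + e2) w - W (e3 + e4) w.
  by move: q2; rewrite scale1r scaleN1r opprD addrA mul1r mulN1r.
have {}q3 : W (e3 + e4) w = W e3 w + W e4 w by move: q3; rewrite !scale1r !mul1r.
have n2 : n%:R = r ^+ 2 by rewrite /r sqr_sqrtr.
rewrite -/r n2 -addrA; apply: le_trans (lerD (lexx _) quad) _.
rewrite q2 q3 (_ : r * (u * W g w + u * (W (e1 + e2) w - (W e3 w + W e4 w))) = a * W g w + a * (W (e1 + e2) w - (W e3 w + W e4 w))); last first.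
  by rewrite /a; ring.
have h : a * (W (e1 + e2) w - (W e3 w + W e4 w)) <= 3 * A * eta * (1 + `|s|).
  apply: (@le_trans _ _ (3 * A * eta)); last first.
    by rewrite ler_peMr ?lerDl// !mulr_ge0//; exact: le_trans aA.
  have -> : 3 * A * eta = A * (3 * eta) by ring.
  apply: le_trans (ler_norm _) _; rewrite normrM; apply: ler_pM => //.
  apply: le_trans (ler_normB _ _) _; apply: le_trans (lerD p12 (ler_normD _ _)) _.
  by apply: (@le_trans _ _ (eta + (eta + eta))); [rewrite lerD2l; exact: lerD|lra].
rewrite -/a -/s; move: h; move: (a * (W _ w - _)) (1 + `|s|) => X Y h.
by move: (a * s * _) (a ^+ 2 * _ / 2) (a * W g w) (ep * _) => x1 x2 x3 x4; lra.
Qed.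

End noise_expansion.

Lemma cvge0_near_lt (R : realType) (u : nat -> \bar R) (c : R) :
  u n @[n --> \oo] --> 0%E -> 0 < c -> \forall n \near \oo, (u n < c%:E)%E.
Proof.
move=> cu c0; have h : (0 < c%:E)%E by rewrite lte_fin.
by have := cu _ (open_ereal_lt' h).
Qed.

Section noise_control.
Variables (R : realType) (d : measure_display) (Omega : measurableType d).
Variables (P : probability Omega R) (V : hilbertType R) (W : V -> Omega -> R).
Hypothesis isoW : iso_gaussian P W.

Lemma setC_prob_le3 (E1 E2 E3 : set Omega) (p : R) :
  measurable E1 -> measurable E2 -> measurable E3 ->
  (P (~` E1) <= (p / 3)%:E)%E -> (P (~` E2) <= (p / 3)%:E)%E ->
  (P (~` E3) <= (p / 3)%:E)%E -> (P (~` (E1 `&` E2 `&` E3)) <= p%:E)%E.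
Proof.
move=> m1 m2 m3 h1 h2 h3; rewrite !setCI.
apply: le_trans (measureU2 _ _ _) _; [by apply: measurableU; exact: measurableC|exact: measurableC|].
apply: le_trans (leeD (measureU2 _ _ _) (lexx _)) _; [exact: measurableC|exact: measurableC|].
apply: le_trans (leeD (leeD h1 h2) h3) _.
by rewrite -!EFinD lee_fin; lra.
Qed.

(** The three remainders of the slope are small elements of sets whose entropy
    is controlled uniformly in the sample size: a ball of the stronger norm, a
    Lipschitz curve, and a single vector. *)
Lemma noise_events (S : normed_subspace V) (th0 x0 L c1 eta p : R) :
  finite_entropy_integral S -> 0 < x0 -> 0 < L -> 0 < c1 -> 0 < eta -> 0 < p ->
  exists2 dl, 0 < dl & forall (g : R -> V) (e : V),
  (forall x y, `|x - th0| <= x0 -> `|y - th0| <= x0 -> `|g x - g y| <= L * `|x - y|) ->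
  `|e| ^+ 2 <= eta ^+ 2 * (p / 3) ->
  exists E, [/\ measurable E, (P (~` E) <= p%:E)%E,
    forall h, ns_le S h c1 -> `|h| <= dl -> {ae P, forall w, E w -> `|W h w| <= eta},
    forall x, `|x - th0| <= x0 -> `|x - th0| <= dl ->
      {ae P, forall w, E w -> `|W (g x - g th0) w| <= eta} &
    {ae P, forall w, E w -> `|W e w| <= eta}].
Proof.
move=> entS x00 L0 c10 eta0 p0.
pose eta1 := Num.min (p / 3) (Num.min (eta / c1) (eta / L)).
have eta10 : 0 < eta1 by rewrite !lt_min !divr_gt0.
have eta1p : eta1 <= p / 3 by rewrite ge_min lexx.
have eta1c : c1 * eta1 <= eta.
  by rewrite mulrC -ler_pdivlMr// !ge_min lexx orbT.
have eta1L : L * eta1 <= eta.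
  by rewrite mulrC -ler_pdivlMr// !ge_min lexx !orbT.
have [m [m_gt0 cov] cvgm] := entropy_covering entS.
have [dl1 dl10 /(_ _ cov)[E1 [mE1 PE1 hE1]]] := chaining_small isoW m_gt0 cvgm eta10.
pose c := Num.truncn (2 * x0).
have hc : 2 * x0 < c.+1%:R.
  by have /andP[] := Num.Theory.truncn_itv (mulr_ge0 (ler0n R 2) (ltW x00)).
have m2_gt0 k : (0 < c.+1 * 2 ^ k)%N by rewrite muln_gt0 expn_gt0.
have [dl2 dl20 hcurve] := chaining_small isoW m2_gt0 (@cvg_link_bound_pow R c) eta10.
exists (Num.min (c1 * dl1) dl2); first by rewrite lt_min mulr_gt0.
move=> g e lip he.
have lip' x y : `|x - th0| <= x0 -> `|y - th0| <= x0 ->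
    `|L^-1 *: (g x - g th0) - L^-1 *: (g y - g th0)| <= `|x - y|.
  move=> hx hy; rewrite -scalerBr opprB addrA subrK normrZ normfV (gtr0_norm L0).
  by rewrite ler_pdivrMl//; exact: lip.
have [E2 [mE2 PE2 hE2]] := hcurve _ (covered_lipschitz_curve x00 hc lip').
pose E3 := ~` [set w | eta <= `|W e w|].
have mE3 : measurable E3.
  apply: measurableC; apply: measurable_set_le => //.
  by apply: measurableT_comp => //; exact: (iso_measurable isoW).
exists (E1 `&` E2 `&` E3); split.
- by apply: measurableI => //; exact: measurableI.
- apply: setC_prob_le3 => //.
  + exact: le_trans PE1 _.
  + exact: le_trans PE2 _.
  + rewrite /E3 setCK; apply: le_trans (iso_chebyshev isoW _ eta0) _.
    by rewrite lee_fin ler_pdivrMr ?exprn_gt0// mulrC.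
- move=> h hS; rewrite le_min => /andP[h1 _].
  have hb : ns_le S (c1^-1 *: h) 1.
    apply: ns_leW (ns_leZ c1^-1 hS); rewrite gtr0_norm ?invr_gt0// mulVf//.
    by rewrite gt_eqF.
  have h2 : `|c1^-1 *: h| <= dl1.
    by rewrite normrZ normfV (gtr0_norm c10) ler_pdivrMl.
  apply: filterS2 (hE1 _ hb h2) (iso_scale isoW c1 (c1^-1 *: h)) => w q1 q2 [[/q1 {}q1 _] _].
  move: q2; rewrite scalerA mulfV ?gt_eqF// scale1r => ->.
  rewrite normrM (gtr0_norm c10); apply: le_trans eta1c.
  by rewrite ler_wpM2l// ltW.
- move=> x hx; rewrite le_min => /andP[_ h1].
  have h2 : `|L^-1 *: (g x - g th0)| <= dl2.
    rewrite normrZ normfV (gtr0_norm L0) ler_pdivrMl//.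
    apply: le_trans (lip _ _ hx _) _; first by rewrite subrr normr0 ltW.
    by rewrite ler_wpM2l// ltW.
  have h3 : [set L^-1 *: (g x - g th0) | x in [set x | `|x - th0| <= x0]] (L^-1 *: (g x - g th0)) by exists x.
  apply: filterS2 (hE2 _ h3 h2) (iso_scale isoW L (L^-1 *: (g x - g th0))) => w q1 q2 [[_ /q1 {}q1] _].
  move: q2; rewrite scalerA mulfV ?gt_eqF// scale1r => ->.
  rewrite normrM (gtr0_norm L0); apply: le_trans eta1L.
  by rewrite ler_wpM2l// ltW.
- by apply: nearW => w [_ /negP]; rewrite -ltNge => /ltW.
Qed.

End noise_control.

Section local_expansion.
Variables (R : realType) (H1 H2 : hilbertType R) (K : R -> {linear H1 -> H2}).
Variables (Theta : set R) (H : normed_subspace H1) (S : normed_subspace H2).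
Variables (th0 : R) (f0 : H1) (D1 D3 D4 x0 CS : R).
Hypotheses (x00 : 0 < x0) (CS0 : 0 < CS) (D10 : 0 <= D1) (D30 : 0 <= D3) (D40 : 0 <= D4).
Hypothesis strongS : forall x c, ns_le S x c -> `|x| <= CS * c.
Hypothesis ballTheta : forall th, `|th - th0| <= x0 -> Theta th.
Hypothesis Hf0 : ns_set H f0.

Local Notation Kd := (Kdot K Theta).

Hypothesis cond1 : forall th f, Theta th -> ns_set H f ->
  `|K th f| <= D1 * `|f| /\ `|Kd th f| <= D1 * `|f|.
Hypothesis cond3 : forall th th' f, Theta th -> Theta th' -> ns_set H f ->
  ns_le S (K th f - K th' f - (th - th') *: Kd th' f)
    (D3 * `|th - th'| ^+ 2 * ns_norm H f).
Hypothesis cond4 : forall th' f, Theta th' -> ns_set H f ->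
  ns_le S (Kd th' (f - f0)) (D4 * ns_norm H (f - f0)).

Let center : `|th0 - th0| <= x0. Proof. by rewrite subrr normr0 ltW. Qed.

Let expand th th' f : `|th - th0| <= x0 -> `|th' - th0| <= x0 -> ns_set H f ->
  `|K th f - K th' f - (th - th') *: Kd th' f| <=
  CS * D3 * `|th - th'| ^+ 2 * ns_norm H f.
Proof.
move=> /ballTheta hth /ballTheta hth' Hf.
by have := strongS (cond3 hth hth' Hf); rewrite !mulrA.
Qed.

Lemma Kdot_sub f : ns_set H f -> Kd th0 f = Kd th0 f0 + Kd th0 (f - f0).
Proof. by move=> Hf; rewrite (derivativeB x00 expand)// addrC subrK. Qed.

Lemma Kdot_lipschitz f h : ns_set H f -> ns_set H h ->
  `|Kd th0 (f - f0)| <= `|Kd th0 (h - f0)| + D1 * `|f - h|.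
Proof.
move=> Hf Hh; have Hfh := ns_setB Hf Hh.
have -> : f - f0 = (h - f0) + (f - h) by rewrite [RHS]addrC subrKA.
rewrite (derivativeD x00 expand (ns_setB Hh Hf0) Hfh).
apply: le_trans (ler_normD _ _) _; rewrite lerD2l.
by case: (cond1 (ballTheta center) Hfh).
Qed.

Lemma operator_lipschitz th th' f : `|th - th0| <= x0 -> `|th' - th0| <= x0 ->
  ns_set H f -> `|K th f - K th' f| <= D1 * `|th - th'| * `|f|.
Proof.
move=> hth hth' Hf; have := family_lipschitz expand Hf _ hth hth'; apply => // z /ballTheta hz.
by case: (cond1 hz Hf).
Qed.

(** Two expansions of the same increment, from either end, bound the change of
    the derivative. *)
Lemma Kdot_increment th f : `|th - th0| <= x0 -> ns_set H f ->
  ns_le S (Kd th f - Kd th0 f) (2 * D3 * `|th - th0| * ns_norm H f).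
Proof.
move=> hth Hf; have [->|tn0] := eqVneq th th0.
  rewrite !subrr normr0 mulr0 mul0r; split; first exact: ns_set0.
  by rewrite ns_norm0.
have n0 : 0 < `|th - th0| by rewrite normr_gt0 subr_eq0.
have h1 := cond3 (ballTheta hth) (ballTheta center) Hf.
have h2 := cond3 (ballTheta center) (ballTheta hth) Hf.
have h := ns_leZ (th - th0)^-1 (ns_leD h1 h2).
have -> : Kd th f - Kd th0 f = (th - th0)^-1 *: (K th f - K th0 f - (th - th0) *: Kd th0 f
   + (K th0 f - K th f - (th0 - th) *: Kd th f)).
  rewrite -[K th0 f - K th f]opprB -[th0 - th]opprB scaleNr opprK.
  rewrite addrACA subrr add0r addrC -scalerBr scalerA mulVf ?scale1r//.
  by rewrite subr_eq0.
apply: ns_leW h; rewrite (distrC th0) normfV.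
have -> : `|th - th0|^-1 * (D3 * `|th - th0| ^+ 2 * ns_norm H f + D3 * `|th - th0| ^+ 2 * ns_norm H f)
  = 2 * D3 * `|th - th0| * ns_norm H f by field; rewrite gt_eqF.
by [].
Qed.

(** The error of the first order expansion at [th0], per unit of the
    parameter. *)
Definition slope_error (th th' : R) (f : H1) : H2 :=
  (th - th')^-1 *: (K th f - K th' f - (th - th') *: Kd th0 f).

Lemma slope_error_le th th' f : `|th - th0| <= x0 -> `|th' - th0| <= x0 ->
  ns_set H f ->
  ns_le S (slope_error th th' f)
    (D3 * (`|th - th'| + 2 * `|th' - th0|) * ns_norm H f).
Proof.
move=> hth hth' Hf; rewrite /slope_error; have [->|tn0] := eqVneq th th'.
  rewrite subrr invr0 scale0r; split; first exact: ns_set0.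
  by rewrite ns_norm0 normr0 add0r !mulr_ge0// ns_norm_ge0.
have n0 : 0 < `|th - th'| by rewrite normr_gt0 subr_eq0.
have h1 := ns_leZ (th - th')^-1 (cond3 (ballTheta hth) (ballTheta hth') Hf).
have h := ns_leD h1 (Kdot_increment hth' Hf).
have -> : (th - th')^-1 *: (K th f - K th' f - (th - th') *: Kd th0 f) =
    (th - th')^-1 *: (K th f - K th' f - (th - th') *: Kd th' f) +
    (Kd th' f - Kd th0 f).
  rewrite !scalerBr !scalerA mulVf ?subr_eq0// !scale1r.
  by rewrite addrA subrK.
apply: ns_leW h; rewrite normfV.
have -> : `|th - th'|^-1 * (D3 * `|th - th'| ^+ 2 * ns_norm H f) + 2 * D3 * `|th' - th0| * ns_norm H f
  = D3 * (`|th - th'| + 2 * `|th' - th0|) * ns_norm H f by field; rewrite gt_eqF.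
by [].
Qed.

(** The increment of the signal along the perturbed least favourable path, as a
    multiple of the efficient slope and four errors. The shift of [f] cancels
    the component of [Kdot th0 f0] in the range of [K th0]. *)
Lemma signal_slope th th' f gam0 gn : ns_set H f ->
  K th f - K th' (f + (th - th') *: gn) =
  (th - th') *: (Kd th0 f0 - K th0 gam0 +
    (slope_error th th' f + Kd th0 (f - f0) - (K th' gn - K th0 gn)
     - K th0 (gn - gam0))).
Proof.
move=> Hf.
have eK : K th' (f + (th - th') *: gn) = K th' f + (th - th') *: K th' gn.
  by rewrite linearD linearZ.
have e4 : K th0 (gn - gam0) = K th0 gn - K th0 gam0 by rewrite linearB.
rewrite eK e4 opprD addrA.
have e1 : (th - th') *: slope_error th th' f = K th f - K th' f - (th - th') *: Kd th0 f.
  rewrite /slope_error; have [->|tn0] := eqVneq th th'.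
    by rewrite !subrr !scale0r subr0.
  by rewrite scalerA mulfV ?subr_eq0// scale1r.
have -> : Kd th0 f0 - K th0 gam0 + (slope_error th th' f + Kd th0 (f - f0)
    - (K th' gn - K th0 gn) - (K th0 gn - K th0 gam0)) =
    slope_error th th' f + Kd th0 f - K th' gn.
  rewrite (Kdot_sub Hf); move: (Kd th0 f0) (K th0 gam0) (slope_error _ _ _) (Kd th0 (f - f0)) (K th' gn) (K th0 gn).
  move=> a b c e x y; rewrite !opprB.
  by rewrite -(addrA (c + e)) [y - x + _]addrC subrKA addrCA subrKA addrA -(addrA c) (addrC e).
by rewrite [in RHS]scalerBr scalerDr e1 subrK.
Qed.

Lemma signal_shift th f : ns_set H f ->
  K th f - K th0 f0 = K th0 (f - f0) + (th - th0) *: (Kd th0 f0 + Kd th0 (f - f0))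
   + (K th f - K th0 f - (th - th0) *: Kd th0 f).
Proof.
move=> Hf; rewrite -(Kdot_sub Hf) linearB /= -addrA [_ *: _ + _]addrC subrK.
by rewrite addrC addrA subrK.
Qed.

Variables (d : measure_display) (Omega : measurableType d).
Variables (P : probability Omega R) (W : H2 -> Omega -> R).
Variables (H_ : nat -> set H1) (gam : H1 -> H1) (gam_ : nat -> H1) (rho : nat -> R).
Hypotheses (isoW : iso_gaussian P W) (entS : finite_entropy_integral S).
Hypothesis subH_ : forall n, H_ n `<=` ns_set H.
Hypothesis lfd : forall f, f = f0 \/ (exists n, H_ n f) ->
    least_favourable K Theta H th0 f (gam f).
Hypothesis H_gam_ : forall n, ns_set H (gam_ n).
Hypothesis rho_decr : {homo rho : m n / (m <= n)%N >-> n <= m}.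
Hypothesis rho_to0 : rho n @[n --> \oo] --> (0 : R).
Hypothesis gam_rho : forall n, `|gam_ n - gam f0| <= rho n.
Hypothesis no_bias :
    ((Num.sqrt n%:R)%:E * ereal_sup
      [set `|inner (K th0 (f - f0)) (K th0 (gam f - gam_ n))|%:E | f in H_ n])%E
    @[n --> \oo] --> 0%E.

Lemma sqrt_near_ge (c : R) : \forall n \near \oo, c <= Num.sqrt n%:R.
Proof.
exists (Num.truncn (`|c| ^+ 2)).+1 => // n /= hn.
apply: le_trans (ler_norm c) _; rewrite -[leLHS]ger0_norm// -sqrtr_sqr ler_wsqrtr//.
have /andP[_ /ltW h] := Num.Theory.truncn_itv (sqr_ge0 `|c|).
by apply: le_trans h _; rewrite ler_nat.
Qed.

Lemma bias_near (ep : R) : 0 < ep -> \forall n \near \oo, forall f, H_ n f ->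
  Num.sqrt n%:R * `|inner (K th0 (f - f0)) (K th0 (gam f - gam_ n))| <= ep.
Proof.
move=> ep0.
have h : \forall n \near \oo, ((Num.sqrt n%:R)%:E * ereal_sup
      [set `|inner (K th0 (f - f0)) (K th0 (gam f - gam_ n))|%:E | f in H_ n] < ep%:E)%E.
  exact: cvge0_near_lt.
near=> n => f Hnf; rewrite -lee_fin EFinM.
have /ltW : ((Num.sqrt n%:R)%:E * ereal_sup
      [set `|inner (K th0 (f - f0)) (K th0 (gam f - gam_ n))|%:E | f in H_ n] < ep%:E)%E.
  by near: n.
apply: le_trans; apply: lee_wpmul2l; first by rewrite lee_fin sqrtr_ge0.
by apply: ereal_sup_ubound; exists f.
Unshelve. all: by end_near. Qed.

(** The slope in the direction [gam] is orthogonal to the range of [K th0]. *)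
Lemma projected_slope f gn : (exists n, H_ n f) ->
  inner (K th0 (f - f0))
    (Kd th0 f0 - K th0 (gam f0) + Kd th0 (f - f0) - K th0 (gn - gam f0)) =
  inner (K th0 (f - f0)) (K th0 (gam f - gn)).
Proof.
move=> Hnf; have Hf : ns_set H f by case: Hnf => n; exact: subH_.
have [Hg /(_ _ (ns_setB Hf Hf0)) h] := lfd (or_intror Hnf).
have -> : Kd th0 f0 - K th0 (gam f0) + Kd th0 (f - f0) - K th0 (gn - gam f0) =
    (Kd th0 f - K th0 (gam f)) + K th0 (gam f - gn).
  have lB x y : K th0 (x - y) = K th0 x - K th0 y by rewrite linearB.
  by rewrite !lB (Kdot_sub Hf) opprB subrKA [LHS]addrAC subrKA [LHS]addrAC.
by rewrite innerDr innerC h add0r.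
Qed.

Lemma slope_inner : inner (Kd th0 f0) (Kd th0 f0 - K th0 (gam f0)) =
  `|Kd th0 f0 - K th0 (gam f0)| ^+ 2.
Proof.
have [Hg /(_ _ Hg) h] := lfd (or_introl erefl).
rewrite -inner_norm; apply/eqP; rewrite -subr_eq0 -innerBl subKr.
by rewrite innerC h.
Qed.

(** Every error term is at most a multiple of the radius [dl] or vanishes as [n]
    grows, so that a small fixed radius is enough. On the right there is, apart
    from the last term, the logarithm of the ratio of the limiting normal density
    at [th] and [th']. *)
Lemma local_comparison (A M kap p : R) : 1 <= A -> 0 <= M -> 0 < kap -> 0 < p ->
  let g := Kd th0 f0 - K th0 (gam f0) in
  exists2 dl0, 0 < dl0 /\ 3 * dl0 <= x0 & forall dl, 0 < dl -> dl <= dl0 ->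
  \forall n \near \oo, A <= dl * Num.sqrt n%:R /\
  exists E, [/\ measurable E, (P (~` E) <= p%:E)%E &
  forall th th' f, let r := Num.sqrt n%:R in
    `|th - th0| < dl -> `|r * (th - th')| <= A ->
    H_ n f -> ns_norm H f < M -> `|K th0 (f - f0)| < dl -> `|Kd th0 (f - f0)| < dl ->
    {ae P, forall w, E w ->
      log_likelihood n (observation W n (K th0 f0) w) (K th f) -
      log_likelihood n (observation W n (K th0 f0) w) (K th' (f + (th - th') *: gam_ n)) <=
      r * (th - th') * W g w - r * (th - th') * (r * (th - th0)) * `|g| ^+ 2 +
      (r * (th - th')) ^+ 2 * `|g| ^+ 2 / 2 + kap * (1 + `|r * (th - th0)|)}].
Proof.
move=> A1 M0 kap0 p0 g.
have A0 : 0 < A by exact: lt_le_trans A1.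
pose kd := Kd th0 f0; pose B := `|g| + `|kd|.
have B0 : 0 <= B by rewrite addr_ge0.
pose Cc := A * (10 + 6 * B) + A ^+ 2 * (4 * B + 8).
have Cc0 : 0 < Cc.
  by apply: addr_gt0; apply: mulr_gt0; rewrite ?exprn_gt0//; move: B0; lra.
pose ep := Num.min 1 (kap / 2 / Cc).
have ep0 : 0 < ep by rewrite lt_min ltr01 !divr_gt0.
have ep1 : ep <= 1 by rewrite ge_min lexx.
have epC : ep * Cc <= kap / 2 by rewrite -ler_pdivlMr// ge_min lexx orbT.
pose eta := kap / (6 * A).
have eta0 : 0 < eta by rewrite divr_gt0// mulr_gt0.
have etaA : 3 * A * eta = kap / 2 by rewrite /eta; field; rewrite gt_eqF.
clearbody ep eta; clear Cc0.
have rho0 n : 0 <= rho n by apply: le_trans (gam_rho n).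
pose L := D1 * (`|gam f0| + rho 0%N) + 1.
have L0 : 0 < L by rewrite ltr_wpDl// mulr_ge0// addr_ge0.
have nf0 : 0 <= ns_norm H f0 by exact: ns_norm_ge0.
pose c1 := D3 * 5 * M + D4 * (M + ns_norm H f0) + 1.
have c10 : 0 < c1 by rewrite ltr_wpDl// addr_ge0// !mulr_ge0// addr_ge0.
pose C1 := CS * D3 * M.
have C10 : 0 <= C1 by rewrite !mulr_ge0// ltW.
have [dl1 dl10 noise] := noise_events isoW th0 entS x00 L0 c10 eta0 p0.
(* Every error must be at most [ep]; the arguments of the noise must also be
   shorter than [dl1]. *)
pose mu := Num.min ep (Num.min (dl1 / 2) (Num.min x0 1)).
have mu0 : 0 < mu by rewrite !lt_min ep0 divr_gt0// x00 ltr01.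
have [mu1 mu2 mu3 mu4] : [/\ mu <= ep, mu <= dl1 / 2, mu <= x0 & mu <= 1].
  by split; rewrite !ge_min lexx ?orbT.
(* [Q] bounds the coefficients of [dl] in the error terms. *)
pose Q := 3 + 5 * C1 + 2 * L + (3 * C1 + L) * A.
have CLA : 0 <= (3 * C1 + L) * A.
  by rewrite mulr_ge0 ?(ltW A0)// addr_ge0 ?(ltW L0)// mulr_ge0.
have Q0 : 0 < Q by rewrite /Q; move: C10 L0 CLA; lra.
exists (mu / Q).
  split; first by rewrite divr_gt0.
  rewrite mulrA ler_pdivrMr//.
  have h : mu * 3 <= mu * Q by rewrite ler_wpM2l ?(ltW mu0)// /Q; move: C10 L0 CLA; lra.
  by have := ler_wpM2r (ltW Q0) mu3; move: h; lra.
move=> dl dl0; rewrite ler_pdivlMr// => dlQ.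
have dlx x : x <= Q -> dl * x <= mu.
  by move=> xQ; apply: le_trans dlQ; rewrite ler_wpM2l// ltW.
have d3 : dl * 3 <= mu by apply: dlx; rewrite /Q; move: C10 L0 CLA; lra.
have d2 : 2 * dl <= mu by move: d3 dl0; lra.
have dlmu : dl <= mu by move: d3 dl0; lra.
have mu_dl1 : mu <= dl1 by move: mu2 dl10; lra.
have dC1 : dl * (5 * C1) <= mu by apply: dlx; rewrite /Q; move: C10 L0 CLA; lra.
have dC1' : dl * C1 <= mu by apply: dlx; rewrite /Q; move: C10 L0 CLA; lra.
have dL : dl * (2 * L) <= mu by apply: dlx; rewrite /Q; move: C10 L0 CLA; lra.
have dCLA : dl * ((3 * C1 + L) * A) <= mu by apply: dlx; rewrite /Q; move: C10 L0 CLA; lra.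
have small_rho c : 0 < c -> \forall n \near \oo, D1 * rho n <= c.
  move=> c0; have : (D1 * rho n) @[n --> \oo] --> D1 * 0 by exact: cvgMr.
  by rewrite mulr0 => /cvgr_le; apply.
have p3 : 0 < Num.sqrt (p / 3) by rewrite sqrtr_gt0 divr_gt0.
have rho_near := small_rho _ (mulr_gt0 eta0 p3).
have bias_n := bias_near ep0.
near=> n.
have hA : A <= dl * Num.sqrt n%:R.
  by rewrite mulrC -ler_pdivrMr//; near: n; exact: sqrt_near_ge.
have r0 : 0 < Num.sqrt n%:R :> R by rewrite -(pmulr_rgt0 _ dl0) (lt_le_trans A0).
have n0 : (0 < n)%N by move: r0; rewrite sqrtr_gt0 ltr0n.
split=> //.
have Ke4 : `|K th0 (gam_ n - gam f0)| <= D1 * rho n.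
  have [Hg _] := lfd (or_introl erefl).
  have [h _] := cond1 (ballTheta center) (ns_setB (H_gam_ n) Hg).
  by apply: le_trans h _; rewrite ler_wpM2l.
have rho_ep : D1 * rho n <= ep by near: n; exact: small_rho.
have rho_eta : D1 * rho n <= eta * Num.sqrt (p / 3).
  by near: n; exact: rho_near.
have e4sq : `|K th0 (gam_ n - gam f0)| ^+ 2 <= eta ^+ 2 * (p / 3).
  rewrite -[p / 3]sqr_sqrtr ?divr_ge0 ?(ltW p0)// -exprMn.
  by rewrite lerXn2r ?nnegrE ?mulr_ge0 ?(ltW eta0) ?(ltW p3)//; exact: le_trans rho_eta.
have gam_n : D1 * `|gam_ n| <= L.
  apply: le_trans (_ : D1 * (`|gam f0| + rho 0%N) <= _); last by rewrite lerDl.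
  rewrite ler_wpM2l// -[gam_ n](subrK (gam f0)) addrC.
  by apply: le_trans (ler_normD _ _) _; rewrite lerD2l (le_trans (gam_rho n))// rho_decr.
have curve x y : `|x - th0| <= x0 -> `|y - th0| <= x0 ->
    `|K x (gam_ n) - K y (gam_ n)| <= L * `|x - y|.
  move=> hx hy; apply: le_trans (operator_lipschitz hx hy (H_gam_ n)) _.
  by rewrite mulrAC ler_wpM2r.
have hbias_n : forall f, H_ n f ->
  Num.sqrt n%:R * `|inner (K th0 (f - f0)) (K th0 (gam f - gam_ n))| <= ep by near: n.
have [E [mE PE noise1 noise2 noise3]] := noise (fun x => K x (gam_ n)) _ curve e4sq.
exists E; split => // th th' f; set r := Num.sqrt n%:R => htt hu Hnf nfM hb hd.
have {}r0 : 0 < r := r0; have {}hA : A <= dl * r := hA.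
have Hf : ns_set H f by exact: subH_ Hnf.
have nf : 0 <= ns_norm H f by exact: ns_norm_ge0.
set u := th - th' in hu *; set t := th - th0 in htt *.
have hru : r * `|u| <= A by rewrite -(gtr0_norm r0) -normrM.
have hu' : `|u| <= dl.
  by rewrite -(ler_pM2l r0) (le_trans hru)// mulrC.
pose t' := th' - th0.
have tt : `|t'| <= `|t| + `|u|.
  have -> : t' = t - u by rewrite /t' /t /u; ring.
  exact: ler_normB.
have hts : `|t| <= x0 by exact: le_trans (ltW htt) (le_trans dlmu mu3).
have ht's : `|t'| <= 2 * dl.
  by rewrite mulr_natl mulr2n; apply: le_trans tt (lerD (ltW htt) hu').
have ht'x : `|t'| <= x0 by exact: le_trans ht's (le_trans d2 mu3).
have hsum : `|u| + 2 * `|t'| <= 5 * dl.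
  rewrite (_ : 5 * dl = dl + 2 * (2 * dl)); last by ring.
  by apply: lerD => //; rewrite ler_wpM2l.
have rt' : r * `|t'| <= A + `|r * t|.
  rewrite normrM (gtr0_norm r0) addrC.
  apply: le_trans (_ : r * (`|t| + `|u|) <= _); first by rewrite ler_wpM2l// ltW.
  by rewrite mulrDr lerD2l.
have sl := slope_error_le hts ht'x Hf.
set e1 := slope_error th th' f in sl.
pose e2 := Kd th0 (f - f0); pose e3 := K th' (gam_ n) - K th0 (gam_ n).
pose e4 := K th0 (gam_ n - gam f0).
have e1b : `|e1| <= C1 * (`|u| + 2 * `|t'|).
  apply: le_trans (strongS sl) _; rewrite /C1 -!mulrA ler_pM2l// ler_wpM2l//.
  by rewrite mulrC ler_wpM2r ?addr_ge0 ?mulr_ge0// ltW.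
have e1s : `|e1| <= mu.
  apply: le_trans e1b _; apply: le_trans dC1.
  rewrite (_ : dl * (5 * C1) = C1 * (5 * dl)); last by ring.
  by rewrite ler_wpM2l.
have e3b : `|e3| <= L * `|t'| by exact: curve.
have e3s : `|e3| <= mu.
  apply: le_trans e3b _; apply: le_trans dL.
  rewrite (_ : dl * (2 * L) = L * (2 * dl)); last by ring.
  by rewrite ler_wpM2l// ltW.
have w12 : {ae P, forall w, E w -> `|W (e1 + e2) w| <= eta}.
  apply: noise1.
    apply: ns_leW (ns_leD sl (cond4 (ballTheta center) Hf)).
    rewrite /c1 -[leRHS]addrA; apply: lerD.
      rewrite -!mulrA ler_wpM2l//; apply: ler_pM => //; last exact: ltW.
      by apply: le_trans hsum _; rewrite -[leRHS]mulr1 ler_wpM2l// (le_trans dlmu).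
    apply: le_trans (_ : D4 * (M + ns_norm H f0) <= _); last by rewrite lerDl.
    rewrite ler_wpM2l//; apply: le_trans (ns_normB Hf Hf0) _.
    by rewrite lerD2r ltW.
  apply: le_trans (ler_normD _ _) _; rewrite [leRHS]splitr; apply: lerD.
    exact: le_trans mu2.
  exact: le_trans (ltW hd) (le_trans dlmu mu2).
have w3 : {ae P, forall w, E w -> `|W e3 w| <= eta}.
  by apply: noise2 => //; exact: le_trans ht's (le_trans d2 mu_dl1).
have w4 : {ae P, forall w, E w -> `|W e4 w| <= eta} by [].
have := @noise_expansion _ _ _ _ _ _ isoW E n (K th0 f0) (K th f)
  (K th' (f + (th - th') *: gam_ n)) g kd e1 e2 e3 e4 (K th0 (f - f0))
  (K th f - K th0 f - (th - th0) *: Kd th0 f) u t A B ep eta.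
move=> /(_ n0 (signal_slope _ _ _ _ Hf) (signal_shift _ Hf) hu).
have gB : `|g| <= B by rewrite lerDl.
have kB : `|kd| <= B by rewrite lerDr.
move=> /(_ gB kB ep1 (ltW eta0) slope_inner).
have he1 : `|e1| <= ep by exact: le_trans mu1.
have he2 : `|e2| <= ep by exact: le_trans (ltW hd) (le_trans dlmu mu1).
have he3 : `|e3| <= ep by exact: le_trans mu1.
have he4 : `|e4| <= ep by exact: le_trans rho_ep.
move=> /(_ he1 he2 he3 he4).
have s0 := normr_ge0 (r * t).
have hcross : r * (`|K th0 (f - f0)| * (`|e1| + `|e3|)) <= ep * (1 + `|r * t|).
  apply: (@le_trans _ _ (dl * (C1 * (A + 2 * (A + `|r * t|)) + L * (A + `|r * t|)))).
    rewrite mulrCA; apply: ler_pM => //; [by rewrite mulr_ge0 ?addr_ge0// ltW|exact: ltW|].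
    rewrite mulrDr; apply: lerD.
      apply: (@le_trans _ _ (C1 * (r * `|u| + 2 * (r * `|t'|)))).
        apply: (@le_trans _ _ (r * (C1 * (`|u| + 2 * `|t'|)))); first by rewrite ler_wpM2l// ltW.
        by rewrite le_eqVlt; apply/orP; left; apply/eqP; ring.
      by rewrite ler_wpM2l//; apply: lerD => //; rewrite ler_wpM2l.
    apply: (@le_trans _ _ (r * (L * `|t'|))); first by rewrite ler_wpM2l// ltW.
    by rewrite mulrCA ler_wpM2l// ltW.
  apply: (@le_trans _ _ (dl * ((3 * C1 + L) * A) * (1 + `|r * t|))); last first.
    by rewrite ler_wpM2r ?(le_trans dCLA)// addr_ge0.
  rewrite -[leRHS]mulrA ler_wpM2l ?(ltW dl0)//.
  by apply: cross_term_le => //; exact: ltW.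
have hbias : r * `|inner (K th0 (f - f0)) (g + e2 - e4)| <= ep.
  rewrite projected_slope; last by exists n.
  exact: hbias_n.
have hr2 : `|K th f - K th0 f - (th - th0) *: Kd th0 f| <= ep * `|t|.
  apply: le_trans (strongS (cond3 (ballTheta hts) (ballTheta center) Hf)) _.
  apply: (@le_trans _ _ (C1 * (`|t| * `|t|))).
    rewrite (_ : CS * _ = CS * D3 * (`|t| * `|t|) * ns_norm H f); last by ring.
    rewrite (_ : C1 * _ = CS * D3 * (`|t| * `|t|) * M); last by rewrite /C1; ring.
    by apply: ler_wpM2l; [rewrite !mulr_ge0// ltW|exact: ltW].
  rewrite mulrA ler_wpM2r//; apply: le_trans mu1; apply: le_trans dC1'.
  by rewrite mulrC ler_wpM2r// ltW.
move=> /(_ hcross hbias hr2 w12 w3 w4).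
apply: filterS => w hw /hw h; apply: le_trans h _.
by rewrite lerD2l ler_wpM2r ?addr_ge0// etaA -/Cc [leRHS]splitr lerD2r.
Unshelve. all: by end_near. Qed.

End local_expansion.

(** * Null sets, local densities and sieves *)

Lemma null_sections (R : realType) d1 d2 (T1 : measurableType d1)
    (T2 : measurableType d2) (m1 : probability T1 R) (m2 : probability T2 R)
    (B : set (T1 * T2)) : measurable B -> (m1 \x m2)%E B = 0%E ->
  {ae m1, forall x, m2 (xsection B x) = 0%E}.
Proof.
move=> mB; rewrite /product_measure1 /= => h0.
have mf : measurable_fun setT (fun x => m2 (xsection B x)) by exact: measurable_fun_xsection.
have : (\int[m1]_x `|m2 (xsection B x)| = 0)%E.
  by rewrite -h0; apply: eq_integral => x _; rewrite gee0_abs.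
move=> /(ae_eq_integral_abs m1 measurableT mf).
by apply: filterS => x; exact.
Qed.

Lemma ae_swap (R : realType) d1 d2 (T1 : measurableType d1)
    (T2 : measurableType d2) (m1 : probability T1 R) (m2 : probability T2 R)
    (B : set (T1 * T2)) : measurable B -> (forall x, m2 (xsection B x) = 0%E) ->
  {ae m2, forall y, m1 (ysection B y) = 0%E}.
Proof.
move=> mB h.
have h0 : (\int[m2]_y m1 (ysection B y) = 0)%E.
  have -> : (\int[m2]_y m1 (ysection B y) = (m1 \x m2)%E B)%E.
    apply/esym; apply: (@product_measure_unique _ _ _ _ _ m1 m2 (m1 \x^ m2)%E) => // A1 A2 mA1 mA2.
    exact: product_measure2E.
  by rewrite /product_measure1 /= integral0_eq.
have mf : measurable_fun setT (fun y => m1 (ysection B y)) by exact: measurable_fun_ysection.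
have : (\int[m2]_y `|m1 (ysection B y)| = 0)%E.
  by rewrite -h0; apply: eq_integral => x _; rewrite gee0_abs.
move=> /(ae_eq_integral_abs m2 measurableT mf).
by apply: filterS => x; exact.
Qed.

(** A density that is continuous and positive at a point is close to a constant
    multiple of Lebesgue measure there. *)
Lemma density_local (R : realType) (Theta : set R) (th0 x0 : R)
    (pi : probability (measurableTypeR R) R) :
  measurable (Theta : set (measurableTypeR R)) -> Theta th0 ->
  (forall th, `|th - th0| <= x0 -> Theta th) -> 0 < x0 ->
  positive_density Theta th0 pi -> exists2 q0 : R, 0 < q0 &
  forall kap : R, 0 < kap -> exists2 rho, 0 < rho <= x0 &
  forall (B : set (measurableTypeR R)) (f : measurableTypeR R -> R), measurable B ->
    B `<=` [set x | `|x - th0| <= rho] -> measurable_fun setT f ->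
    (forall x, 0 <= f x) ->
    (\int[pi]_(x in B) (f x)%:E <=
     ((1 + kap) * q0)%:E * \int[lebesgue_measure]_(x in B) (f x)%:E)%E /\
    (((1 - kap) * q0)%:E * \int[lebesgue_measure]_(x in B) (f x)%:E <=
     \int[pi]_(x in B) (f x)%:E)%E.
Proof.
move=> mT Tth0 ballT x00 [q [mq q_gt0 cq hq]]; exists (q th0); first exact: q_gt0.
move=> kap kap0.
have e0 : 0 < kap * q th0 by rewrite mulr_gt0// q_gt0.
move/cvgrPdist_le : cq => /(_ _ e0) /nbhs_ballP[r /= r0 hr].
exists (Num.min (r / 2) x0).
  by rewrite lt_min divr_gt0//= x00 ge_min lexx orbT.
pose p := (q : measurableTypeR R -> R) \_ Theta.
have p0 x : 0 <= p x.
  by rewrite /p patchE; case: ifPn => // /[!inE] /q_gt0 /ltW.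
have mp : measurable_fun setT (p : measurableTypeR R -> R).
  by apply/(measurable_restrictT _ mT).
have hp (A : set (measurableTypeR R)) : measurable A ->
    pi A = (\int[lebesgue_measure]_(x in A) (p x)%:E)%E.
  move=> mA; rewrite hq// integral_mkcondr; apply: eq_integral => x _.
  by rewrite /p !patchE; case: ifPn.
move=> B f mB sB mf f0.
have mfB : measurable_fun B (EFin \o f) by apply: measurable_funTS; apply/measurable_EFinP.
rewrite (@ge0_integral_density _ _ (measurableTypeR R) pi lebesgue_measure p B (EFin \o f) p0 mp hp mB mfB); last by move=> x _; rewrite lee_fin.
have pb x : B x -> (1 - kap) * q th0 <= p x <= (1 + kap) * q th0.
  move=> /sB /=; rewrite le_min => /andP[h1 /ballT Tx].
  have /= := hr x; rewrite /ball/= distrC => /(_ (le_lt_trans h1 _) Tx).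
  rewrite /p patchE mem_set//= ler_norml ltr_pdivrMr// ltr_pMr//.
  by rewrite ltr1n => /(_ isT) /andP[]; lra.
have mfp : measurable_fun B (fun x => ((f x)%:E * (p x)%:E)%E).
  by apply: emeasurable_funM => //; apply: measurable_funTS; apply/measurable_EFinP.
split.
  have [k0|k0] := leP 0 ((1 + kap) * q th0); last first.
    by move: k0; rewrite ltNge mulr_ge0// ?addr_ge0 ?(ltW kap0)//; exact/ltW/q_gt0.
  rewrite -ge0_integralZl//; last by move=> x _; rewrite lee_fin.
  apply: ge0_le_integral => //.
  - by move=> x _; rewrite mule_ge0// lee_fin.
  - by apply: emeasurable_funM.
  - by move=> x /pb /andP[_ h]; rewrite muleC lee_wpmul2r ?lee_fin.
have [k0|k0] := leP 0 ((1 - kap) * q th0).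
  rewrite -ge0_integralZl//; last by move=> x _; rewrite lee_fin.
  apply: ge0_le_integral => //.
  - by move=> x _; rewrite mule_ge0// lee_fin.
  - by apply: emeasurable_funM.
  - by move=> x /pb /andP[h _]; rewrite muleC lee_wpmul2l ?lee_fin.
apply: (@le_trans _ _ 0%E).
  rewrite mule_le0_ge0 ?lee_fin ?(ltW k0)//.
  by apply: integral_ge0 => x _; rewrite lee_fin.
by apply: integral_ge0 => x _; rewrite mule_ge0// lee_fin.
Qed.

(** In the scaled parameter the sieves increase to the whole line, so that the
    part of [[-A, A]] that they miss has vanishing measure. *)
Lemma sieve_full (R : realType) (th0 : R) (Theta_ : nat -> set R) (A kap : R) :
  (forall n, measurable (Theta_ n : set (measurableTypeR R))) ->
  (forall m n, (0 < m)%N -> (m <= n)%N ->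
    [set Num.sqrt m%:R * (th - th0) | th in Theta_ m] `<=`
    [set Num.sqrt n%:R * (th - th0) | th in Theta_ n]) ->
  \bigcup_(n in [set n | (0 < n)%N])
    [set Num.sqrt n%:R * (th - th0) | th in Theta_ n] = setT ->
  0 < kap -> \forall n \near \oo,
  (lebesgue_measure (([set v | (`|Num.sqrt n%:R * v| <= A)%R] `\`
     [set v | Theta_ n (th0 + v)%R]) : set (measurableTypeR R)) <= (kap / Num.sqrt n%:R)%:E)%E.
Proof.
move=> mT incr full kap0.
pose r n : R := Num.sqrt n.+1%:R.
have r0 n : 0 < r n by rewrite sqrtr_gt0.
pose F n : set (measurableTypeR R) := [set s | (`|s| <= A)%R /\ ~ Theta_ n.+1 (th0 + s / r n)].
have imE n s : [set r n * (th - th0) | th in Theta_ n.+1] s <-> Theta_ n.+1 (th0 + s / r n).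
  split=> [[th hth <-]|h]; first by rewrite mulrAC mulfV ?gt_eqF// mul1r addrC subrK.
  by exists (th0 + s / r n) => //; rewrite addrC addKr mulrC divfK// gt_eqF.
have mabs : measurable ([set s : measurableTypeR R | (`|s| <= A)%R]).
  rewrite [X in measurable X](_ : _ = `[- A, A]%classic)//.
  by apply/seteqP; split => x /=; rewrite in_itv/= ler_norml.
have mF n : measurable (F n).
  apply: measurableI => //; apply: measurableC.
  rewrite -[X in measurable X]setTI.
  have mf : measurable_fun setT ((fun s => th0 + s / r n) : measurableTypeR R -> measurableTypeR R).
    by apply: measurable_funD => //; apply: measurable_funM.
  exact: mf.
have cvF : lebesgue_measure (F n) @[n --> \oo] --> lebesgue_measure (\bigcap_n F n).
  apply: nonincreasing_cvg_mu => //.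
  - apply: (@le_lt_trans _ _ (lebesgue_measure (`[- A, A]%classic : set (measurableTypeR R)))).
      apply: le_measure; rewrite ?inE//.
      by move=> x [/= h _]; rewrite in_itv/= -ler_norml.
    by rewrite lebesgue_measure_itv/=; case: ifP; rewrite ltry.
  - exact: bigcapT_measurable.
  - move=> m n mn; apply/subsetPset => s [/= h nT]; split => // hT; apply: nT.
    by apply/imE; apply: (incr m.+1 n.+1) => //; apply/imE.
have F0 : \bigcap_n F n = set0.
  rewrite -subset0 => s hs.
  have : (\bigcup_(n in [set n | (0 < n)%N])
    [set Num.sqrt n%:R * (th - th0) | th in Theta_ n]) s by rewrite full.
  case=> -[|n] //= _ /(imE n s) hT.
  by case: (hs n I).
rewrite F0 measure0 in cvF.
have := cvge0_near_lt cvF kap0; case=> N _ hN; exists N.+1 => // -[//|n] /= Nn.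
have -> : [set v | (`|Num.sqrt n.+1%:R * v| <= A)%R] `\` [set v | Theta_ n.+1 (th0 + v)] =
    [set v | F n (r n * (v - 0))].
  apply/seteqP; split => v; rewrite /F /= subr0;
  by rewrite -/(r n) mulrAC mulfV ?mul1r// gt_eqF.
rewrite (lebesgue_measure_affine 0 (r0 n) (mF n)) mulrC EFinM.
by apply: lee_wpmul2l; [rewrite lee_fin invr_ge0 ltW|apply/ltW/hN].
Qed.

(** * From the likelihood expansion to the marginal posterior *)

(** Fubini's theorem for null sets: an inequality that holds almost surely for
    each parameter holds, almost surely, for almost every parameter. *)
Lemma ae_exchange (R : realType) d1 d2 d3 (X : measurableType d1)
    (Y : measurableType d2) (Omega : measurableType d3)
    (m1 : probability X R) (m2 : probability Y R) (P : probability Omega R)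
    (B : set ((X * Y) * Omega)) : measurable B ->
  (forall p, {ae P, forall w, ~ B (p, w)}) ->
  {ae P, forall w, {ae m1, forall x, {ae m2, forall y, ~ B ((x, y), w)}}}.
Proof.
move=> mB h.
have h0 p : P (xsection B p) = 0%E.
  have mx : measurable (xsection B p) by exact: measurable_xsection.
  have [N [mN PN sN]] := h p.
  apply/eqP; rewrite -measure_le0 -PN; apply: le_measure; rewrite ?inE//.
  by move=> w; rewrite /xsection /= inE => Bw; apply: sN => /= /(_ Bw).
have := @ae_swap _ _ _ _ _ (m1 \x m2)%E P B mB h0.
apply: filterS => w hw.
have mw : measurable (ysection B w) by exact: measurable_ysection.
have := null_sections mw hw.
apply: filterS => x hx.
exists (xsection (ysection B w) x); split => //; first exact: measurable_xsection.
by move=> y /contrapT By; rewrite /xsection/= inE /ysection/= inE.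
Qed.

Section bayes_shift.
Variables (R : realType) (H1 H2 : hilbertType R) (K : R -> {linear H1 -> H2}).
Variables (H : normed_subspace H1) (pi_f : probability (borel H1) R).
Hypothesis mH : measurable (ns_set H : set (borel H1)).
Variables (n : nat) (x : H2 -> R).

Lemma measurable_likelihood d (T : measurableType d) (D : set T) (k : T -> H2) :
  measurable_fun setT (x : borel H2 -> R) ->
  measurable_fun D (k : T -> borel H2) ->
  measurable_fun D (fun p => (likelihood n x (k p))%:E).
Proof.
move=> mx mk; apply/measurable_EFinP; apply: measurableT_comp => //.
apply: measurable_funB.
  by apply: measurable_funM => //; exact: (measurableT_comp mx mk).
apply: measurable_funM => //; apply: measurable_funX.
have h : measurable_fun setT ((fun y : H2 => `|y|) : borel H2 -> R).
  apply: continuous_borel_real; exact: norm_continuous.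
exact: (measurableT_comp h mk).
Qed.

(** Bayes's formula reweights the prior by the likelihood. A shift of the
    nuisance parameter along [g] changes the prior by the density [p]; it turns
    the likelihood at [th] into the likelihood at [th'], up to the factor that
    the local expansion provides. *)
Lemma bayes_shift (th th' c k1 : R) (g : H1) (L : set (borel H1)) (p : H1 -> R) :
  measurable_fun setT (x : borel H2 -> R) ->
  continuous (K th) -> continuous (K th') -> ns_set H g ->
  measurable L -> L `<=` ns_set H ->
  is_density (pushforward pi_f
      ((fun f => f + (th' - th) *: g) : borel H1 -> borel H1)) pi_f p ->
  (forall f, L f -> expR (- k1) <= p f) ->
  {ae pi_f, forall f, L f ->
     log_likelihood n x (K th f) -
     log_likelihood n x (K th' (f + (th - th') *: g)) <= c} ->
  (\int[pi_f]_(f in L) (likelihood n x (K th f))%:E <=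
   (expR (k1 + c))%:E * \int[pi_f]_(f in ns_set H) (likelihood n x (K th' f))%:E)%E.
Proof.
move=> mx cK cK' Hg mL LH [p0 mp hp] pk hc.
pose phi : borel H1 -> borel H1 := fun f => f + (th' - th) *: g.
pose psi : borel H1 -> borel H1 := fun f => f + (th - th') *: g.
have cshift (v : H1) : continuous (fun f : H1 => f + v).
  by move=> f; apply: (@cvgD R H1); [exact: cvg_id|exact: cvg_cst].
have mphi : measurable_fun setT phi by exact: (continuous_borel (cshift _)).
have mpsi : measurable_fun setT psi by exact: (continuous_borel (cshift _)).
have mKth : measurable_fun setT (K th : borel H1 -> borel H2) by exact: continuous_borel.
have mKth' : measurable_fun setT (K th' : borel H1 -> borel H2) by exact: continuous_borel.
have psiK f : psi (phi f) = f.
  by rewrite /psi /phi -[th - th']opprB scaleNr addrK.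
pose G (f : borel H1) := (likelihood n x (K th' f))%:E.
have mG : measurable_fun setT G by exact: measurable_likelihood.
have G0 f : (0 <= G f)%E by rewrite lee_fin expR_ge0.
have mLik : measurable_fun setT (fun f : borel H1 => (likelihood n x (K th f))%:E).
  exact: measurable_likelihood.
have mpE : measurable_fun setT (fun f : borel H1 => (p f)%:E) by apply/measurable_EFinP.
have mGpsi : measurable_fun setT (G \o psi) by exact: measurableT_comp.
apply: (@le_trans _ _ (\int[pi_f]_(f in L) ((expR (k1 + c))%:E * ((G \o psi) f * (p f)%:E)))%E).
  apply: ae_ge0_le_integral => //.
  - by move=> f _; rewrite lee_fin expR_ge0.
  - exact: measurable_funTS.
  - by move=> f _; rewrite !mule_ge0// lee_fin ?expR_ge0.
  - apply: measurable_funTS; apply: emeasurable_funM => //; exact: emeasurable_funM.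
  apply: filterS hc => f hf Lf; have {}hf := hf Lf.
  rewrite /G /= -!EFinM lee_fin.
  apply: (@le_trans _ _ (expR (k1 + c) * (likelihood n x (K th' (psi f)) * expR (- k1)))).
    rewrite /likelihood -!expRD ler_expR.
    by move: hf; rewrite /log_likelihood /psi; lra.
  by rewrite ler_wpM2l ?expR_ge0// ler_wpM2l ?expR_ge0// pk.
rewrite ge0_integralZl//; last 2 first.
- by apply: measurable_funTS; apply: emeasurable_funM.
- by move=> f _; apply: mule_ge0; [exact: G0|rewrite lee_fin].
apply: lee_wpmul2l; first by rewrite lee_fin expR_ge0.
have := @ge0_integral_density _ _ _ (pushforward pi_f phi) pi_f p L (G \o psi) p0 mp hp mL (measurable_funTS mGpsi) (fun f _ => G0 _).
move=> <-.
rewrite (ge0_integral_pushforward mphi)//; last 2 first.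
- exact: measurable_funTS.
- by move=> f _; exact: G0.
rewrite (eq_integral G); last by move=> f _ /=; rewrite psiK.
apply: ge0_subset_integral => //.
- by rewrite -[X in measurable X]setTI; exact: mphi.
- exact: measurable_funTS.
- move=> f /= /LH; rewrite /phi => h.
  have -> : f = (f + (th' - th) *: g) - (th' - th) *: g by rewrite addrK.
  by apply: ns_setB => //; exact: ns_setZ.
Qed.

End bayes_shift.

Section posterior_mass.
Variables (R : realType) (H1 H2 : hilbertType R) (K : R -> {linear H1 -> H2}).
Variables (Theta : set R) (H : normed_subspace H1).
Variables (pi_theta : probability (measurableTypeR R) R) (pi_f : probability (borel H1) R).
Hypothesis mTheta : measurable (Theta : set (measurableTypeR R)).
Hypothesis mH : measurable (ns_set H : set (borel H1)).
Hypothesis mK : measurable_fun (param_set Theta H)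
  ((fun p => K p.1 p.2) : measurableTypeR R * borel H1 -> borel H2).
Variables (n : nat) (x : H2 -> R).
Hypothesis mx : measurable_fun setT (x : borel H2 -> R).

Local Notation TP := (measurableTypeR R * borel H1)%type.
Local Notation post := (joint_posterior K Theta H pi_theta pi_f n x).
Local Notation mu := (pi_theta \x pi_f)%E.

(** The likelihood, extended by zero to all parameters. *)
Definition weight : TP -> \bar R :=
  (fun p => (likelihood n x (K p.1 p.2))%:E) \_ (param_set Theta H).

Let mparam : measurable (param_set Theta H : set TP). Proof. exact: measurableX. Qed.

Lemma weight_ge0 p : (0 <= weight p)%E.
Proof. by rewrite /weight patchE; case: ifP => // _; rewrite lee_fin expR_ge0. Qed.

Lemma measurable_weight : measurable_fun setT weight.
Proof.
by apply/(measurable_restrictT _ mparam); exact: measurable_likelihood.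
Qed.

Lemma joint_posteriorE B : post B = ((\int[mu]_(p in B) weight p) / (\int[mu]_p weight p))%E.
Proof.
by rewrite /joint_posterior /posterior integral_mkcondr -[X in (_ / \int[_]_(p in X) _)%E]setTI integral_mkcondr.
Qed.

Lemma integral_rectangle (F : set (measurableTypeR R)) (A : set (borel H1)) :
  measurable F -> measurable A ->
  (\int[mu]_(p in F `*` A) weight p =
   \int[pi_theta]_(th in F) \int[pi_f]_(f in A) weight (th, f))%E.
Proof.
move=> mF mA; have mFA : measurable (F `*` A) by exact: measurableX.
rewrite integral_mkcond fubini_tonelli1; last 2 first.
- by apply/(measurable_restrictT _ mFA); exact: measurable_funTS measurable_weight.
- by move=> p; rewrite patchE; case: ifP => // _; exact: weight_ge0.
rewrite [RHS]integral_mkcond; apply: eq_integral => th _.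
rewrite /fubini_F patchE; case: ifPn => [|/negP] hF.
  rewrite [RHS]integral_mkcond; apply: eq_integral => f _; rewrite !patchE.
  rewrite in_setX hF /=; by [].
apply: integral0_eq => f _; rewrite patchE in_setX.
by case: (th \in F) hF.
Qed.

Definition marginal_weight (A : set (borel H1)) (th : measurableTypeR R) : \bar R :=
  (\int[pi_f]_(f in A) weight (th, f))%E.

Lemma marginal_weight_ge0 A th : (0 <= marginal_weight A th)%E.
Proof. by apply: integral_ge0 => f _; exact: weight_ge0. Qed.

Lemma marginal_weight_le A th : measurable A -> (marginal_weight A th <= marginal_weight setT th)%E.
Proof.
move=> mA; apply: ge0_subset_integral => //; last by move=> f _; exact: weight_ge0.
exact: (measurableT_comp measurable_weight (measurable_pair1 th)).
Qed.

Lemma measurable_marginal_weight A : measurable A -> measurable_fun setT (marginal_weight A).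
Proof.
move=> mA.
have mTA : measurable ([set: measurableTypeR R] `*` A) by exact: measurableX.
have -> : marginal_weight A = fubini_F pi_f (weight \_ (setT `*` A)).
  apply/funext => th; rewrite /marginal_weight /fubini_F [LHS]integral_mkcond.
  by apply: eq_integral => f _; rewrite !patchE in_setX in_setT.
apply: measurable_fun_fubini_tonelli_F.
- by apply/(measurable_restrictT _ mTA); exact: measurable_funTS measurable_weight.
- by move=> p; rewrite patchE; case: ifP => // _; exact: weight_ge0.
Qed.

Lemma marginal_weightE A th : Theta th -> A `<=` ns_set H ->
  marginal_weight A th = (\int[pi_f]_(f in A) (likelihood n x (K th f))%:E)%E.
Proof.
move=> Tth AH; apply: eq_integral => f /[!inE] Af; rewrite /weight patchE.
by rewrite mem_set//; split => //=; exact: AH.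
Qed.

Lemma marginal_weightT th : Theta th ->
  marginal_weight setT th = (\int[pi_f]_(f in ns_set H) (likelihood n x (K th f))%:E)%E.
Proof.
move=> Tth; rewrite [RHS]integral_mkcond; apply: eq_integral => f _.
rewrite /weight !patchE; have [Hf|nHf] := pselect (ns_set H f).
  by rewrite !mem_set.
by rewrite !memNset//; case.
Qed.

(** A positive posterior mass excludes a degenerate normalizing constant. *)
Lemma posterior_total B : measurable B -> (0 < post B)%E ->
  exists2 Z : R, 0 < Z & (\int[mu]_p weight p = Z%:E)%E.
Proof.
move=> mB; rewrite joint_posteriorE.
have Z0 : (0 <= \int[mu]_p weight p)%E by apply: integral_ge0 => p _; exact: weight_ge0.
have BZ : (\int[mu]_(p in B) weight p <= \int[mu]_p weight p)%E.
  apply: ge0_subset_integral => //; first exact: measurable_weight.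
  by move=> p _; exact: weight_ge0.
case E : (\int[mu]_p weight p)%E Z0 BZ => [Z| |] //; last first.
  by rewrite invey mule0 ltxx.
rewrite lee_fin le_eqVlt => /predU1P[<-|Z0] BZ; last by exists Z.
have -> : (\int[mu]_(p in B) weight p = 0)%E.
  apply/eqP; rewrite eq_le BZ /=; apply: integral_ge0 => p _; exact: weight_ge0.
by rewrite mul0e ltxx.
Qed.

Section normalized.
Variable Z : R.
Hypotheses (Z0 : 0 < Z) (hZ : (\int[mu]_p weight p = Z%:E)%E).

Lemma posteriorE B : post B = ((Z^-1)%:E * \int[mu]_(p in B) weight p)%E.
Proof. by rewrite joint_posteriorE hZ inver gt_eqF// muleC. Qed.

Lemma posterior_ge0 B : (0 <= post B)%E.
Proof.
rewrite posteriorE mule_ge0// ?lee_fin ?invr_ge0 ?(ltW Z0)//.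
by apply: integral_ge0 => p _; exact: weight_ge0.
Qed.

Lemma posterior_le A B : measurable A -> measurable B -> A `<=` B -> (post A <= post B)%E.
Proof.
move=> mA mB AB; rewrite !posteriorE; apply: lee_wpmul2l.
  by rewrite lee_fin invr_ge0 ltW.
apply: ge0_subset_integral => //; last by move=> p _; exact: weight_ge0.
exact: measurable_funTS measurable_weight.
Qed.

Lemma posteriorT : post setT = 1%E.
Proof. by rewrite posteriorE hZ -EFinM mulVf ?gt_eqF. Qed.

Lemma posteriorC B : measurable B -> (post B + post (~` B) = 1)%E.
Proof.
move=> mB; rewrite -posteriorT !posteriorE -ge0_muleDr; last 2 first.
- by apply: integral_ge0 => p _; exact: weight_ge0.
- by apply: integral_ge0 => p _; exact: weight_ge0.
congr (_ * _)%E; rewrite -(setUv B) ge0_integral_setU//.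
- exact: measurableC.
- by rewrite setUv; exact: measurable_weight.
- by move=> p _; exact: weight_ge0.
- by apply/disj_setPS; rewrite setICr.
Qed.

Lemma posterior_fin B : measurable B -> post B \is a fin_num.
Proof.
move=> mB; rewrite ge0_fin_numE ?posterior_ge0//.
apply: (@le_lt_trans _ _ (post setT)); last by rewrite posteriorT ltry.
exact: posterior_le.
Qed.

Lemma posteriorU B C : measurable B -> measurable C -> (post (B `|` C) <= post B + post C)%E.
Proof.
move=> mB mC; rewrite !posteriorE -ge0_muleDr; last 2 first.
- by apply: integral_ge0 => p _; exact: weight_ge0.
- by apply: integral_ge0 => p _; exact: weight_ge0.
apply: lee_wpmul2l; first by rewrite lee_fin invr_ge0 ltW.
apply: ge0_integral_setU_le => //; first exact: measurable_weight.
exact: weight_ge0.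
Qed.

Lemma posteriorI B C (b c : R) : measurable B -> measurable C ->
  ((1 - b)%:E <= post B)%E -> ((1 - c)%:E <= post C)%E ->
  ((1 - (b + c))%:E <= post (B `&` C))%E.
Proof.
move=> mB mC hB hC.
have mBC : measurable (B `&` C) by exact: measurableI.
have := posteriorC mB; have := posteriorC mC; have := posteriorC mBC.
have mB' := measurableC mB; have mC' := measurableC mC.
have := posteriorU mB' mC'; rewrite -setCI.
have mBC' := measurableC mBC; move: hB hC.
rewrite -(fineK (posterior_fin mB)) -(fineK (posterior_fin mC)) -(fineK (posterior_fin mBC))
 -(fineK (posterior_fin mB')) -(fineK (posterior_fin mC')) -(fineK (posterior_fin mBC')).
rewrite -!EFinD !lee_fin => h1 h2 h3 [h4] [h5] [h6]; lra.
Qed.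

(** An upper bound on all sets is a two-sided bound, since complements are
    bounded as well. *)
Lemma posterior_tv (Q : probability (measurableTypeR R) R) (eps : R) :
  (forall F, measurable F ->
    (\int[pi_theta]_(th in F) marginal_weight setT th <= (Q F + eps%:E) * Z%:E)%E) ->
  (tv_norm (fun F : set (measurableTypeR R) => post (F `*` setT)) Q <= (2 * eps)%:E)%E.
Proof.
move=> h; rewrite /tv_norm EFinM; apply: lee_wpmul2l => //.
apply: ge_ereal_sup => _ [F mF <-].
have Qfin G : measurable G -> Q G \is a fin_num by move=> mG; exact: fin_num_measure.
have up G : measurable G -> fine (post (G `*` setT)) <= fine (Q G) + eps.
  move=> mG; have mGT : measurable (G `*` [set: borel H1]) by exact: measurableX.
  rewrite -lee_fin EFinD (fineK (posterior_fin mGT)) (fineK (Qfin _ mG)) posteriorE.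
  by rewrite lee_pdivrMl// muleC (le_trans _ (h _ mG))// integral_rectangle.
have mFC := measurableC mF.
have mFT : measurable (F `*` [set: borel H1]) by exact: measurableX.
have mFCT : measurable (~` F `*` [set: borel H1]) by exact: measurableX.
have e1 : (post (F `*` setT) + post (~` F `*` setT) = 1)%E.
  rewrite -(posteriorC mFT); congr (_ + post _)%E.
  by apply/seteqP; split => -[a b] /=; [move=> [h1 _] [h2 _]|move=> h1; split => // h2; apply: h1].
have e2 : (Q F + Q (~` F) = 1)%E.
  by rewrite (probability_setC Q mF) addeC subeK// Qfin.
have h1 := up _ mF; have h2 := up _ mFC.
move: e1 e2 h1 h2.
rewrite -(fineK (posterior_fin mFT)) -(fineK (posterior_fin mFCT)) -(fineK (Qfin _ mF)) -(fineK (Qfin _ mFC)).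
rewrite -!EFinD abse_EFin lee_fin ler_norml => -[e1] [e2] /= h1 h2.
by apply/andP; split; lra.
Qed.

End normalized.
End posterior_mass.

Section outer.
Variables (R : realType) (d : measure_display) (T : measurableType d) (P : probability T R).

Lemma mu_ext_setU (A B : set T) : (mu_ext P (A `|` B) <= mu_ext P A + mu_ext P B)%E.
Proof. exact: outer_measureU2. Qed.

Lemma cvge0P (u : nat -> \bar R) : (forall n, (0 <= u n)%E) ->
  (forall e : R, 0 < e -> \forall n \near \oo, (u n <= e%:E)%E) ->
  u n @[n --> \oo] --> 0%E.
Proof.
move=> u0 h U /= [e /= e0 hU].
have := h (e / 2) (divr_gt0 e0 (ltr0n R 2)); apply: filterS => n un.
have := u0 n; case E : (u n) un => [r| |]//; rewrite !lee_fin => r1 r0.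
change (U (u n)); rewrite E; apply: hU => /=; rewrite /ball/= sub0r normrN ger0_norm//.
by apply: le_lt_trans r1 _; rewrite ltr_pdivrMr// ltr_pMr// ltr1n.
Qed.

End outer.

(** The bound excludes [p = 0], where the logarithm is infinite. *)
Lemma prior_ratio_ge (R : realType) (p c e : R) : 0 <= p -> 0 < e ->
  (`|lne p%:E / e%:E| < c%:E)%E -> expR (- (c * e)) <= p.
Proof.
move=> p0 e0; rewrite inver gt_eqF//.
move: p0; rewrite le_eqVlt => /predU1P[<-|p0].
  by rewrite le0_lneNy// gt0_mulNye ?lte_fin ?invr_gt0.
rewrite lne_EFin// -EFinM abse_EFin lte_fin ltr_norml => /andP[h _].
rewrite -[leRHS]lnK ?posrE// ler_expR.
by move: h; rewrite ltr_pdivlMr// mulNr => /ltW.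
Qed.

Lemma measurable_signal (R : realType) (H1 H2 : hilbertType R)
    (K : R -> {linear H1 -> H2}) (Theta : set R) (H : normed_subspace H1)
    (S : normed_subspace H2) (D2 CS : R) :
  separable H2 -> measurable (Theta : set (measurableTypeR R)) ->
  measurable (ns_set H : set (borel H1)) ->
  (forall th, Theta th -> continuous (K th)) -> 0 < CS ->
  (forall x c, ns_le S x c -> `|x| <= CS * c) ->
  (forall th th' f, Theta th -> Theta th' -> ns_set H f ->
    ns_le S (K th f - K th' f) (D2 * `|th - th'| * ns_norm H f)) ->
  measurable_fun (param_set Theta H)
  ((fun p => K p.1 p.2) : measurableTypeR R * borel H1 -> borel H2).
Proof.
move=> sepH2 mT mH cK CS0 strongS cond2.
have := @measurable_caratheodory R H2 sepH2 _ (borel H1) Theta (ns_set H) (fun th f => K th f) mT mH.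
apply.
  by move=> th Tth; apply: measurable_funTS; apply: continuous_borel; exact: cK.
move=> th f eps Tth Hf eps0.
pose c := CS * (`|D2| * ns_norm H f) + 1.
have c0 : 0 < c by rewrite ltr_wpDl// !mulr_ge0 ?(ltW CS0)// ns_norm_ge0.
exists (eps / c); first by rewrite divr_gt0.
move=> th' Tth' h; apply: le_lt_trans (strongS _ _ (cond2 _ _ _ Tth' Tth Hf)) _.
move: h; rewrite ltr_pdivlMr//; apply: le_lt_trans.
rewrite (_ : CS * _ = `|th' - th| * (CS * (D2 * ns_norm H f))); last by ring.
rewrite ler_wpM2l// /c; apply: le_trans (_ : CS * (`|D2| * ns_norm H f) <= _); last by rewrite lerDl.
by rewrite ler_pM2l// ler_wpM2r ?ns_norm_ge0// ler_norm.
Qed.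

(** The likelihood is jointly measurable in the parameters and the sample point,
    so that the exceptional null set can be chosen before the parameters. *)
Lemma expansion_ae (R : realType) (H1 H2 : hilbertType R)
    (K : R -> {linear H1 -> H2}) (Theta : set R) (H : normed_subspace H1)
    (pi_theta : probability (measurableTypeR R) R) (pi_f : probability (borel H1) R)
    (d : measure_display) (Omega : measurableType d) (P : probability Omega R)
    (W : H2 -> Omega -> R) (k0 : H2) (gn : H1) (n : nat)
    (Zset : set (measurableTypeR R * measurableTypeR R)) (L : set (borel H1)) (E : set Omega)
    (c : (measurableTypeR R * measurableTypeR R) * Omega -> R) :
  separable H1 ->
  measurable (Theta : set (measurableTypeR R)) ->
  measurable (ns_set H : set (borel H1)) ->
  iso_gaussian P W ->
  measurable_fun (param_set Theta H)
    ((fun p => K p.1 p.2) : measurableTypeR R * borel H1 -> borel H2) ->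
  measurable Zset -> measurable L -> measurable E -> L `<=` ns_set H -> ns_set H gn ->
  (forall z, Zset z -> Theta z.1 /\ Theta z.2) -> measurable_fun setT c ->
  let gap z f w := log_likelihood n (observation W n k0 w) (K z.1 f) -
      log_likelihood n (observation W n k0 w) (K z.2 (f + (z.1 - z.2) *: gn)) in
  (forall z f, Zset z -> L f -> {ae P, forall w, E w -> gap z f w <= c (z, w)}) ->
  {ae P, forall w, E w -> {ae (pi_theta \x pi_theta)%E, forall z, Zset z ->
    {ae pi_f, forall f, L f -> gap z f w <= c (z, w)}}}.
Proof.
move=> sepH1 mT mH isoW mK mZ mL mE LH Hgn ZT mc gap hgap.
have [_ _ _ mW] := isoW.
pose TR := measurableTypeR R.
pose D : set ((TR * TR) * borel H1 * Omega) := (Zset `*` L) `*` E.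
have mD : measurable D by apply: measurableX => //; exact: measurableX.
pose ll (p : borel H2 * Omega) : R := log_likelihood n (observation W n k0 p.2) p.1.
have mll : measurable_fun setT ll.
  apply: measurable_funB; apply: measurable_funM => //.
    apply: measurable_funD; last exact: measurable_funM.
    have h : measurable_fun setT (inner k0 : borel H2 -> R).
      by apply: continuous_borel_real; exact: continuous_inner.
    exact: (measurableT_comp h measurable_fst).
  apply: measurable_funX.
  have h : measurable_fun setT ((fun y : H2 => `|y|) : borel H2 -> R).
    apply: continuous_borel_real; exact: norm_continuous.
  exact: (measurableT_comp h measurable_fst).
pose k : TR * borel H1 -> borel H2 :=
  (fun p => K p.1 p.2 : borel H2) \_ (param_set Theta H).
have mk : measurable_fun setT k.
  by apply/(measurable_restrictT _ (measurableX mT mH)).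
have kE th f : Theta th -> ns_set H f -> k (th, f) = K th f.
  by move=> Tth Hf; rewrite /k patchE mem_set.
have mshift : measurable_fun setT ((fun p : (TR * TR) * borel H1 * Omega =>
    p.1.2 + (p.1.1.1 - p.1.1.2) *: gn) : _ -> borel H1).
  apply: (measurableT_comp (measurable_line sepH1 gn)
    (g := fun p : (TR * TR) * borel H1 * Omega => (p.1.1.1 - p.1.1.2 : TR, p.1.2))).
  apply: measurable_fun_pair; last by repeat apply: measurableT_comp => //.
  by apply: measurable_funB; repeat apply: measurableT_comp => //.
have mk1 : measurable_fun setT (fun p : (TR * TR) * borel H1 * Omega => k (p.1.1.1, p.1.2)).
  have h : measurable_fun setT (fun p : (TR * TR) * borel H1 * Omega => (p.1.1.1 : TR, p.1.2 : borel H1)).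
    by apply: measurable_fun_pair => /=; repeat apply: measurableT_comp => //.
  exact: (measurableT_comp mk h).
have mk2 : measurable_fun setT (fun p : (TR * TR) * borel H1 * Omega =>
    k (p.1.1.2, p.1.2 + (p.1.1.1 - p.1.1.2) *: gn)).
  have h : measurable_fun setT (fun p : (TR * TR) * borel H1 * Omega => (p.1.1.2 : TR, p.1.2 + (p.1.1.1 - p.1.1.2) *: gn : borel H1)).
    by apply: measurable_fun_pair => //=; repeat apply: measurableT_comp => //.
  exact: (measurableT_comp mk h).
pose gapc (p : (TR * TR) * borel H1 * Omega) := ll (k (p.1.1.1, p.1.2), p.2)
  - ll (k (p.1.1.2, p.1.2 + (p.1.1.1 - p.1.1.2) *: gn), p.2) - c (p.1.1, p.2).
have mg : measurable_fun setT gapc.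
  have m2 : measurable_fun setT (snd : (TR * TR) * borel H1 * Omega -> Omega) by [].
  apply: measurable_funB.
    apply: measurable_funB.
      exact: (measurableT_comp mll (measurable_fun_pair mk1 m2)).
    exact: (measurableT_comp mll (measurable_fun_pair mk2 m2)).
  apply: (measurableT_comp mc (g := fun p => (p.1.1, p.2))).
  by apply: measurable_fun_pair => //; repeat apply: measurableT_comp => //.
pose B := D `&` gapc @^-1` `]0, +oo[.
have mB : measurable B.
  by apply: measurableI => //; rewrite -[X in measurable X]setTI; exact: mg.
have BE z f w : B ((z, f), w) <-> [/\ Zset z, L f, E w & c (z, w) < gap z f w].
  have gapE : Zset z -> L f -> gapc ((z, f), w) = gap z f w - c (z, w).
    move=> Zz Lf; have [T1 T2] := ZT _ Zz; have Hf := LH _ Lf.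
    by rewrite /gapc /= !kE//; apply: ns_setD => //; exact: ns_setZ.
  split=> [[[[/= Zz Lf] Ew]]|[Zz Lf Ew h]].
    by rewrite gapE// in_itv/= andbT subr_gt0 => h; split.
  by split => //=; rewrite gapE// in_itv/= andbT subr_gt0.
have nB p : {ae P, forall w, ~ B (p, w)}.
  case: p => z f; have [[Zz Lf]|nZL] := pselect (Zset z /\ L f).
    apply: filterS (hgap z f Zz Lf) => w hw /BE[_ _ Ew].
    by rewrite ltNge (hw Ew).
  by apply: nearW => w /BE[]; move=> h1 h2 _ _; apply: nZL.
have := @ae_exchange _ _ _ _ _ _ _ (pi_theta \x pi_theta)%E pi_f P B mB nB.
apply: filterS => w hw Ew; apply: filterS hw => z hz Zz.
apply: filterS hz => f hf Lf; rewrite leNgt; apply/negP => h.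
by apply: hf; apply/BE.
Qed.

Lemma mass_ge (R : realType) (c : R) (y : \bar R) :
  ~ (c%:E <= `|y - 1|)%E -> ((1 - c)%:E <= y)%E.
Proof.
move=> /negP; rewrite -ltNge; case: y => [y| |] //=.
by rewrite lte_fin lee_fin ltr_norml => /andP[+ _]; lra.
Qed.

Lemma measurable_observation (R : realType) (V : hilbertType R) d
    (Omega : measurableType d) (P : probability Omega R) (W : V -> Omega -> R)
    (n : nat) (h : V) (w : Omega) : iso_gaussian P W ->
  measurable_fun setT (observation W n h w : borel V -> R).
Proof.
move=> [_ _ _ mW]; apply: measurable_funD.
  by apply: continuous_borel_real; exact: continuous_inner.
apply: measurable_funM => //.
exact: (measurableT_comp mW (measurable_pair2 w)).
Qed.

Section mass_events.
Variables (R : realType) (H1 H2 : hilbertType R) (K : R -> {linear H1 -> H2}).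
Variables (Theta : set R) (H : normed_subspace H1).
Variables (pi_theta : probability (measurableTypeR R) R) (pi_f : probability (borel H1) R).
Variables (d : measure_display) (Omega : measurableType d) (P : probability Omega R).
Variables (W : H2 -> Omega -> R) (th0 : R) (f0 : H1).
Hypothesis isoW : iso_gaussian P W.
Hypothesis mTheta : measurable (Theta : set (measurableTypeR R)).
Hypothesis mH : measurable (ns_set H : set (borel H1)).
Hypothesis mK : measurable_fun (param_set Theta H)
  ((fun p => K p.1 p.2) : measurableTypeR R * borel H1 -> borel H2).

Local Notation post n w := (joint_posterior K Theta H pi_theta pi_f n (data K W th0 f0 n w)).

Lemma mass_near (B : nat -> set (measurableTypeR R * borel H1)) (c p : R) :
  cvg_in_prob P (fun n w => post n w (B n)) 1%E -> 0 < c -> 0 < p ->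
  \forall n \near \oo, (mu_ext P (~` [set w | ((1 - c)%:E <= post n w (B n))%E]) <= p%:E)%E.
Proof.
move=> hB c0 p0; have := cvge0_near_lt (hB c c0) p0.
apply: filterS => n /ltW; apply: le_trans; apply: le_mu_ext => w /= nw.
by apply: contrapT => /mass_ge.
Qed.

(** The radii of consistency tend to zero, hence a fixed radius is enough. *)
Lemma consistent_near (dist : R -> H1 -> R) (dl c p : R) :
  consistent K Theta H pi_theta pi_f P W th0 f0 dist ->
  (forall r, measurable ([set q | param_set Theta H q /\ dist q.1 q.2 < r] :
    set (measurableTypeR R * borel H1))) ->
  0 < dl -> 0 < c -> c < 1 -> 0 < p ->
  \forall n \near \oo, (mu_ext P (~` [set w | ((1 - c)%:E <=
    post n w [set q | param_set Theta H q /\ (dist q.1 q.2 < dl)%R])%E]) <= p%:E)%E.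
Proof.
move=> [delta [_ cdelta hcons]] mdist dl0 c0 c1 p0.
have hdl : \forall n \near \oo, delta n < dl by exact: (cvgr_lt _ cdelta).
have hm := mass_near hcons c0 p0.
apply: filterS2 hdl hm => n hn; apply: le_trans; apply: le_mu_ext => w /=.
apply: contra_not => h.
have mx := measurable_observation n (K th0 f0) w isoW.
have [Z Z0 hZ] : exists2 Z : R, 0 < Z &
   (\int[(pi_theta \x pi_f)%E]_p weight K Theta H n (data K W th0 f0 n w) p = Z%:E)%E.
  apply: (posterior_total mTheta mH mK mx (mdist (delta n))).
  by apply: lt_le_trans h; rewrite lte_fin subr_gt0.
apply: le_trans h _; apply: (posterior_le mTheta mH mK mx Z0 hZ) => //.
by move=> q [hq hd]; split => //; exact: lt_trans hn.
Qed.

End mass_events.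

(** * The Bernstein-von Mises theorem *)

(** The statement for a fixed sample. The constants [A] and [kap] come first
    because the localization radius, the exceptional events and the sample size
    are chosen after them. *)
Lemma posterior_close_normal (R : realType) (i0 v0 eps : R) :
  0 < i0 -> 0 < v0 -> 0 < eps -> exists A kap : R, [/\ 2 <= A, 0 < kap & kap < 1] /\
  forall (H1 H2 : hilbertType R) (K : R -> {linear H1 -> H2}) (Theta : set R)
    (H : normed_subspace H1) (pi_theta : probability (measurableTypeR R) R)
    (pi_f : probability (borel H1) R) (n : nat) (x : H2 -> R) (th0 x0 dl rho q0 V : R)
    (Theta_n : set R) (L : set (borel H1)) (gn : H1) (p : R -> H1 -> R),
  let r := Num.sqrt n%:R in
  measurable (Theta : set (measurableTypeR R)) ->
  measurable (ns_set H : set (borel H1)) ->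
  measurable_fun (param_set Theta H)
    ((fun p => K p.1 p.2) : measurableTypeR R * borel H1 -> borel H2) ->
  (forall th, Theta th -> continuous (K th)) ->
  measurable_fun setT (x : borel H2 -> R) ->
  (forall th, `|th - th0| <= x0 -> Theta th) ->
  measurable (Theta_n : set (measurableTypeR R)) ->
  measurable L -> L `<=` ns_set H -> ns_set H gn ->
  (0 < n)%N -> `|V| <= v0 -> 0 < q0 -> 0 < dl -> 3 * dl <= x0 -> dl <= rho / 2 ->
  A <= dl * r ->
  (forall (B : set (measurableTypeR R)) (f : measurableTypeR R -> R), measurable B ->
    B `<=` [set x | `|x - th0| <= rho] -> measurable_fun setT f ->
    (forall x, 0 <= f x) ->
    (\int[pi_theta]_(x in B) (f x)%:E <=
     ((1 + kap) * q0)%:E * \int[lebesgue_measure]_(x in B) (f x)%:E)%E /\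
    (((1 - kap) * q0)%:E * \int[lebesgue_measure]_(x in B) (f x)%:E <=
     \int[pi_theta]_(x in B) (f x)%:E)%E) ->
  (lebesgue_measure (([set v | (`|r * v| <= A)%R] `\`
     [set v | Theta_n (th0 + v)%R]) : set (measurableTypeR R)) <= (kap / r)%:E)%E ->
  (forall th, Theta_n th -> is_density (pushforward pi_f
      ((fun f => f + (th - th0) *: gn) : borel H1 -> borel H1)) pi_f (p th)) ->
  (forall th f, Theta_n th -> L f -> `|r * (th - th0)| <= A ->
     expR (- (kap / 2)) <= p th f) ->
  {ae (pi_theta \x pi_theta)%E, forall z : measurableTypeR R * measurableTypeR R,
    `|z.1 - th0| < dl /\ `|r * (z.1 - z.2)| <= A ->
    {ae pi_f, forall f, L f ->
      log_likelihood n x (K z.1 f) - log_likelihood n x (K z.2 (f + (z.1 - z.2) *: gn)) <=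
      r * (z.1 - z.2) * V - r * (z.1 - z.2) * (r * (z.1 - th0)) * i0 +
      (r * (z.1 - z.2)) ^+ 2 * i0 / 2 + kap / 2 * (1 + `|r * (z.1 - th0)|)}} ->
  ((1 - kap)%:E <= joint_posterior K Theta H pi_theta pi_f n x
     ((Theta_n `&` [set th | (`|th - th0| < dl)%R]) `*` L))%E ->
  (tv_norm (fun F : set (measurableTypeR R) =>
      joint_posterior K Theta H pi_theta pi_f n x (F `*` setT))
    (normal_prob (th0 + r^-1 * (i0^-1 * V)) (Num.sqrt (n%:R^-1 * i0^-1))) <= (2 * eps)%:E)%E.
Proof.
move=> i00 v00 eps0; have [A [kap [[A2 kap0 kap1] napp]]] := normal_approximation i00 v00 eps0.
exists A, kap; split => // H1 H2 K Theta H pi_theta pi_f n x th0 x0 dl rho q0 V Theta_n L gn p r.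
move=> mTheta mH mK cK mx ballT mTn mL LH Hgn n0 Vv0 q00 dl0 dlx0 dlrho Adl dens leb densp prior expansion mass.
pose TR := measurableTypeR R.
pose T : set TR := Theta_n `&` [set th | `|th - th0| < dl].
pose D : set TR := [set v | Theta_n (th0 + v)].
have r0 : 0 < r by rewrite sqrtr_gt0 ltr0n.
have nr : n%:R^-1 = r ^- 2 by rewrite /r sqr_sqrtr.
rewrite nr.
have mT : measurable T.
  apply: measurableI => //; apply: measurable_set_lt => //.
  by apply: measurableT_comp => //; exact: measurable_funB.
have mD : measurable D.
  rewrite /D -[X in measurable X]setTI.
  have mf : measurable_fun setT ((fun v => th0 + v) : TR -> TR) by exact: measurable_funD.
  exact: mf.
have mTL : measurable (T `*` L) by exact: measurableX.
have [Z Z0 hZ] : exists2 Z : R, 0 < Z &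
   (\int[(pi_theta \x pi_f)%E]_p weight K Theta H n x p = Z%:E)%E.
  apply: (posterior_total mTheta mH mK mx mTL).
  by apply: lt_le_trans mass; rewrite lte_fin subr_gt0.
apply: (posterior_tv mTheta mH mK mx Z0 hZ) => F mF.
apply: (napp pi_theta th0 r V rho q0 Z D T F (marginal_weight K Theta H pi_f n x L)
  (marginal_weight K Theta H pi_f n x setT)) => //.
- by apply: le_trans dlrho; rewrite ler_pdivrMr.
- exact: measurable_marginal_weight.
- exact: measurable_marginal_weight.
- by move=> th; exact: marginal_weight_ge0.
- by move=> th; exact: marginal_weight_le.
- by move=> th [_ /= h]; apply: le_trans dlrho; exact: ltW.
- apply: filterS expansion => -[th th'] /= hexp [_ /= hth] hD hu.
  have {}hexp := hexp (conj hth hu).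
  have hu' : `|th - th'| <= dl.
    by rewrite -(ler_pM2l r0) -{1}(gtr0_norm r0) -normrM (le_trans hu)// mulrC.
  have Tth : Theta th by apply: ballT; apply: le_trans dlx0; move: hth dl0; lra.
  have Tth' : Theta th'.
    apply: ballT; apply: le_trans dlx0.
    have -> : th' - th0 = (th - th0) - (th - th') by ring.
    apply: le_trans (ler_normB _ _) _; move: hth hu' dl0; lra.
  have hv : th0 + (th' - th) - th0 = th' - th by ring.
  have hdens := densp _ hD; rewrite hv in hdens.
  have hprior f : L f -> expR (- (kap / 2)) <= p (th0 + (th' - th)) f.
    move=> Lf; apply: prior => //.
    by rewrite hv -opprB mulrN normrN.
  have := bayes_shift mH mx (cK _ Tth) (cK _ Tth') Hgn mL LH hdens hprior hexp.
  rewrite -(marginal_weightE K pi_f n x Tth LH) -(marginal_weightT K H pi_f n x Tth') => hb.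
  set c := _ + kap / 2 * _ in hb.
  set m := th0 + _; set sd := Num.sqrt _.
  have phi0 z : 0 <= normal_pdf m sd z by exact: normal_pdf_ge0.
  apply: le_trans (lee_wpmul2r _ hb) _; first by rewrite lee_fin.
  rewrite muleAC muleC; apply: lee_wpmul2l; first exact: marginal_weight_ge0.
  rewrite -EFinM lee_fin (local_normal_ratio th0 V r0 i00 th th').
  rewrite mulrCA mulrC -mulrA ler_wpM2l// mulrC -expRD ler_expR /c.
  have s0 : 0 <= kap / 2 * `|r * (th - th0)| by rewrite mulr_ge0 ?divr_ge0// ltW.
  move: s0; lra.
- by rewrite -(integral_rectangle pi_theta pi_f mTheta mH mK n mx measurableT measurableT) setXTT.
- rewrite -(integral_rectangle pi_theta pi_f mTheta mH mK n mx mT mL).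
  move: mass; rewrite (posteriorE Z0 hZ) EFinM.
  by rewrite lee_pdivlMl// muleC.
Qed.

Lemma not_union7 (T : Type) (A B C D E F G : set T) (w : T) :
  ~ (~` A `|` (~` B `|` (~` C `|` (~` D `|` (~` E `|` (F `|` G)))))) w ->
  A w /\ B w /\ C w /\ D w /\ E w /\ ~ F w /\ ~ G w.
Proof.
move=> n; do ?split; first [move=> h|apply: contrapT => h]; apply: n => /=; tauto.
Qed.

Theorem theorem2p2 (R : realType)
  (H1 H2 : hilbertType R) (sepH1 : separable H1) (sepH2 : separable H2)
  (Theta : set R) (cTheta : compact Theta)
  (K : R -> {linear H1 -> H2})
  (cK : forall th, Theta th -> continuous (K th))
  (H : normed_subspace H1)
  (dK : forall th f, Theta th -> ns_set H f -> Kdot_exists K Theta th f)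
  (S : normed_subspace H2) (strongS : stronger_norm S)
  (KHS : forall th f, Theta th -> ns_set H f -> ns_set S (K th f))
  (entS : finite_entropy_integral S)
  (pi_theta : probability (measurableTypeR R) R)
  (pi_f : probability (borel H1) R)
  (mH : measurable (ns_set H : set (borel H1)))
  (mHnorm : forall M : R,
    measurable ([set f | ns_set H f /\ ns_norm H f < M] : set (borel H1)))
  (suppf : pi_f (ns_set H) = 1%E)
  (d : measure_display) (Omega : measurableType d) (P : probability Omega R)
  (W : H2 -> Omega -> R) (isoW : iso_gaussian P W)
  (th0 : R) (f0 : H1) (Theta_th0 : Theta th0) (H_f0 : ns_set H f0)
  (dens_theta : positive_density Theta th0 pi_theta)
  (D1 D2 D3 D4 : R)
  (cond1 : forall th f, Theta th -> ns_set H f ->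
    `|K th f| <= D1 * `|f| /\ `|Kdot K Theta th f| <= D1 * `|f|)
  (cond2 : forall th th' f, Theta th -> Theta th' -> ns_set H f ->
    ns_le S (K th f - K th' f) (D2 * `|th - th'| * ns_norm H f))
  (cond3 : forall th th' f, Theta th -> Theta th' -> ns_set H f ->
    ns_le S (K th f - K th' f - (th - th') *: Kdot K Theta th' f)
      (D3 * `|th - th'| ^+ 2 * ns_norm H f))
  (cond4 : forall th' f, Theta th' -> ns_set H f ->
    ns_le S (Kdot K Theta th' (f - f0)) (D4 * ns_norm H (f - f0)))
  (bounded : exists M0 : R, forall M, M0 <= M ->
    cvg_in_prob P (fun n w =>
      joint_posterior K Theta H pi_theta pi_f n (data K W th0 f0 n w)
        (setT `*` [set f | ns_set H f /\ ns_norm H f < M])) 1%E)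
  (consistent1 : consistent K Theta H pi_theta pi_f P W th0 f0
    (fun th f => `|th - th0| + `|K th0 (f - f0)|))
  (consistent2 : consistent K Theta H pi_theta pi_f P W th0 f0
    (fun _ f => `|Kdot K Theta th0 (f - f0)|))
  (Theta_ : nat -> set R) (H_ : nat -> set H1)
  (mTheta_ : forall n, measurable (Theta_ n : set (measurableTypeR R)))
  (mH_ : forall n, measurable (H_ n : set (borel H1)))
  (subTheta_ : forall n, Theta_ n `<=` Theta)
  (subH_ : forall n, H_ n `<=` ns_set H)
  (gam : H1 -> H1)
  (lfd : forall f, f = f0 \/ (exists n, H_ n f) ->
    least_favourable K Theta H th0 f (gam f))
  (info_gt0 : 0 < eff_info K Theta th0 f0 (gam f0))
  (gam_ : nat -> H1) (H_gam_ : forall n, ns_set H (gam_ n))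
  (rho : nat -> R)
  (rho_decr : {homo rho : m n / (m <= n)%N >-> n <= m})
  (rho_to0 : rho n @[n --> \oo] --> (0 : R))
  (gam_rho : forall n, `|gam_ n - gam f0| <= rho n)
  (scaled_incr : forall m n, (0 < m)%N -> (m <= n)%N ->
    [set Num.sqrt m%:R * (th - th0) | th in Theta_ m] `<=`
    [set Num.sqrt n%:R * (th - th0) | th in Theta_ n])
  (scaled_full : \bigcup_(n in [set n | (0 < n)%N])
    [set Num.sqrt n%:R * (th - th0) | th in Theta_ n] = setT)
  (mass_sieve : cvg_in_prob P (fun n w =>
    joint_posterior K Theta H pi_theta pi_f n (data K W th0 f0 n w)
      (Theta_ n `*` H_ n)) 1%E)
  (mass_shifted : cvg_in_prob P (fun n w =>
    ereal_inf [set known_theta_posterior K H th0 pi_f n (data K W th0 f0 n w)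
      [set f + (th - th0) *: gam_ n | f in H_ n] | th in Theta_ n]) 1%E)
  (no_bias :
    ((Num.sqrt n%:R)%:E * ereal_sup
      [set `|inner (K th0 (f - f0)) (K th0 (gam f - gam_ n))|%:E | f in H_ n])%E
    @[n --> \oo] --> 0%E)
  (* p n th is a version of the density of the law of f + (th - th0) gam_n
     with respect to the law of f *)
  (p : nat -> R -> H1 -> R)
  (dens_p : forall n th, Theta_ n th ->
    is_density (pushforward pi_f
      ((fun f => f + (th - th0) *: gam_ n) : borel H1 -> borel H1))
      pi_f (p n th))
  (prior_shift :
    ereal_sup [set `|lne (p n q.1 q.2)%:E /
                     (1 + n%:R * (q.1 - th0) ^+ 2)%:E|%E
              | q in Theta_ n `*` H_ n]
    @[n --> \oo] --> 0%E) :
  bernstein_von_mises K Theta H pi_theta pi_f P W th0 f0 (gam f0).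
Proof.
have clTheta : closed Theta by exact: compact_closed.
have mTheta : measurable (Theta : set (measurableTypeR R)) by exact: closed_measurable.
have [x0 x00 ballT] := scaled_cover_nbhs clTheta subTheta_ scaled_incr scaled_full.
have [CS CS0 strongS'] := stronger_norm_pos strongS.
have D0 (D : R) : 0 <= `|D| by [].
have cond1' th f : Theta th -> ns_set H f ->
    `|K th f| <= `|D1| * `|f| /\ `|Kdot K Theta th f| <= `|D1| * `|f|.
  move=> hth Hf; have [h1 h2] := cond1 th f hth Hf.
  by split; [apply: le_trans h1 _|apply: le_trans h2 _]; rewrite ler_wpM2r// ler_norm.
have cond3' th th' f : Theta th -> Theta th' -> ns_set H f ->
    ns_le S (K th f - K th' f - (th - th') *: Kdot K Theta th' f)
      (`|D3| * `|th - th'| ^+ 2 * ns_norm H f).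
  move=> hth hth' Hf; apply: ns_leW (cond3 _ _ _ hth hth' Hf).
  by rewrite ler_wpM2r ?ns_norm_ge0// ler_wpM2r ?ler_norm// exprn_ge0.
have cond4' th f : Theta th -> ns_set H f ->
    ns_le S (Kdot K Theta th (f - f0)) (`|D4| * ns_norm H (f - f0)).
  move=> hth Hf; apply: ns_leW (cond4 _ _ hth Hf).
  by rewrite ler_wpM2r ?ler_norm//; apply: ns_norm_ge0; exact: ns_setB.
have mK := measurable_signal sepH2 mTheta mH cK CS0 strongS' cond2.
pose g := Kdot K Theta th0 f0 - K th0 (gam f0); pose i0 := `|g| ^+ 2.
have i00 : 0 < i0 by exact: info_gt0.
have mKd r : measurable (ns_set H `&` [set f | `|Kdot K Theta th0 (f - f0)| < r] : set (borel H1)).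
  apply: (@measurable_lipschitz_lt _ _ _ (fun f => `|Kdot K Theta th0 (f - f0)|) `|D1|) => //.
  move=> f h Hf Hh.
  exact: (Kdot_lipschitz x00 strongS' ballT H_f0 cond1' cond3').
have mKf0 : measurable_fun setT ((fun f => `|K th0 (f - f0)|) : borel H1 -> R).
  under eq_fun do rewrite linearB.
  by apply: measurable_norm_dist => //; apply: continuous_borel; exact: cK.
have mK0 r : measurable ([set f | `|K th0 (f - f0)| < r] : set (borel H1)).
  exact: measurable_set_lt.
have mdist1 r : measurable ([set q | param_set Theta H q /\
    `|q.1 - th0| + `|K th0 (q.2 - f0)| < r] : set (measurableTypeR R * borel H1)).
  apply: measurableI; first exact: measurableX.
  apply: measurable_set_lt => //; apply: measurable_funD.
    apply: measurableT_comp => //; exact: measurable_funB.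
  exact: (measurableT_comp mKf0 measurable_snd).
have mdist2 r : measurable ([set q | param_set Theta H q /\
    `|Kdot K Theta th0 (q.2 - f0)| < r] : set (measurableTypeR R * borel H1)).
  rewrite (_ : [set _ | _] = Theta `*` (ns_set H `&` [set f | `|Kdot K Theta th0 (f - f0)| < r])).
    by apply: measurableX => //; exact: mKd.
  by apply/seteqP; split => -[th f] /=; [move=> [[h1 h2] h3]|move=> [h1 [h2 h3]]].
move=> e e0; apply: cvge0P => [n|eta eta0]; first exact: mu_ext_ge0.
(* Four masses, the noise, the score and a null set make up the exceptional
   event; each but the last has probability at most [pr]. *)
pose pr := eta / 8; have pr0 : 0 < pr by rewrite divr_gt0.
pose v0 := Num.sqrt (i0 / pr).
have v00 : 0 < v0 by rewrite sqrtr_gt0 divr_gt0.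
have e40 : 0 < e / 4 by rewrite divr_gt0.
have [A [kap [[A2 kap0 kap1] close]]] := posterior_close_normal i00 v00 e40.
have A1 : 1 <= A by apply: le_trans A2; rewrite ler1n.
have [M0 hM0] := bounded.
pose M := Num.max M0 0.
have M_ge0 : 0 <= M by rewrite le_max lexx orbT.
have massM : cvg_in_prob P (fun n w =>
    joint_posterior K Theta H pi_theta pi_f n (data K W th0 f0 n w)
      (setT `*` [set f | ns_set H f /\ ns_norm H f < M])) 1%E.
  by apply: hM0; rewrite le_max lexx.
have [q0 q00 dens] := density_local mTheta Theta_th0 ballT x00 dens_theta.
have [rad /andP[rad0 radx] densrad] := dens kap kap0.
have kap2 : 0 < kap / 2 by rewrite divr_gt0.
have [dl0 [dl00 dl0x] loc] := local_comparison x00 CS0 (D0 D1) (D0 D3) (D0 D4) strongS'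
  ballT H_f0 cond1' cond3' cond4' isoW entS subH_ lfd H_gam_ rho_decr rho_to0
  gam_rho no_bias A1 M_ge0 kap2 pr0.
pose dl := Num.min dl0 (rad / 2).
have dl_gt0 : 0 < dl by rewrite lt_min dl00 divr_gt0.
have dldl0 : dl <= dl0 by rewrite ge_min lexx.
have dlrho : dl <= rad / 2 by rewrite ge_min lexx orbT.
have dlx0 : 3 * dl <= x0 by apply: le_trans dl0x; rewrite ler_pM2l.
(* Only shifts [v] with [n v^2 <= A^2] occur, so that the normalization of the
   prior ratio is at most [1 + A^2]. *)
pose c := kap / 2 / (1 + A ^+ 2).
have A20 : 0 < 1 + A ^+ 2 by rewrite ltr_wpDr ?sqr_ge0.
have c0 : 0 < c by rewrite divr_gt0.
have k40 : 0 < kap / 4 by rewrite divr_gt0.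
have k41 : kap / 4 < 1 by rewrite ltr_pdivrMr// mul1r (lt_trans kap1)// ltr1n.
have near_loc := loc dl dl_gt0 dldl0.
have near_sieve := mass_near mass_sieve k40 pr0.
have near_M := mass_near massM k40 pr0.
have near_dist1 := consistent_near isoW mTheta mH mK consistent1 mdist1 dl_gt0 k40 k41 pr0.
have near_dist2 := consistent_near isoW mTheta mH mK consistent2 mdist2 dl_gt0 k40 k41 pr0.
have near_full := sieve_full A mTheta_ scaled_incr scaled_full kap0.
have near_prior := cvge0_near_lt prior_shift c0.
have near_gt0 : \forall n \near \oo, (0 < n)%N by exists 1%N.
have := filterI near_gt0 (filterI near_loc (filterI near_sieve (filterI near_M
  (filterI near_dist1 (filterI near_dist2 (filterI near_full near_prior)))))).
case=> N _ hN; exists N => // n /= /hN [n0 [[hA [E [mE PE hE]]] [hsieve [hM [hd1 [hd2 [hfull hprior]]]]]]].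
clear near_gt0 near_loc near_sieve near_M near_dist1 near_dist2 near_full near_prior loc hN.
set r := Num.sqrt n%:R in hA hE hfull.
have r0 : 0 < r by rewrite sqrtr_gt0 ltr0n.
pose TR := measurableTypeR R.
pose L : set (borel H1) := H_ n `&` [set f | ns_set H f /\ ns_norm H f < M]
  `&` [set f | `|K th0 (f - f0)| < dl]
  `&` (ns_set H `&` [set f | `|Kdot K Theta th0 (f - f0)| < dl]).
have mL : measurable L.
  apply: measurableI; last exact: mKd.
  by apply: measurableI => //; apply: measurableI.
have LH : L `<=` ns_set H by move=> f [[[Hnf _] _] _]; exact: subH_ Hnf.
pose Zset : set (TR * TR) := [set z | `|z.1 - th0| < dl /\ `|r * (z.1 - z.2)| <= A].
have mZ : measurable Zset.
  apply: measurableI.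
    apply: measurable_set_lt => //; apply: measurableT_comp => //.
    by apply: measurable_funB.
  apply: measurable_set_le => //; apply: measurableT_comp => //.
  by apply: measurable_funM => //; apply: measurable_funB.
have ZT z : Zset z -> Theta z.1 /\ Theta z.2.
  move=> [/= h1 h2]; have h3 : `|z.1 - z.2| <= dl.
    by rewrite -(ler_pM2l r0) -{1}(gtr0_norm r0) -normrM (le_trans h2)// mulrC.
  split; apply: ballT; apply: le_trans dlx0; first by rewrite (le_trans (ltW h1))// ler_peMl ?(ltW dl_gt0)// ler1n.
  have -> : z.2 - th0 = (z.1 - th0) - (z.1 - z.2) by ring.
  apply: le_trans (ler_normB _ _) (le_trans (lerD (ltW h1) h3) _).
  by rewrite (_ : dl + dl = 2 * dl) ?ler_pM2r ?ler_nat//; ring.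
pose cc (q : (TR * TR) * Omega) : R := r * (q.1.1 - q.1.2) * W g q.2
  - r * (q.1.1 - q.1.2) * (r * (q.1.1 - th0)) * i0
  + (r * (q.1.1 - q.1.2)) ^+ 2 * i0 / 2 + kap / 2 * (1 + `|r * (q.1.1 - th0)|).
have mcc : measurable_fun setT cc.
  have m1 : measurable_fun setT (fun q : (TR * TR) * Omega => q.1.1 : TR).
    exact: (measurableT_comp measurable_fst).
  have m2 : measurable_fun setT (fun q : (TR * TR) * Omega => q.1.2 : TR).
    exact: (measurableT_comp measurable_snd).
  have mu' : measurable_fun setT (fun q : (TR * TR) * Omega => r * (q.1.1 - q.1.2)).
    by apply: measurable_funM => //; exact: measurable_funB.
  have ms : measurable_fun setT (fun q : (TR * TR) * Omega => r * (q.1.1 - th0)).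
    by apply: measurable_funM => //; exact: measurable_funB.
  have mWg : measurable_fun setT (fun q : (TR * TR) * Omega => W g q.2).
    exact: (measurableT_comp (iso_measurable isoW g) measurable_snd).
  apply: measurable_funD; [apply: measurable_funD; [apply: measurable_funB|]|].
  - exact: measurable_funM.
  - by apply: measurable_funM => //; exact: measurable_funM.
  - by apply: measurable_funM => //; apply: measurable_funM => //; exact: measurable_funX.
  - by apply: measurable_funM => //; apply: measurable_funD => //; exact: measurableT_comp.
have := @expansion_ae _ _ _ K Theta H pi_theta pi_f _ _ P W (K th0 f0) (gam_ n) n Zset L E cc
  sepH1 mTheta mH isoW mK mZ mL mE LH (H_gam_ n) ZT mcc.
have hgap z f : Zset z -> L f -> {ae P, forall w, E w ->
    log_likelihood n (observation W n (K th0 f0) w) (K z.1 f) -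
    log_likelihood n (observation W n (K th0 f0) w) (K z.2 (f + (z.1 - z.2) *: gam_ n)) <= cc (z, w)}.
  by move=> [z1 z2] [[[Hnf [_ nf]] b1] [_ b2]]; exact: hE.
move=> /(_ hgap) [Nul [mNul PNul subNul]].
pose S1 := [set w | ((1 - kap / 4)%:E <= joint_posterior K Theta H pi_theta pi_f n
  (data K W th0 f0 n w) (Theta_ n `*` H_ n))%E].
pose S2 := [set w | ((1 - kap / 4)%:E <= joint_posterior K Theta H pi_theta pi_f n
  (data K W th0 f0 n w) (setT `*` [set f | ns_set H f /\ (ns_norm H f < M)%R]))%E].
pose S3 := [set w | ((1 - kap / 4)%:E <= joint_posterior K Theta H pi_theta pi_f n
  (data K W th0 f0 n w) [set q | param_set Theta H q /\ (`|q.1 - th0| + `|K th0 (q.2 - f0)| < dl)%R])%E].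
pose S4 := [set w | ((1 - kap / 4)%:E <= joint_posterior K Theta H pi_theta pi_f n
  (data K W th0 f0 n w) [set q | param_set Theta H q /\ (`|Kdot K Theta th0 (q.2 - f0)| < dl)%R])%E].
pose VV := [set w | v0 <= `|W g w|].
have PV : (P VV <= pr%:E)%E.
  apply: le_trans (iso_chebyshev isoW g v00) _; rewrite lee_fin.
  rewrite ler_pdivrMr ?exprn_gt0// /v0 sqr_sqrtr; last by rewrite divr_ge0// ltW.
  by rewrite mulrC divfK// gt_eqF.
have mVV : measurable VV.
  apply: measurable_set_le => //; apply: measurableT_comp => //; exact: (iso_measurable isoW).
apply: (@le_trans _ _ (mu_ext P (~` S1 `|` (~` S2 `|` (~` S3 `|` (~` S4 `|` (~` E `|` (VV `|` Nul)))))))).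
  apply: le_mu_ext => w /= tvw; apply: contrapT => nbad.
  have [s1 [s2 [s3 [s4 [Ew [Vw Nw]]]]]] : S1 w /\ S2 w /\ S3 w /\ S4 w /\ E w /\ ~ VV w /\ ~ Nul w.
    exact: not_union7.
  have {}Vw : `|W g w| <= v0 by move/negP: Vw; rewrite -ltNge => /ltW.
  have hexp : {ae (pi_theta \x pi_theta)%E, forall z, Zset z -> {ae pi_f, forall f, L f ->
    log_likelihood n (observation W n (K th0 f0) w) (K z.1 f) -
    log_likelihood n (observation W n (K th0 f0) w) (K z.2 (f + (z.1 - z.2) *: gam_ n)) <= cc (z, w)}}.
    by apply: contrapT => hn; apply: Nw; apply: subNul => /= h; apply: hn; exact: h.
  have mx := measurable_observation n (K th0 f0) w isoW.
  have dens' th : Theta_ n th -> is_density (pushforward pi_f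
      ((fun f => f + (th - th0) *: gam_ n) : borel H1 -> borel H1)) pi_f (p n th).
    exact: dens_p.
  have prior' th f : Theta_ n th -> L f -> `|r * (th - th0)| <= A ->
     expR (- (kap / 2)) <= p n th f.
    move=> Tth [[[Hnf _] _] _] hr.
    have q0' : 0 < 1 + n%:R * (th - th0) ^+ 2.
      by rewrite ltr_wpDr// mulr_ge0// sqr_ge0.
    have [p_ge0 _ _] := dens_p n th Tth.
    have h := prior_ratio_ge (p_ge0 f) q0' (le_lt_trans _ hprior).
    apply: le_trans (h _); last by apply: ereal_sup_ubound; exists (th, f).
    rewrite ler_expR lerN2 /c mulrAC ler_pdivrMr// ler_pM2l// lerD2l.
    have -> : n%:R * (th - th0) ^+ 2 = (r * (th - th0)) ^+ 2.
      by rewrite exprMn sqr_sqrtr.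
    by rewrite -real_normK ?num_real// lerXn2r ?nnegrE// (le_trans _ A1).
  have mass : ((1 - kap)%:E <= joint_posterior K Theta H pi_theta pi_f n (data K W th0 f0 n w)
     ((Theta_ n `&` [set th | (`|th - th0| < dl)%R]) `*` L))%E.
    have mB1 : measurable (Theta_ n `*` H_ n : set (TR * borel H1)) by exact: measurableX.
    have mB2 : measurable (setT `*` [set f | ns_set H f /\ ns_norm H f < M] : set (TR * borel H1)).
      exact: measurableX.
    have k4 : (0 < (1 - kap / 4)%:E)%E by rewrite lte_fin subr_gt0.
    have [Z Z0 hZ] := posterior_total mTheta mH mK mx mB1 (lt_le_trans k4 s1).
    have post12 := posteriorI mTheta mH mK mx Z0 hZ mB1 mB2 s1 s2.
    have post123 := posteriorI mTheta mH mK mx Z0 hZ (measurableI _ _ mB1 mB2) (mdist1 dl) post12 s3.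
    have mB123 := measurableI _ _ (measurableI _ _ mB1 mB2) (mdist1 dl).
    have post1234 := posteriorI mTheta mH mK mx Z0 hZ mB123 (mdist2 dl) post123 s4.
    have -> : 1 - kap = 1 - (kap / 4 + kap / 4 + kap / 4 + kap / 4) by field.
    apply: le_trans post1234 _; apply: (posterior_le mTheta mH mK mx Z0 hZ).
    - by apply: measurableI => //; exact: mdist2.
    - apply: measurableX => //; apply: measurableI => //; apply: measurable_set_lt => //.
      by apply: measurableT_comp => //; exact: measurable_funB.
    move=> [th f] [[[[/= Tth Hnf] [_ [Hf nf]]] [_ hb]] [_ hd]]; split=> /=.
      by split => //; apply: le_lt_trans hb; rewrite lerDl.
    split=> //; split=> //=; apply: le_lt_trans hb; rewrite lerDr//.
  have := close _ _ _ _ _ _ _ n (data K W th0 f0 n w) th0 x0 dl rad q0 (W g w) (Theta_ n) L (gam_ n) (p n)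
    mTheta mH mK cK mx ballT (mTheta_ n) mL LH (H_gam_ n) n0 Vw q00 dl_gt0 dlx0 dlrho
    hA densrad hfull dens' prior' hexp mass.
  move=> tvle; move: tvw; rewrite sube0 gee0_abs; last first.
    rewrite /tv_norm mule_ge0//.
    by apply: le_trans (abse_ge0 _) (ereal_sup_ubound _); exists set0.
  rewrite leNgt => /negP; apply; apply: le_lt_trans tvle _; rewrite lte_fin.
  by rewrite mulrCA gtr_pMr// ltr_pdivrMr// mul1r ltr_nat.
have sumle (x1 x2 x3 x4 x5 x6 : \bar R) : (x1 <= pr%:E)%E -> (x2 <= pr%:E)%E ->
    (x3 <= pr%:E)%E -> (x4 <= pr%:E)%E -> (x5 <= pr%:E)%E -> (x6 <= pr%:E)%E ->
    (x1 + (x2 + (x3 + (x4 + (x5 + (x6 + 0))))) <= eta%:E)%E.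
  move=> *; apply: (@le_trans _ _ (pr + (pr + (pr + (pr + (pr + (pr + 0))))))%:E).
    by rewrite !EFinD; repeat apply: leeD.
  by rewrite lee_fin /pr; move: eta0; lra.
apply: le_trans (sumle _ _ _ _ _ _ hsieve hM hd1 hd2 PE PV).
rewrite -(measurable_mu_extE P (measurableC mE)) -(measurable_mu_extE P mVV) -PNul -(measurable_mu_extE P mNul).
by repeat (apply: le_trans (mu_ext_setU _ _ _) _; apply: leeD => //).
Qed.
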